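(* Let $q=e^{2\pi i\tau}$, $t(\tau)=\eta(3\tau)^{12}/\eta(\tau)^{12}$ and $B_n=(-1)^nA_n$, where $A_n=27^n[z^n]\,{}_2F_1(\tfrac13,\tfrac13;1;z)^3$. Then \[ \sum_{n\ge0}B_n\,t(\tau)^n=\frac{\eta(\tau)^9}{\eta(3\tau)^3}. \] Consequently, with $C(q):=\Bigl(\sum_{n\ge0}B_nt^n\Bigr)\cdot\frac{q}{t}\cdot\frac{dt}{dq}$, one has $C(q)=3E_{5,\chi_0,\chi_3}(\tau)$, and writing $C(q)=1+\sum_{n\ge1}c_nq^n$, \[ c_n=3\sum_{d\mid n}\chi_3(d)d^4. \]
   Context: $\eta(\tau)=q^{1/24}\prod_{n\ge1}(1-q^n)$ is the Dedekind eta function. $\chi_3(n)=\left(\frac{n}{3}\right)$ and $\chi_0$ is the trivial character. $E_{5,\chi_0,\chi_3}$ denotes the weight-5 Eisenstein series on $\Gamma_0(3)$ with character $\chi_3$, normalized to have constant term $1/3$ times... more precisely normalized so that its $n$-th Fourier coefficient ($n\ge1$) is $\sum_{d\mid n}\chi_3(d)d^4$ and $3E_{5,\chi_0,\chi_3}$ has constant term $1$. *)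

(* Defs.v *)
From mathcomp Require Import all_boot all_order all_algebra complex.
From mathcomp Require Import all_classical all_reals all_analysis.

Set Implicit Arguments.
Unset Strict Implicit.
Unset Printing Implicit Defensive.

Import Order.TTheory GRing.Theory Num.Theory numFieldNormedType.Exports.

Local Open Scope classical_set_scope.
Local Open Scope ring_scope.
Local Open Scope complex_scope.

(* [R[i]] carries the topology of its norm, and complex differentiation
   ([derive1]), through the regular module [R[i]^o]. *)
Notation Cplx R := (R[i]^o) (only parsing).

Definition legendre (p n : nat) : int :=
  if (p %| n)%N then 0
  else if [exists x : 'I_p, x ^ 2 == n %[mod p]]%N then 1 else -1.

Definition chi3 (n : nat) : int := legendre 3 n.

(* sum over d | n of chi_3(d) d^4, for n >= 1 *)
Definition sigma4_chi3 (n : nat) : int :=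
  \sum_(d <- divisors n) chi3 d * d%:Z ^+ 4.

Definition pochhammer (a : rat) (n : nat) : rat := \prod_(i < n) (a + i%:R).

(* [z^n] 2F1(a, b; c; z) *)
Definition hyp2F1_coef (a b c : rat) (n : nat) : rat :=
  pochhammer a n * pochhammer b n / (pochhammer c n * n`!%:R).

(* The n-th coefficient of the cube of a power series only depends on its
   truncation modulo z^(n+1). *)
Definition A_ (n : nat) : rat :=
  27 ^+ n * ((\poly_(k < n.+1) hyp2F1_coef (1 / 3) (1 / 3) 1 k) ^+ 3)`_n.

Definition B_ (n : nat) : rat := (-1) ^+ n * A_ n.

Section ComplexFunctions.
Context {R : realType}.
Local Notation C := (Cplx R).

Definition cexp (z : C) : C := (expR (complex.Re z))%:C * (cos (complex.Im z) +i* sin (complex.Im z)).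

Definition two_pi_i : C := 0 +i* (2 * pi).

Definition nome (tau : C) : C := cexp (two_pi_i * tau).

Definition eta (tau : C) : C :=
  cexp (two_pi_i * tau / 24) *
  limn (fun N : nat => \prod_(1 <= n < N) (1 - nome tau ^+ n) : C).

Definition t_ (tau : C) : C := eta (3 * tau) ^+ 12 / eta tau ^+ 12.

(* A function f on the upper half-plane with f(tau + 1) = f(tau), seen as a
   function of q = exp(2 i pi tau) on 0 < |q| < 1. *)
Definition in_q (f : C -> C) (q : C) : C :=
  f (xget 0 [set tau : C | 0 < complex.Im tau /\ nome tau = q]).

(* partial sums of sum_n B_n x^n *)
Definition B_series (x : C) : nat -> C :=
  series (fun n : nat => ratr (B_ n) * x ^+ n : C).

Definition C_ (q : C) : C :=
  limn (B_series (in_q t_ q)) * (q / in_q t_ q) * derive1 (in_q t_) q.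

(* E_{5,chi_0,chi_3}, given by its Fourier expansion at infinity *)
Definition E5 (tau : C) : C :=
  1 / 3 +
  limn (fun N : nat => \sum_(1 <= n < N) (sigma4_chi3 n)%:~R * nome tau ^+ n : C).

(* The power series sum_n B_n x^n has radius of convergence 1/27.  Since t is
   invariant under Gamma_0(3) while eta(tau)^9 / eta(3 tau)^3 has weight 3, the
   condition |t(tau)| < 1/27 alone does not select the branch of the sum which
   is attached to the cusp at infinity; asking for it along the whole vertical
   half-line from tau to infinity does. *)
Definition cusp_domain (tau : C) : Prop :=
  0 < complex.Im tau /\ forall s : R, 0 <= s -> `|t_ (tau + (0 +i* s))| < 1 / 27.

(* f(q) = 1 + sum_{n >= 1} c_n q^n for all q <> 0 close to 0 *)
Definition has_q_expansion (f : C -> C) (c : nat -> C) : Prop :=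
  \forall q \near (0 : C)^',
    (fun N : nat => 1 + \sum_(1 <= n < N) c n * q ^+ n : C) @ \oo --> f q.

End ComplexFunctions.

(* Main.v *)
(** Put [u_n = q^n / (1 - q^n)], so that [u_n u_m = u_(n+m) (1 + u_n + u_m)].  Summing this
    relation against a function [Phi] on the triples [x + y + z = 0] which is even and symmetric
    evaluates the sum of the [u_n u_m (Phi(n, m) - Phi(n, -m))], as in Liouville's elementary
    method.  Five functions [Phi] depending on residues modulo 3 give the differential system,
    with respect to [D = q d/dq], of
      [a = 1 + 6 sum chi_3(n) u_n],  [beta = 1 - 9 sum n^2 chi_3(n) u_n]  and  [sum n u_n],
    together with [a^2 beta = 1 + 3 sum n^4 chi_3(n) u_n = 3 E_5].  Comparing logarithmic
    derivatives of products and Lambert series yields, with [b = eta(tau)^3 / eta(3 tau)],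
      [beta = b^3],  [D t / t = a^2]  and  [a^3 = (1 + 27 t) beta].
    For [F(w) = 2F1(1/3, 1/3; 1; -w)] the hypergeometric equation then says exactly that
    [D (D (F(27 t) / b)) = 0].  On a segment from the cusp [q = 0] this forces [F(27 t) / b] to
    be constant, equal to 1.  Hence [sum B_n t^n = F(27 t)^3 = b^3], and
    [C = b^3 (D t / t) = beta a^2]. *)

(* Identities between the functions of [q] are obtained as first integrals on the disk [absc q < 1]:
   a quotient has zero derivative along the segment from 0 to [q], so its value can be read at the
   cusp, where the Lambert series vanish and the Euler products are 1. There the operator [q d/dq]
   degenerates, which is why the mean value inequality asks for derivatives inside the segment only,
   with continuity at its ends. Squares [u_n^2] enter Liouville's identity through the value of
   [Phi] at [(n, -n, 0)]; since [D u_n = n (u_n + u_n^2)], a nonzero value there yields a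
   derivative, and a zero value an algebraic relation. The obstacle in the last step is convergence:
   the series of [F] is available for [|27 t| < 1], so the constancy of [F(27 t) / b] is propagated
   along a segment that stays in this domain. The second-order equation leaves two constants, and
   both are fixed at [q = 0]. *)
Require Import Defs.
From mathcomp Require Import all_boot all_order all_algebra complex.
From mathcomp Require Import all_classical all_reals all_analysis.
From mathcomp Require Import ring lra.
Set Implicit Arguments.
Unset Strict Implicit.
Unset Printing Implicit Defensive.
Import Order.TTheory GRing.Theory Num.Theory numFieldNormedType.Exports.
Local Open Scope classical_set_scope.
Local Open Scope ring_scope.
Local Open Scope complex_scope.

(** * Norm and limits in R[i] *)

Section ComplexNorm.
Context {R : realType}.
Local Notation C := (Cplx R).

(* The norm of [R[i]] is valued in [R[i]]; this is the same norm with values in [R]. *)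
Definition absc (z : C) : R := Normc.normc (z : R[i]).

Lemma normE (z : C) : `|z| = (absc z)%:C.
Proof. by rewrite /absc /Num.norm /=. Qed.

Lemma absc_ge0 z : 0 <= absc z.
Proof. by rewrite -lecR -normE normr_ge0. Qed.

Lemma absc0 : absc 0 = 0. Proof. exact: Normc.normc0. Qed.
Lemma absc1 : absc 1 = 1. Proof. exact: Normc.normc1. Qed.
Lemma abscM (x y : C) : absc (x * y) = absc x * absc y.
Proof. exact: (@Normc.normcM R). Qed.
Lemma abscD (x y : C) : absc (x + y) <= absc x + absc y.
Proof. exact: (@le_normcD R). Qed.
Lemma abscN (x : C) : absc (- x) = absc x.
Proof. exact: (@normcN R). Qed.
Lemma abscV (x : C) : absc x^-1 = (absc x)^-1.
Proof. exact: (@Normc.normcV R). Qed.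
Lemma absc_eq0 (x : C) : (absc x == 0) = (x == 0).
Proof.
by apply/eqP/eqP => [|->]; [exact: (@Normc.eq0_normc R)|exact: absc0].
Qed.
Lemma abscB (x y : C) : absc (x - y) <= absc x + absc y.
Proof. by rewrite -(abscN y) abscD. Qed.
Lemma abscC (x y : C) : absc (x - y) = absc (y - x).
Proof. by rewrite -abscN opprB. Qed.
Lemma abscX (x : C) n : absc (x ^+ n) = absc x ^+ n.
Proof. by elim: n => [|n ih]; rewrite ?expr0 ?absc1// !exprS abscM ih. Qed.
Lemma absc_real (r : R) : absc (r%:C : C) = `|r|.
Proof. by rewrite /absc/= expr0n /= addr0 sqrtr_sqr. Qed.
Lemma absc_nat n : absc (n%:R : C) = n%:R.
Proof.
have -> : (n%:R : C) = (n%:R : R)%:C by rewrite rmorph_nat.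
by rewrite absc_real ger0_norm.
Qed.
Lemma absc_lt1 (x : C) (r : R) : (`|x| < r%:C) = (absc x < r).
Proof. by rewrite normE ltcR. Qed.
Lemma absc_sum (I : Type) (s : seq I) (P : pred I) (f : I -> C) :
  absc (\sum_(i <- s | P i) f i) <= \sum_(i <- s | P i) absc (f i).
Proof.
elim/big_ind2: _ => [|x a y b xa yb|//]; first by rewrite absc0.
by rewrite (le_trans (abscD _ _))// lerD.
Qed.
Lemma Re_le_absc (x : C) : `|complex.Re x| <= absc x.
Proof. by rewrite -lecR -normE; exact: (@normc_ge_Re R). Qed.
Lemma Im_le_absc (x : C) : `|complex.Im x| <= absc x.
Proof.
case: x => a b; rewrite /absc/= -sqrtr_sqr ler_sqrt ?lerDr ?sqr_ge0//.
by rewrite addr_ge0// sqr_ge0.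
Qed.
Lemma absc_le_ReIm (x : C) : absc x <= `|complex.Re x| + `|complex.Im x|.
Proof.
have -> : absc x = absc ((complex.Re x)%:C + (0 +i* 1) * (complex.Im x)%:C).
  by congr absc; case: x => a b; apply/eqP;
     rewrite eq_complex /=; apply/andP; split; apply/eqP; ring.
rewrite (le_trans (abscD _ _))// abscM !absc_real.
have -> : absc (0 +i* 1 : C) = 1 by rewrite /absc/= expr0n/= add0r expr1n sqrtr1.
by rewrite mul1r.
Qed.

Lemma cvg_absP (z : nat -> C) (l : C) :
  z @ \oo --> l <->
  forall e : R, 0 < e -> exists M, forall n, (M <= n)%N -> absc (z n - l) < e.
Proof.
split=> [/cvgrPdist_lt zl e e0|zl].
  have e0' : (0 : R[i]) < e%:C by rewrite ltcR.
  have [M _ HM] := zl _ e0'.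
  by exists M => n Mn; rewrite abscC -absc_lt1; exact: HM.
(* A positive element of [R[i]] has imaginary part 0, so the radius is a real number. *)
apply/cvgrPdist_lt => -[e i] /=; rewrite ltcE /= => /andP[/eqP ie e0].
have [M HM] := zl _ e0; exists M => // n /= Mn.
by rewrite ie (absc_lt1 (l - z n) e) abscC; exact: HM.
Qed.

Lemma near_absP (P : C -> Prop) (x : C) :
  (\forall y \near x, P y) <-> exists2 d : R, 0 < d &
     forall y, absc (y - x) < d -> P y.
Proof.
split=> [/nbhs_ballP[[d i] /=]|[d d0 H]].
  rewrite ltcE /= => /andP[/eqP id d0] H.
  exists d => // y yd; apply: H.
  by rewrite -ball_normE /= id absc_lt1 abscC.
apply/nbhs_ballP; exists (d%:C); first by rewrite /= ltcR.
by move=> y; rewrite -ball_normE /= absc_lt1 => yd; apply: H; rewrite abscC.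
Qed.

Lemma cvg_realP (u : nat -> R) (l : R) :
  u @ \oo --> l <->
  forall e : R, 0 < e -> exists M, forall n, (M <= n)%N -> `|u n - l| < e.
Proof.
split=> [/cvgrPdist_lt zl e e0|zl].
  have [M _ HM] := zl _ e0.
  by exists M => n Mn; rewrite distrC; exact: HM.
apply/cvgrPdist_lt => e e0.
have [M HM] := zl _ e0; exists M => // n /= Mn.
by rewrite distrC; exact: HM.
Qed.

Lemma cvg_absc_squeeze (z : nat -> C) (l : C) (e : nat -> R) :
  (forall n, absc (z n - l) <= e n) -> e @ \oo --> 0 -> z @ \oo --> l.
Proof.
move=> ze /cvg_realP e0; apply/cvg_absP => d d0.
have [M HM] := e0 _ d0; exists M => n Mn.
have := HM _ Mn; rewrite subr0; apply: le_lt_trans.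
exact: le_trans (ze n) (ler_norm _).
Qed.

Lemma absc_dist (x y : C) : `|absc x - absc y| <= absc (x - y).
Proof.
rewrite ler_norml; apply/andP; split.
  have : absc y <= absc x + absc (x - y).
    by rewrite -{1}(subKr x y) abscB.
  by move=> h; lra.
have : absc x <= absc (x - y) + absc y by rewrite -{1}(subrK y x) abscD.
by move=> h; lra.
Qed.

Lemma cvg_absc (z : nat -> C) (l : C) :
  z @ \oo --> l -> (fun n => absc (z n)) @ \oo --> absc l.
Proof.
move=> /cvg_absP zl; apply/cvg_realP => e /zl [M HM]; exists M => n /HM.
exact/le_lt_trans/absc_dist.
Qed.

Lemma cvg_absc_le (z : nat -> C) (l : C) (B : R) :
  (forall n, absc (z n) <= B) -> z @ \oo --> l -> absc l <= B.
Proof.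
move=> zB zl; have := cvg_absc zl => H.
rewrite -(cvg_lim _ H)//; apply: limr_le; first by apply/cvg_ex; eexists; exact: H.
by near=> n; exact: zB.
Unshelve. all: by end_near. Qed.

Lemma cvg_absc_ge (z : nat -> C) (l : C) (B : R) :
  (forall n, B <= absc (z n)) -> z @ \oo --> l -> B <= absc l.
Proof.
move=> zB zl; have := cvg_absc zl => H.
rewrite -(cvg_lim _ H)//; apply: limr_ge; first by apply/cvg_ex; eexists; exact: H.
by near=> n; exact: zB.
Unshelve. all: by end_near. Qed.

Lemma cvgc_unique (z : nat -> C) (l l' : C) : z @ \oo --> l -> z @ \oo --> l' -> l = l'.
Proof. by move=> h h'; rewrite -(cvg_lim _ h)// -(cvg_lim _ h'). Qed.

Section Filters.
Context {T : Type} {F : set_system T} {FF : Filter F}.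
Implicit Types (f g : T -> C) (a b : C).

Lemma cvgc_nearP f a :
  f @ F --> a <-> forall e : R, 0 < e -> \forall t \near F, absc (f t - a) < e.
Proof.
split=> [/cvgrPdist_lt fa e e0|fa].
  have e0' : (0 : R[i]) < e%:C by rewrite ltcR.
  by apply: filterS (fa _ e0') => t; rewrite abscC (absc_lt1 (a - f t) e).
apply/cvgrPdist_lt => -[e i] /=; rewrite ltcE /= => /andP[/eqP -> e0].
by apply: filterS (fa _ e0) => t; rewrite abscC -(absc_lt1 (a - f t) e).
Qed.

Lemma cvgc_cst a : (fun _ : T => a) @ F --> a.
Proof.
by apply/cvgc_nearP => e e0; apply: nearW => t; rewrite subrr absc0.
Qed.

Lemma cvgcD f g a b : f @ F --> a -> g @ F --> b -> (fun t => f t + g t) @ F --> a + b.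
Proof.
move=> /cvgc_nearP fa /cvgc_nearP gb; apply/cvgc_nearP => e e0.
have e20 : 0 < e / 2 by rewrite divr_gt0.
apply: filterS2 (fa _ e20) (gb _ e20) => t ha hb.
rewrite [X in absc X](_ : _ = (f t - a) + (g t - b)); last by ring.
by rewrite (le_lt_trans (abscD _ _))//; lra.
Qed.

Lemma cvgcN f a : f @ F --> a -> (fun t => - f t) @ F --> - a.
Proof.
move=> /cvgc_nearP fa; apply/cvgc_nearP => e e0; apply: filterS (fa _ e0) => t.
by rewrite -opprD abscN.
Qed.

Lemma cvgcB f g a b : f @ F --> a -> g @ F --> b -> (fun t => f t - g t) @ F --> a - b.
Proof. by move=> fa /cvgcN; exact: cvgcD. Qed.

Lemma cvgcM f g a b : f @ F --> a -> g @ F --> b -> (fun t => f t * g t) @ F --> a * b.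
Proof.
move=> /cvgc_nearP fa /cvgc_nearP gb; apply/cvgc_nearP => e e0.
(* The radius [min 1 (e / 2k)] serves twice: its first entry bounds [absc (g t - b) + absc b] by
   [k], its second makes both error terms small. *)
pose k := 1 + absc a + absc b.
have a0 := absc_ge0 a; have b0 := absc_ge0 b.
have k0 : 0 < k by rewrite /k; lra.
have e20 : 0 < Num.min 1 (e / (k *+ 2)) by rewrite lt_min ltr01 divr_gt0// pmulrn_lgt0.
apply: filterS2 (fa _ e20) (gb _ e20) => t.
rewrite !lt_min => /andP[a1 a2] /andP[b1 b2].
rewrite [X in absc X](_ : _ = (f t - a) * (g t - b) + (f t - a) * b + a * (g t - b));
  last by ring.
rewrite (le_lt_trans (abscD _ _))// (@le_lt_trans _ _ (absc ((f t - a) * (g t - b)) +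
  absc ((f t - a) * b) + absc (a * (g t - b))))//; first by rewrite lerD2r abscD.
rewrite !abscM.
have ha := absc_ge0 (f t - a); have hb := absc_ge0 (g t - b).
have h1 : absc (f t - a) * (absc (g t - b) + absc b) <= e / (k *+ 2) * k.
  by apply: ler_pM => //; rewrite /k; lra.
have h2 : absc a * absc (g t - b) <= k * (e / (k *+ 2)).
  by apply: ler_pM => //; rewrite /k; lra.
have h3 : absc a * absc (g t - b) < k * (e / (k *+ 2)).
  apply: (@le_lt_trans _ _ (k * absc (g t - b))).
    by rewrite ler_wpM2r// /k; lra.
  by rewrite ltr_pM2l.
have h4 : e / (k *+ 2) * k = e / 2 by field; rewrite ?lt0r_neq0.
by move: h1 h3; rewrite mulrDr [k * _]mulrC h4 => h1 h3; lra.
Qed.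

Lemma cvgcV f a : a != 0 -> f @ F --> a -> (fun t => (f t)^-1) @ F --> a^-1.
Proof.
move=> a0 /cvgc_nearP fa; apply/cvgc_nearP => e e0.
have A0 : 0 < absc a by rewrite lt_neqAle absc_ge0 andbT eq_sym absc_eq0.
have e1 : 0 < Num.min (absc a / 2) (e * absc a ^+ 2 / 2).
  by rewrite lt_min !divr_gt0// mulr_gt0// exprn_gt0.
apply: filterS (fa _ e1) => t; rewrite lt_min => /andP[h1 h2].
have hf : absc a / 2 < absc (f t).
  have : absc a <= absc (f t) + absc (f t - a) by rewrite -{1}(subKr (f t) a) abscB.
  by lra.
have f0 : f t != 0 by rewrite -absc_eq0 gt_eqF// (lt_trans _ hf)// divr_gt0.
have hfp : 0 < absc (f t) by lra.
have h3 : absc a ^+ 2 / 2 <= absc (f t) * absc a by nra.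
rewrite [X in absc X](_ : _ = - (f t - a) / (f t * a)); last by field; rewrite f0 a0.
rewrite abscM abscN abscV abscM ltr_pdivrMr ?mulr_gt0//.
by rewrite (lt_le_trans h2)// -mulrA ler_wpM2l// ltW.
Qed.

Lemma cvgc_near f g a : (\forall t \near F, f t = g t) -> f @ F --> a -> g @ F --> a.
Proof.
move=> fg /cvgc_nearP fa; apply/cvgc_nearP => e /fa.
by apply: filterS2 fg => t ->.
Qed.

Lemma cvgc_sum (I : Type) (s : seq I) (P : pred I) (f : I -> T -> C) (a : I -> C) :
  (forall i, P i -> f i @ F --> a i) ->
  (fun t => \sum_(i <- s | P i) f i t) @ F --> \sum_(i <- s | P i) a i.
Proof.
move=> fa; elim: s => [|i s ih].
  rewrite big_nil (_ : (fun t => _) = fun _ => 0); first exact: cvgc_cst.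
  by apply/funext => t; rewrite big_nil.
have [Pi|Pi] := boolP (P i).
  rewrite big_cons Pi (_ : (fun t => _) = fun t => f i t + \sum_(i <- s | P i) f i t); last first.
    by apply/funext => t; rewrite big_cons Pi.
  exact: (cvgcD (fa i Pi) ih).
rewrite big_cons (negbTE Pi) (_ : (fun t => _) = fun t => \sum_(i <- s | P i) f i t)//.
by apply/funext => t; rewrite big_cons (negbTE Pi).
Qed.

End Filters.

(* The filter [nbhs x] with real radii, for which [Filter] instances are found at once. *)
Definition near_c (x : C) : set_system C :=
  [set P | exists2 d : R, 0 < d & forall y, absc (y - x) < d -> P y].

Global Instance near_c_filter (x : C) : Filter (near_c x).
Proof.
split; first by exists 1.
  move=> P Q [d d0 HP] [e e0 HQ]; exists (Num.min d e); first by rewrite lt_min d0.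
  by move=> y; rewrite lt_min => /andP[/HP + /HQ].
by move=> P Q PQ [d d0 HP]; exists d => // y /HP /PQ.
Qed.

Lemma near_c_self (P : C -> Prop) (x : C) : near_c x P -> P x.
Proof. by case=> d d0; apply; rewrite subrr absc0. Qed.

Lemma cvgc_atP (f : C -> C) (x a : C) :
  f @ near_c x --> a <-> forall e : R, 0 < e -> exists2 d : R, 0 < d &
     forall y, absc (y - x) < d -> absc (f y - a) < e.
Proof. exact: cvgc_nearP. Qed.

Lemma cvgc_id (x : C) : (fun y : C => y) @ near_c x --> x.
Proof. by apply/cvgc_atP => e e0; exists e. Qed.

Lemma cvgc_comp (T : Type) (F : set_system T) (FF : Filter F) (f : T -> C) (g : C -> C) (a b : C) :
  f @ F --> a -> g @ near_c a --> b -> (fun y => g (f y)) @ F --> b.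
Proof.
move=> /cvgc_nearP fa /cvgc_atP gb; apply/cvgc_nearP => e /gb [d d0 H].
by apply: filterS (fa _ d0) => t /H.
Qed.

End ComplexNorm.

Section Families.
Context {R : realType}.
Local Notation C := (Cplx R).

(** The general rules are restated for the two filters in use, points and sequences: with the filter
    fixed, a limit can be built as a plain term such as [atM ua vb]. *)
Lemma at_cst (x : C) (a : C) : (fun _ : C => a) @ near_c x --> a.
Proof. exact: cvgc_cst. Qed.

Lemma atD (x : C) (f g : C -> C) (a b : C) : f @ near_c x --> a -> g @ near_c x --> b ->
  (fun t => f t + g t) @ near_c x --> a + b.
Proof. exact: cvgcD. Qed.

Lemma atB (x : C) (f g : C -> C) (a b : C) : f @ near_c x --> a -> g @ near_c x --> b ->
  (fun t => f t - g t) @ near_c x --> a - b.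
Proof. exact: cvgcB. Qed.

Lemma atM (x : C) (f g : C -> C) (a b : C) : f @ near_c x --> a -> g @ near_c x --> b ->
  (fun t => f t * g t) @ near_c x --> a * b.
Proof. exact: cvgcM. Qed.

Lemma atN (x : C) (f : C -> C) (a : C) : f @ near_c x --> a ->
  (fun t => - f t) @ near_c x --> - a.
Proof. exact: cvgcN. Qed.

Lemma atV (x : C) (f : C -> C) (a : C) : a != 0 -> f @ near_c x --> a ->
  (fun t => (f t)^-1) @ near_c x --> a^-1.
Proof. exact: cvgcV. Qed.

Lemma at_comp (x : C) (f : C -> C) (g : C -> C) (a b : C) : f @ near_c x --> a ->
  g @ near_c a --> b -> (fun t => g (f t)) @ near_c x --> b.
Proof. exact: cvgc_comp. Qed.

Lemma at_near (x : C) (f g : C -> C) (a : C) : (\forall t \near near_c x, f t = g t) ->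
  f @ near_c x --> a -> g @ near_c x --> a.
Proof. exact: cvgc_near. Qed.

Lemma sq_cst  (a : C) : (fun _ : nat => a) @ \oo --> a.
Proof. exact: cvgc_cst. Qed.

Lemma sqD  (f g : nat -> C) (a b : C) : f @ \oo --> a -> g @ \oo --> b ->
  (fun t => f t + g t) @ \oo --> a + b.
Proof. exact: cvgcD. Qed.

Lemma sqB  (f g : nat -> C) (a b : C) : f @ \oo --> a -> g @ \oo --> b ->
  (fun t => f t - g t) @ \oo --> a - b.
Proof. exact: cvgcB. Qed.

Lemma sqM  (f g : nat -> C) (a b : C) : f @ \oo --> a -> g @ \oo --> b ->
  (fun t => f t * g t) @ \oo --> a * b.
Proof. exact: cvgcM. Qed.

Lemma sqN  (f : nat -> C) (a : C) : f @ \oo --> a ->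
  (fun t => - f t) @ \oo --> - a.
Proof. exact: cvgcN. Qed.

Lemma sq_near  (f g : nat -> C) (a : C) : (\forall t \near \oo, f t = g t) ->
  f @ \oo --> a -> g @ \oo --> a.
Proof. exact: cvgc_near. Qed.

End Families.

Arguments cvgc_id {R} x.
Arguments at_cst {R} x a.
Arguments atD {R} {x} {f g a b}.
Arguments atB {R} {x} {f g a b}.
Arguments atM {R} {x} {f g a b}.
Arguments atN {R} {x} {f a}.
Arguments atV {R} {x} {f a}.
Arguments at_comp {R} {x} {f g a b}.
Arguments at_near {R} {x} {f g a}.
Arguments sq_cst {R} a.
Arguments sqD {R} {f g a b}.
Arguments sqB {R} {f g a b}.
Arguments sqM {R} {f g a b}.
Arguments sqN {R} {f a}.
Arguments sq_near {R} {f g a}.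

(** * Complex derivatives and the mean value inequality *)

Section Derivative.
Context {R : realType}.
Local Notation C := (Cplx R).

(* Caratheodory's form of complex differentiability. *)
Definition dv (f : C -> C) (x d : C) : Prop :=
  exists g : C -> C, [/\ g x = d, g @ near_c x --> d &
    forall y, f y - f x = (y - x) * g y].

Lemma dv_cvg f x d : dv f x d -> f @ near_c x --> f x.
Proof.
move=> [g [_ gd fg]].
have := atD (at_cst x (f x)) (atM (atB (cvgc_id x) (at_cst x x)) gd).
rewrite subrr mul0r addr0; apply: at_near.
by apply: nearW => y; rewrite -fg addrC subrK.
Qed.

Lemma dv_cst a x : dv (fun _ => a) x 0.
Proof.
by exists (fun _ => 0); split => //[|y]; [exact: at_cst|rewrite mulr0 subrr].
Qed.

Lemma dv_id x : dv (fun y => y) x 1.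
Proof.
by exists (fun _ => 1); split => //[|y]; [exact: at_cst|rewrite mulr1].
Qed.

Lemma dvD f g x a b : dv f x a -> dv g x b -> dv (fun y => f y + g y) x (a + b).
Proof.
move=> [u [ux ua fu]] [v [vx vb gv]]; exists (fun y => u y + v y).
split; [by rewrite ux vx|exact: (atD ua vb)|move=> y].
by rewrite mulrDr -fu -gv; ring.
Qed.

Lemma dvM f g x a b : dv f x a -> dv g x b ->
  dv (fun y => f y * g y) x (a * g x + f x * b).
Proof.
move=> df dg; have gx := dv_cvg dg.
move: df dg => [u [ux ua fu]] [v [vx vb gv]].
exists (fun y => u y * g y + f x * v y).
split; first by rewrite ux vx.
  exact: (atD (atM ua gx) (atM (at_cst x (f x)) vb)).
move=> y; have -> : f y = f x + (y - x) * u y by rewrite -fu addrC subrK.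
have -> : g y = g x + (y - x) * v y by rewrite -gv addrC subrK.
by ring.
Qed.

Lemma dv_eq f x a b : dv f x a -> a = b -> dv f x b.
Proof. by move=> h <-. Qed.

Lemma dvN f x a : dv f x a -> dv (fun y => - f y) x (- a).
Proof.
move=> df; have := dvM (dv_cst (-1) x) df.
rewrite (_ : (fun y => -1 * f y) = fun y => - f y); last first.
  by apply/funext => y; rewrite mulN1r.
by move/dv_eq; apply; rewrite mul0r add0r mulN1r.
Qed.

Lemma dvB f g x a b : dv f x a -> dv g x b -> dv (fun y => f y - g y) x (a - b).
Proof. by move=> df /dvN; exact: dvD. Qed.

Lemma dvX f x a n : dv f x a -> dv (fun y => f y ^+ n) x (n%:R * a * f x ^+ n.-1).
Proof.
move=> df; elim: n => [|n ih].
  by rewrite !mul0r; exact: dv_cst.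
have := dvM df ih; rewrite (_ : (fun y => f y * f y ^+ n) = fun y => f y ^+ n.+1); last first.
  by apply/funext => y; rewrite exprS.
move/dv_eq; apply; case: n {ih} => [|n] /=.
  by rewrite expr0 !mul0r mulr0; ring.
by rewrite exprS -[n.+2%:R]natr1; ring.
Qed.

(** The slope of the composite is the product of slopes [v (f y) * u y]; this avoids dividing by
    [f y - f x], which may vanish. *)
Lemma dv_comp f g x a b : dv f x a -> dv g (f x) b ->
  dv (fun y => g (f y)) x (b * a).
Proof.
move=> df; have fx := dv_cvg df.
case: df => [u [ux ua fu]] [v [vx vb gv]].
exists (fun y => v (f y) * u y); split; first by rewrite vx ux.
  exact: (atM (at_comp fx vb) ua).
by move=> y; rewrite gv fu; ring.
Qed.

(** The factorisation in [dv] is global while [f = g] holds only near [x]: the slope of [g] is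
    rebuilt as its own difference quotient, and its limit is taken from [f]. *)
Lemma dv_near f g x a : (\forall y \near near_c x, f y = g y) -> dv f x a -> dv g x a.
Proof.
move=> fg [u [ux ua fu]].
exists (fun y => if y == x then a else (g y - g x) / (y - x)).
have gx : f x = g x by exact: (near_c_self fg).
split; first by rewrite eqxx.
  apply: at_near ua; apply: filterS fg => y fgy.
  case: eqP => [->//|/eqP yx]; rewrite -fgy -gx fu mulrAC mulfV ?mul1r//.
  by rewrite subr_eq0.
move=> y; case: eqP => [->|/eqP yx]; first by rewrite !subrr mul0r.
by rewrite mulrCA mulfV ?mulr1// subr_eq0.
Qed.

Lemma dvV f x a : f x != 0 -> dv f x a -> dv (fun y => (f y)^-1) x (- a / f x ^+ 2).
Proof.
move=> fx0 df; have fx := dv_cvg df.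
have fne : \forall y \near near_c x, f y != 0.
  have : (0 : R) < absc (f x) by rewrite lt_neqAle absc_ge0 andbT eq_sym absc_eq0.
  move/(cvgc_atP _ _ _).1 : fx => /[apply] -[d d0 H].
  exists d => // y /H; apply: contraTneq => ->.
  by rewrite sub0r abscN ltxx.
(* [f1] equals [f] near [x] and vanishes nowhere, which gives its inverse a slope defined on the
   whole plane. *)
pose f1 y := if f y == 0 then f x else f y.
have ff1 : \forall y \near near_c x, f y = f1 y.
  by apply: filterS fne => y; rewrite /f1 => /negbTE ->.
have f10 y : f1 y != 0 by rewrite /f1; case: ifPn.
have f1x : f1 x = f x by rewrite /f1; case: ifP.
have df1 := dv_near ff1 df; have f1c := dv_cvg df1.
apply: (@dv_near (fun y => (f1 y)^-1)).
  by apply: filterS ff1 => y ->.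
case: df1 => u [ux ua fu].
exists (fun y => - u y / f1 y / f1 x); split.
- by rewrite ux f1x; field.
- have -> : - a / f x ^+ 2 = - a / f1 x / f1 x by rewrite f1x; field.
  exact: (atM (atM (atN ua) (atV (f10 x) f1c)) (at_cst x _)).
- move=> y; have -> : (f1 y)^-1 - (f1 x)^-1 = - (f1 y - f1 x) / f1 y / f1 x.
    by field; rewrite !f10.
  by rewrite fu; field; rewrite !f10.
Qed.

Lemma dv_div f g x a b : g x != 0 -> dv f x a -> dv g x b ->
  dv (fun y => f y / g y) x ((a * g x - f x * b) / g x ^+ 2).
Proof.
by move=> g0 df /(dvV g0) dg; apply: dv_eq (dvM df dg) _; field.
Qed.

Lemma dv_derive1 f x a : dv f x a -> derive1 f x = a.
Proof.
move=> [u [ux /cvgc_atP ua fu]]; apply: cvg_lim => //.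
apply/(@cvgc_nearP _ _ _ (dnbhs_filter (0 : C))) => e e0.
have [d d0 Hd] := ua _ e0; apply/near_absP; exists d => // h; rewrite subr0 => hd h0.
rewrite fu addrK /GRing.scale /= mulrA mulVf// mul1r.
by apply: Hd; rewrite addrK.
Qed.

(** The epsilon form of differentiability, in which the errors of a series can be added up; termwise
    differentiation is proved in it. *)
Lemma dvP f x a : dv f x a <-> forall e : R, 0 < e -> exists2 d : R, 0 < d &
  forall y, absc (y - x) < d -> absc (f y - f x - (y - x) * a) <= e * absc (y - x).
Proof.
split=> [[u [ux ua fu]] e e0|H].
  move: ua => /cvgc_atP /(_ _ e0) [d d0 Hd]; exists d => // y /Hd ue.
  by rewrite fu -mulrBr abscM mulrC ler_wpM2r ?absc_ge0// ltW.
exists (fun y => if y == x then a else (f y - f x) / (y - x)).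
split; first by rewrite eqxx.
  apply/cvgc_atP => e e0; have e20 : 0 < e / 2 by rewrite divr_gt0.
  have [d d0 Hd] := H _ e20; exists d => // y /Hd.
  case: eqP => [_ _|/eqP yx]; first by rewrite subrr absc0.
  move=> h; have yx0 : y - x != 0 by rewrite subr_eq0.
  have -> : (f y - f x) / (y - x) - a = (f y - f x - (y - x) * a) / (y - x) by field.
  have p0 : 0 < absc (y - x) by rewrite lt_neqAle absc_ge0 andbT eq_sym absc_eq0.
  rewrite abscM abscV ltr_pdivrMr//; apply: (le_lt_trans h).
  by rewrite ltr_pM2r//; lra.
move=> y; case: eqP => [->|/eqP yx]; first by rewrite !subrr mul0r.
by rewrite mulrCA mulfV ?mulr1// subr_eq0.
Qed.

(** A real-linear form [L] of norm at most 1 turns [f] on the segment into a real function, to which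
    the real mean value theorem applies. The instances are the real and the imaginary part. *)
Lemma mean_value_linear (L : C -> R) (f df : C -> C) (x h : C) (B : R) :
  (forall y, `|L y| <= absc y) -> (forall y z, L (y - z) = L y - L z) ->
  (forall (s : R) y, L (s%:C * y) = s * L y) ->
  (forall s : R, 0 <= s <= 1 -> f @ near_c (x + s%:C * h) --> f (x + s%:C * h)) ->
  (forall s : R, 0 < s < 1 -> dv f (x + s%:C * h) (df (x + s%:C * h))) ->
  (forall s : R, 0 < s < 1 -> absc (df (x + s%:C * h)) <= B) ->
  `|L (f (x + h) - f x)| <= B * absc h.
Proof.
move=> Lle LB LZ fc fd dB.
have lin0 (s : R) : (fun k : R => x + k%:C * h) @ s --> x + s%:C * h.
  apply/cvgc_nearP => e e0.
  have hp : 0 < absc h + 1 by rewrite ltr_wpDl ?absc_ge0.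
  near=> k.
  rewrite abscC.
  have -> : x + s%:C * h - (x + k%:C * h) = (s - k)%:C * h by rewrite rmorphB; ring.
  rewrite abscM absc_real (@le_lt_trans _ _ (`|s - k| * (absc h + 1)))//.
    by rewrite ler_wpM2l// lerDl.
  rewrite -ltr_pdivlMr//; near: k.
  by apply: (@cvgr_dist_lt _ _ _ _ _ (fun k : R => k) s) => //; rewrite divr_gt0.
have Lc (y : C) (F : set_system R) (FF : Filter F) (g : R -> C) :
    g @ F --> y -> (fun k => L (g k)) @ F --> L y.
  move=> gy; apply/cvgrPdist_lt => e e0.
  have e0' : (0 : R[i]) < e%:C by rewrite ltcR.
  have := (@cvgrPdist_lt _ _ _ F FF g y).1 gy _ e0'.
  apply: filterS => k; rewrite (absc_lt1 (y - g k) e); apply: le_lt_trans.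
  by rewrite -LB.
pose phi (s : R) := L (f (x + s%:C * h)).
have phid (s : R) : s \in `]0, 1[ -> is_derive s 1 phi (L (h * df (x + s%:C * h))).
  rewrite in_itv /= => s01; have [u [ux ua fu]] := fd s s01.
  suff H : (fun k : R => k^-1 *: (phi (k *: 1 + s) - phi s)) @ 0^' --> L (h * df (x + s%:C * h)).
    by apply: DeriveDef; [apply/cvg_ex; eexists; exact: H|exact: cvg_lim H].
  apply: (@cvg_trans _ ((fun k : R => L (h * u (x + (k + s)%:C * h))) @ 0^')).
    apply: near_eq_cvg; near=> k; have k0 : k != 0 by near: k; exact: nbhs_dnbhs_neq.
    rewrite /phi -LB /GRing.scale /= mulr1 fu.
    have -> : (x + (k + s)%:C * h - (x + s%:C * h)) * u (x + (k + s)%:C * h) =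
       k%:C * (h * u (x + (k + s)%:C * h)) by rewrite rmorphD; ring.
    by rewrite LZ mulrA mulVf// mul1r.
  apply: cvg_within_filter; apply: Lc.
  have k0 : (fun k : R => x + (k + s)%:C * h) @ (0 : R) --> x + s%:C * h.
    have k1 : (fun k : R => k + s) @ (0 : R) --> s.
      by rewrite -[X in _ --> X]add0r; apply: cvgD; [exact: cvg_id|exact: cvg_cst].
    exact: cvg_comp k1 (lin0 s).
  apply: cvgcM; first exact: cvgc_cst.
  exact: cvgc_comp k0 ua.
have phic : {within `[0, 1], continuous phi}.
  apply: continuous_in_subspaceT => s; rewrite inE /= in_itv /= => s01.
  apply: Lc; exact: cvgc_comp (lin0 s) (fc s s01).
have [c] := MVT ltr01 phid phic.
rewrite in_itv /= => c01.
rewrite subr0 mulr1 /phi -LB mul0r addr0 mul1r => ->.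
by rewrite (le_trans (Lle _))// abscM mulrC ler_wpM2r ?absc_ge0 ?dB.
Unshelve. all: by end_near. Qed.

(** The factor 2 comes from adding the bounds for the real and the imaginary part. *)
Lemma mean_value (f df : C -> C) (x h : C) (B : R) :
  (forall s : R, 0 <= s <= 1 -> f @ near_c (x + s%:C * h) --> f (x + s%:C * h)) ->
  (forall s : R, 0 < s < 1 -> dv f (x + s%:C * h) (df (x + s%:C * h))) ->
  (forall s : R, 0 < s < 1 -> absc (df (x + s%:C * h)) <= B) ->
  absc (f (x + h) - f x) <= 2 * B * absc h.
Proof.
move=> fc fd dB; rewrite (le_trans (absc_le_ReIm _))//.
have HR := @mean_value_linear (@complex.Re R) f df x h B.
have HI := @mean_value_linear (@complex.Im R) f df x h B.
rewrite -mulrA mulr_natl mulr2n; apply: lerD.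
  apply: HR => //; first exact: Re_le_absc.
    by move=> [? ?] [? ?].
  by move=> s [a b] /=; rewrite mul0r subr0.
apply: HI => //; first exact: Im_le_absc.
  by move=> [? ?] [? ?].
by move=> s [a b] /=; rewrite mul0r addr0.
Qed.

End Derivative.

(** * Liouville's method modulo 3 *)

Section Residues.
Context {R : realType}.
Local Notation C := (Cplx R).

Definition chi (n : nat) : C := (chi3 n)%:~R.
Definition three (n : nat) : C := (3 %| n)%:R.

Lemma chi3E n : chi3 n = if (n %% 3 == 0)%N then 0 else if (n %% 3 == 1)%N then 1 else -1.
Proof.
rewrite /chi3 /legendre /dvdn; case: ifPn => // n0.
case: ifPn => [/existsP[x]|/existsPn nx].
  have : (x < 3)%N by exact: ltn_ord.
  have : (n %% 3 < 3)%N by exact: ltn_pmod.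
  move: n0; case: (n %% 3)%N => [|[|[|]]]//= _ _.
  by case: x => -[|[|[|]]].
have := nx (@Ordinal 3 1 isT).
have : (n %% 3 < 3)%N by exact: ltn_pmod.
by move: n0; case: (n %% 3)%N => [|[|[|]]].
Qed.

Lemma residueP n : [\/ chi n = 0 /\ three n = 1, chi n = 1 /\ three n = 0 |
  chi n = -1 /\ three n = 0].
Proof.
rewrite /chi /three chi3E /dvdn; have : (n %% 3 < 3)%N by exact: ltn_pmod.
by case: (n %% 3)%N => [|[|[|]]]//= _; [constructor 1|constructor 2|constructor 3];
   rewrite ?rmorphN ?rmorph1 ?rmorph0.
Qed.

(* [chi (n - m)] and [three (n - m)] in terms of the residues of [n] and [m]. *)
Definition chi_sub (x a y b : C) : C := (x * (3 * b - 1) - (3 * a - 1) * y) / 2.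
Definition three_sub (x a y b : C) : C :=
  (2 + (3 * a - 1) * (3 * b - 1) + 3 * x * y) / 6.

(** As [3 * three n - 1] is [2 cos(2 pi n / 3)] and [chi n] is [2 sin(2 pi n / 3) / sqrt 3], this
    formula and the next are the addition formulas for sine and cosine. *)
Lemma chiD n m :
  chi (n + m) = (chi n * (3 * three m - 1) + (3 * three n - 1) * chi m) / 2.
Proof.
rewrite /chi /three !chi3E /dvdn -(modnDm n m).
have : (n %% 3 < 3)%N by exact: ltn_pmod.
have : (m %% 3 < 3)%N by exact: ltn_pmod.
case: (n %% 3)%N => [|[|[|]]]//=; case: (m %% 3)%N => [|[|[|]]]//= _ _;
  rewrite ?rmorphN ?rmorph1 ?rmorph0; by field.
Qed.

Lemma threeD n m :
  three (n + m) = (2 + (3 * three n - 1) * (3 * three m - 1) - 3 * chi n * chi m) / 6.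
Proof.
rewrite /chi /three !chi3E /dvdn -(modnDm n m).
have : (n %% 3 < 3)%N by exact: ltn_pmod.
have : (m %% 3 < 3)%N by exact: ltn_pmod.
case: (n %% 3)%N => [|[|[|]]]//=; case: (m %% 3)%N => [|[|[|]]]//= _ _;
  rewrite ?rmorphN ?rmorph1 ?rmorph0; by field.
Qed.

Lemma chiS n : chi n.+1 = (3 * three n - 1 - chi n) / 2.
Proof.
rewrite -addn1 chiD (_ : chi 1 = 1) 1?(_ : three 1 = 0)//; first by field.
by rewrite /chi chi3E.
Qed.

Lemma threeS n : three n.+1 = (1 - three n - chi n) / 2.
Proof.
rewrite -addn1 threeD (_ : chi 1 = 1) 1?(_ : three 1 = 0)//; first by field.
by rewrite /chi chi3E.
Qed.

(* [ker (chi n) (three n) n (chi m) (three m) m] is [Phi (n, -m, m - n)] for the following even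
   symmetric functions [Phi] on [x + y + z = 0], where [s = (x^2 + y^2 + z^2) / 2] and the triple
   is, modulo 3, either [0], or constant equal to [r = 1, -1], or a permutation of [(1, -1, 0)]:
     ker1: 0, 1, 0;                         ker2: 0, 0, x - y;
     ker3: 0, 10 r x y z, (x - y) x y;      ker4: 2 s, - 2 s, - z^2 / 2 - 2 x y;
     ker5: 0, r x y z, 0. *)
Definition ker1 (x a N y b M : C) : C :=
  (1 - a) * (1 - b) * (1 - x * y) / 2.

Definition ker2 (x a N y b M : C) : C :=
  N * x + M * y + (N - M) * chi_sub x a y b.

Definition ker3 (x a N y b M : C) : C :=
  a * y * (N - 2 * M) * M * (M - N) + b * x * (2 * N - M) * N * (M - N)
   - three_sub x a y b * x * (N + M) * N * M
   + 10 * N * M * (N - M) * x * y * chi_sub x a y b.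

Definition ker4 (x a N y b M : C) : C :=
  (2 * a * b - (1 - a) * (1 - b) * (1 - x * y)) * (N ^+ 2 - N * M + M ^+ 2)
   + a * (1 - b) * (2 * M * (M - N) - N ^+ 2 / 2)
   + b * (1 - a) * (2 * N * (N - M) - M ^+ 2 / 2)
   + (three_sub x a y b - a * b) * (2 * N * M - (M - N) ^+ 2 / 2).

Definition ker5 (x a N y b M : C) : C :=
  N * M * (N - M) * x * y * chi_sub x a y b.

(* Antidifferences in the first variable, vanishing at 1. *)
Definition prim1 (x a N y b M : C) : C :=
  ((- 3 - 3 * y + 3 * b - x + 3 * x * y + x * b + 3 * a + 3 * a * y - 3 * a * b)
   + N * (4 - 4 * b)) / 12.

Definition prim2 (x a N y b M : C) : C :=
  ((6 * y + 2 * x + 6 * x * b - 6 * a * y)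
   + M * (3 - 15 * y - 9 * b - 3 * x + 3 * x * y + 9 * x * b - 3 * a - 9 * a * y + 9 * a * b)
   + N * (1 - 3 * y + 3 * b - 3 * x - 3 * x * y - 9 * x * b - 3 * a + 9 * a * y - 9 * a * b)
   + N * M * (12 * y)) / 12.

Definition prim3 (x a N y b M : C) : C :=
  ((8 * x * b)
   + M * (- 18 + 6 * b - 6 * x * y + 18 * a - 6 * a * b)
   + M ^+ 2 * (6 * y - 22 * x + 18 * x * b - 6 * a * y)
   + M ^+ 3 * (12 * y - 4 * x * y + 12 * a * y)
   + N * (8 * b - 24 * a * b)
   + N * M * (- 20 * y + 36 * x - 12 * x * b + 36 * a * y)
   + N * M ^+ 2 * (- 11 - 27 * y + 9 * b + 33 * x - 3 * x * y - 27 * x * b + 33 * a + 9 * a * y - 27 * a * b)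
   + N * M ^+ 3 * (- 8 * y)
   + N ^+ 2 * (- 24 * x * b)
   + N ^+ 2 * M * (9 + 33 * y - 3 * b - 27 * x + 9 * x * y + 9 * x * b - 27 * a - 27 * a * y + 9 * a * b)
   + N ^+ 2 * M ^+ 2 * (24 * y)
   + N ^+ 3 * (- 4 * b + 12 * x * b + 12 * a * b)
   + N ^+ 3 * M * (- 16 * y)) / 12.

Definition prim4 (x a N y b M : C) : C :=
  ((- 6 * y - 2 * x + 2 * x * b + 6 * a * y)
   + M * (36 - 36 * b + 4 * x * y - 36 * a + 36 * a * b)
   + M ^+ 2 * (- 9 + 9 * y - 9 * b + 13 * x - 9 * x * y - 3 * x * b - 39 * a - 9 * a * y + 9 * a * b)
   + N * (- 8 + 16 * b + 12 * x * y + 12 * a - 12 * a * b)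
   + N * M * (- 30 + 2 * y + 54 * b - 18 * x - 6 * x * y + 18 * x * b + 54 * a - 6 * a * y - 54 * a * b)
   + N * M ^+ 2 * (- 4 + 12 * b)
   + N ^+ 2 * (15 + 3 * y - 39 * b + 3 * x - 9 * x * y - 3 * x * b - 9 * a - 9 * a * y + 9 * a * b)
   + N ^+ 2 * M * (12 - 36 * b)
   + N ^+ 3 * (- 8 + 24 * b)) / 24.

Definition prim5 (x a N y b M : C) : C :=
  (M * (- 6 + 6 * b - 2 * x * y + 6 * a - 6 * a * b)
   + M ^+ 2 * (6 * y - 6 * x + 6 * x * b - 6 * a * y)
   + N * M * (- 6 * y + 12 * x - 12 * x * b + 12 * a * y)
   + N * M ^+ 2 * (- 3 - 9 * y + 3 * b + 9 * x - 3 * x * y - 9 * x * b + 9 * a + 9 * a * y - 9 * a * b)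
   + N ^+ 2 * M * (3 + 9 * y - 3 * b - 9 * x + 3 * x * y + 9 * x * b - 9 * a - 9 * a * y + 9 * a * b)
   + N ^+ 2 * M ^+ 2 * (6 * y)
   + N ^+ 3 * M * (- 4 * y)) / 36.

Definition at_residues (k : C -> C -> C -> C -> C -> C -> C) (n m : nat) : C :=
  k (chi n) (three n) n%:R (chi m) (three m) m%:R.

(** A kernel is a polynomial in [n] with coefficients periodic modulo 3, so it has an antidifference
    [p] of the same shape. Giving [p] explicitly reduces [pS] to nine polynomial identities, one for
    each pair of residues. *)
Lemma sum_prim (k p : C -> C -> C -> C -> C -> C -> C) (m : nat) :
  (forall n, at_residues p n.+1 m = at_residues p n m + at_residues k n m) ->
  at_residues p 1 m = 0 -> (0 < m)%N ->
  \sum_(1 <= n < m) at_residues k n m = at_residues p m m.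
Proof.
move=> pS p1 m0; have H j : (0 < j)%N -> \sum_(1 <= n < j) at_residues k n m = at_residues p j m.
  elim: j => // -[|j] ih _; first by rewrite big_geq.
  by rewrite big_nat_recr//= ih// -pS.
exact: H.
Qed.

Ltac by_residues n := case: (residueP n) => -[-> ->].

Lemma residue0 : chi 0 = 0 /\ three 0 = 1.
Proof. by rewrite /chi chi3E. Qed.

Ltac expand_at_residues :=
  rewrite /at_residues /ker1 /ker2 /ker3 /ker4 /ker5 /prim1 /prim2 /prim3 /prim4 /prim5
    /chi_sub /three_sub.

(** The facts proved for each kernel are the hypotheses of [liouville]: the sum gives the
    coefficient of [u_m], [_sub] the products of Lambert series, [_sym] and [_symD] the symmetry and
    evenness of [Phi], and [_diag] the coefficient of [u_n^2]. *)
Lemma sum_ker1 m : (0 < m)%N ->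
  \sum_(1 <= n < m) at_residues ker1 n m =
  (m%:R * (1 - three m) - chi m) / 3.
Proof.
have [c0 e0] := residue0.
move=> m0; rewrite (@sum_prim _ prim1)//; expand_at_residues.
- by by_residues m; field.
- move=> n; rewrite chiS threeS -natr1.
  by by_residues m; by_residues n; field.
- by rewrite chiS threeS c0 e0; by_residues m; field.
Qed.

Lemma ker1_sub n m : at_residues ker1 n (n + m) - at_residues ker1 n m =
  chi n * chi m.
Proof.
expand_at_residues; rewrite chiD threeD ?natrD.
by by_residues m; by_residues n; field.
Qed.

Lemma ker1_sym n m : at_residues ker1 n m = at_residues ker1 m n.
Proof. by expand_at_residues; by_residues m; by_residues n; field. Qed.

Lemma ker1_symD n m : at_residues ker1 n (n + m) = at_residues ker1 m (n + m).
Proof.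
expand_at_residues; rewrite chiD threeD ?natrD.
by by_residues m; by_residues n; field.
Qed.

Lemma ker1_diag n : at_residues ker1 n n = 0.
Proof. by expand_at_residues; by_residues n; field. Qed.

Lemma sum_ker2 m : (0 < m)%N ->
  \sum_(1 <= n < m) at_residues ker2 n m =
  m%:R ^+ 2 * chi m - 2 * m%:R * chi m - m%:R * (3 * three m - 1) / 3 + 2 / 3 * chi m.
Proof.
have [c0 e0] := residue0.
move=> m0; rewrite (@sum_prim _ prim2)//; expand_at_residues.
- by by_residues m; field.
- move=> n; rewrite chiS threeS -natr1.
  by by_residues m; by_residues n; field.
- by rewrite chiS threeS c0 e0; by_residues m; field.
Qed.

Lemma ker2_sub n m : at_residues ker2 n (n + m) - at_residues ker2 n m =
  chi n * (m%:R * (3 * three m - 1)) + n%:R * (3 * three n - 1) * chi m.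
Proof.
expand_at_residues; rewrite chiD threeD ?natrD.
by by_residues m; by_residues n; field.
Qed.

Lemma ker2_sym n m : at_residues ker2 n m = at_residues ker2 m n.
Proof. by expand_at_residues; by_residues m; by_residues n; field. Qed.

Lemma ker2_symD n m : at_residues ker2 n (n + m) = at_residues ker2 m (n + m).
Proof.
expand_at_residues; rewrite chiD threeD ?natrD.
by by_residues m; by_residues n; field.
Qed.

Lemma ker2_diag n : at_residues ker2 n n = 2 * n%:R * chi n.
Proof. by expand_at_residues; by_residues n; field. Qed.

Lemma sum_ker3 m : (0 < m)%N ->
  \sum_(1 <= n < m) at_residues ker3 n m =
  2 * m%:R ^+ 3 * chi m - 4 / 3 * m%:R * three m - 2 * m%:R * (1 - three m).
Proof.
have [c0 e0] := residue0.
move=> m0; rewrite (@sum_prim _ prim3)//; expand_at_residues.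
- by by_residues m; field.
- move=> n; rewrite chiS threeS -natr1.
  by by_residues m; by_residues n; field.
- by rewrite chiS threeS c0 e0; by_residues m; field.
Qed.

Lemma ker3_sub n m : at_residues ker3 n (n + m) - at_residues ker3 n m =
  - 9 * (n%:R ^+ 2 * chi n * (m%:R * (1 - three m)) + n%:R * (1 - three n) * (m%:R ^+ 2 * chi m))
    - 6 * (n%:R ^+ 2 * chi n * (m%:R * three m) + n%:R * three n * (m%:R ^+ 2 * chi m)).
Proof.
expand_at_residues; rewrite chiD threeD ?natrD.
by by_residues m; by_residues n; field.
Qed.

Lemma ker3_sym n m : at_residues ker3 n m = at_residues ker3 m n.
Proof. by expand_at_residues; by_residues m; by_residues n; field. Qed.

Lemma ker3_symD n m : at_residues ker3 n (n + m) = at_residues ker3 m (n + m).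
Proof.
expand_at_residues; rewrite chiD threeD ?natrD.
by by_residues m; by_residues n; field.
Qed.

Lemma ker3_diag n : at_residues ker3 n n = - 2 * n%:R ^+ 3 * chi n.
Proof. by expand_at_residues; by_residues n; field. Qed.

Lemma sum_ker4 m : (0 < m)%N ->
  \sum_(1 <= n < m) at_residues ker4 n m =
  m%:R / 3 + 3 / 2 * m%:R * (1 - three m) - chi m / 3 + m%:R ^+ 2 * chi m / 2 - 2 * m%:R ^+ 2.
Proof.
have [c0 e0] := residue0.
move=> m0; rewrite (@sum_prim _ prim4)//; expand_at_residues.
- by by_residues m; field.
- move=> n; rewrite chiS threeS -natr1.
  by by_residues m; by_residues n; field.
- by rewrite chiS threeS c0 e0; by_residues m; field.
Qed.

Lemma ker4_sub n m : at_residues ker4 n (n + m) - at_residues ker4 n m =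
  4 * (n%:R * m%:R) - 9 * (n%:R * (1 - three n) * (m%:R * (1 - three m)))
    - 3 / 2 * (chi n * (m%:R ^+ 2 * chi m) + n%:R ^+ 2 * chi n * chi m).
Proof.
expand_at_residues; rewrite chiD threeD ?natrD.
by by_residues m; by_residues n; field.
Qed.

Lemma ker4_sym n m : at_residues ker4 n m = at_residues ker4 m n.
Proof. by expand_at_residues; by_residues m; by_residues n; field. Qed.

Lemma ker4_symD n m : at_residues ker4 n (n + m) = at_residues ker4 m (n + m).
Proof.
expand_at_residues; rewrite chiD threeD ?natrD.
by by_residues m; by_residues n; field.
Qed.

Lemma ker4_diag n : at_residues ker4 n n = 2 * n%:R ^+ 2.
Proof. by expand_at_residues; by_residues n; field. Qed.

Lemma sum_ker5 m : (0 < m)%N ->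
  \sum_(1 <= n < m) at_residues ker5 n m =
  (m%:R ^+ 4 * chi m - 4 * m%:R * (1 - three m) + 3 * m%:R ^+ 2 * chi m) / 18.
Proof.
have [c0 e0] := residue0.
move=> m0; rewrite (@sum_prim _ prim5)//; expand_at_residues.
- by by_residues m; field.
- move=> n; rewrite chiS threeS -natr1.
  by by_residues m; by_residues n; field.
- by rewrite chiS threeS c0 e0; by_residues m; field.
Qed.

Lemma ker5_sub n m : at_residues ker5 n (n + m) - at_residues ker5 n m =
  - (n%:R * (1 - three n) * (m%:R ^+ 2 * chi m) + n%:R ^+ 2 * chi n * (m%:R * (1 - three m))).
Proof.
expand_at_residues; rewrite chiD threeD ?natrD.
by by_residues m; by_residues n; field.
Qed.

Lemma ker5_sym n m : at_residues ker5 n m = at_residues ker5 m n.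
Proof. by expand_at_residues; by_residues m; by_residues n; field. Qed.

Lemma ker5_symD n m : at_residues ker5 n (n + m) = at_residues ker5 m (n + m).
Proof.
expand_at_residues; rewrite chiD threeD ?natrD.
by by_residues m; by_residues n; field.
Qed.

Lemma ker5_diag n : at_residues ker5 n n = 0.
Proof. by expand_at_residues; by_residues n; field. Qed.

End Residues.

(** * Liouville's elementary identity for finite sums *)

Section Liouville.
Context {K : comNzRingType}.

Lemma sum_square (f : nat -> nat -> K) M : (forall n m, f n m = f m n) ->
  \sum_(1 <= n < M) \sum_(1 <= m < M) f n m =
  2 * (\sum_(1 <= k < M) \sum_(1 <= n < k) f n k) + \sum_(1 <= n < M) f n n.
Proof.
move=> fC; elim: M => [|M ih]; first by rewrite !big_geq// mulr0 addr0.
case: M ih => [_|M ih]; first by rewrite !big_geq// mulr0 addr0.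
rewrite big_nat_recr//= (eq_bigr (fun n => \sum_(1 <= m < M.+1) f n m + f n M.+1)); last first.
  by move=> n _; rewrite big_nat_recr.
rewrite big_split /= ih [\sum_(1 <= m < M.+2) f M.+1 m]big_nat_recr//=.
rewrite [\sum_(1 <= k < M.+2) \sum_(1 <= n < k) _]big_nat_recr//=.
rewrite [\sum_(1 <= n < M.+2) f n n]big_nat_recr//=.
rewrite (eq_bigr (F1 := fun m => f M.+1 m) (fun m => f m M.+1)) => [|m _]; last exact: fC.
ring.
Qed.

(* If [B n m = Phi n (- m)] for an even symmetric function [Phi x y] of the triples
   [x + y + z = 0], then [Phi n m = B n (n + m)]. *)
Lemma liouville_sum (u : nat -> K) (B : nat -> nat -> K) M :
  (forall n m, (0 < n)%N -> (0 < m)%N -> u n * u m = u (n + m)%N * (1 + u n + u m)) ->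
  (forall n m, B n m = B m n) -> (forall n m, B n (n + m)%N = B m (n + m)%N) ->
  \sum_(1 <= k < M) \sum_(1 <= n < k) u n * u (k - n)%N * B n k -
  \sum_(1 <= n < M) \sum_(1 <= m < M) u n * u m * B n m =
  \sum_(1 <= k < M) u k * (\sum_(1 <= n < k) B n k) - \sum_(1 <= n < M) u n ^+ 2 * B n n.
Proof.
move=> uM BC BD.
rewrite (sum_square (f := fun n m => u n * u m * B n m)); last first.
  by move=> n m; rewrite BC [u n * _]mulrC.
(* The relation on [u] trades [u n * u (k - n)] for terms that contain [u k]; the reflection
   [n -> k - n] and [BD] identify the two quadratic ones. Their double then cancels the off-diagonal
   part of the sum over the square. *)
have step k : \sum_(1 <= n < k) u n * u (k - n)%N * B n k =
  u k * (\sum_(1 <= n < k) B n k) + 2 * \sum_(1 <= n < k) u n * u k * B n k.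
  have -> : \sum_(1 <= n < k) u n * u (k - n)%N * B n k =
      \sum_(1 <= n < k) (u k * B n k + (u n * u k * B n k + u k * u (k - n)%N * B n k)).
    apply: eq_big_nat => n /andP[n1 nk]; rewrite uM ?subn_gt0// subnKC ?(ltnW nk)//.
    by ring.
  rewrite !big_split /= -mulr_sumr.
  suff -> : \sum_(1 <= n < k) u k * u (k - n)%N * B n k =
      \sum_(1 <= n < k) u n * u k * B n k by ring.
  rewrite big_nat_rev; apply: eq_big_nat => n /andP[n1 nk].
  have -> : (1 + k - n.+1 = k - n)%N by rewrite add1n subSS.
  rewrite subKn ?(ltnW nk)// [u k * _]mulrC.
  have := BD n (k - n)%N; rewrite subnKC ?(ltnW nk)// => ->; by [].
rewrite (eq_bigr _ (fun k _ => step k)) big_split /= -mulr_sumr.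
under [\sum_(1 <= n < M) u n ^+ 2 * _]eq_bigr do rewrite expr2.
by ring.
Qed.

End Liouville.

(** * Dominated series *)

Section Series.
Context {R : realType}.
Local Notation C := (Cplx R).

Definition Sum (f : nat -> C) : C := limn (series f : nat -> C).

Lemma cvg_ReIm (z : nat -> C) (a b : R) :
  (fun n => complex.Re (z n)) @ \oo --> a -> (fun n => complex.Im (z n)) @ \oo --> b ->
  z @ \oo --> (a +i* b : C).
Proof.
move=> /cvg_realP za /cvg_realP zb; apply/cvg_absP => e e0.
have e20 : 0 < e / 2 by rewrite divr_gt0.
have [M HM] := za _ e20; have [N HN] := zb _ e20; exists (maxn M N) => n.
rewrite geq_max => /andP[/HM hM /HN hN].
have -> : absc (z n - (a +i* b)) = absc ((complex.Re (z n) - a) +i* (complex.Im (z n) - b)).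
  by congr absc; case: (z n).
by rewrite (le_lt_trans (absc_le_ReIm _))//=; lra.
Qed.

Lemma geometric_cvg0 (K rho : R) : 0 <= rho < 1 -> (fun n => K * rho ^+ n) @ \oo --> 0.
Proof. by move=> /andP[r0 r1]; apply: cvg_geometric; rewrite ger0_norm. Qed.

Lemma sum_geometric_le (K rho : R) M N : 0 <= K -> 0 <= rho < 1 ->
  \sum_(M <= n < N) K * rho ^+ n <= K * rho ^+ M / (1 - rho).
Proof.
move=> K0 /andP[r0 r1]; have h1 : 0 < 1 - rho by lra.
rewrite ler_pdivlMr//; have [MN|NM] := leqP M N; last first.
  by rewrite big_geq ?(ltnW NM)// mul0r mulr_ge0// exprn_ge0.
have H j : (\sum_(M <= n < M + j) K * rho ^+ n) * (1 - rho) = K * rho ^+ M - K * rho ^+ (M + j).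
  elim: j => [|j ih]; first by rewrite addn0 big_geq// mul0r subrr.
  by rewrite addnS big_nat_recr ?leq_addr//= mulrDl ih exprS; ring.
by rewrite -(subnKC MN) H lerBlDr lerDl mulr_ge0// exprn_ge0.
Qed.

Lemma dominated_ge0 (f : nat -> C) (K rho : R) :
  (forall n, absc (f n) <= K * rho ^+ n) -> 0 <= K.
Proof. by move/(_ 0%N); rewrite (expr0 rho) (mulr1 K); exact/le_trans/absc_ge0. Qed.

Lemma real_dominated_cvg (g : nat -> R) (K rho : R) : 0 <= K -> 0 <= rho < 1 ->
  (forall n, `|g n| <= K * rho ^+ n) -> cvgn (series g).
Proof.
move=> K0 /andP[r0 r1] gK; apply: normed_cvg; apply: (@series_le_cvg _ _ (geometric K rho)).
- by move=> n; exact: normr_ge0.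
- by move=> n; rewrite mulr_ge0// exprn_ge0.
- exact: gK.
- by apply: is_cvg_geometric_series; rewrite ger0_norm.
Qed.

Lemma Sum_cvg (f : nat -> C) (K rho : R) : 0 <= rho < 1 ->
  (forall n, absc (f n) <= K * rho ^+ n) -> series f @ \oo --> Sum f.
Proof.
move=> rho01 fK; have K0 := dominated_ge0 fK.
have hR : cvgn (series (fun n => complex.Re (f n))).
  by apply: (real_dominated_cvg K0 rho01) => n; exact: le_trans (Re_le_absc _) (fK n).
have hI : cvgn (series (fun n => complex.Im (f n))).
  by apply: (real_dominated_cvg K0 rho01) => n; exact: le_trans (Im_le_absc _) (fK n).
have H : series f @ \oo -->
    (limn (series (fun n => complex.Re (f n))) +i* limn (series (fun n => complex.Im (f n))) : C).
  apply: cvg_ReIm.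
    rewrite (_ : (fun n => _) = series (fun n => complex.Re (f n)))//.
    apply/funext => n; rewrite /series /=.
    by elim/big_rec2: _ => // i a b _ <-; case: (f i); case: b.
  rewrite (_ : (fun n => _) = series (fun n => complex.Im (f n)))//.
  apply/funext => n; rewrite /series /=.
  by elim/big_rec2: _ => // i a b _ <-; case: (f i); case: b.
by rewrite /Sum (cvg_lim _ H).
Qed.

Lemma Sum_tail (f : nat -> C) (K rho : R) : 0 <= rho < 1 ->
  (forall n, absc (f n) <= K * rho ^+ n) ->
  forall M, absc (Sum f - series f M) <= K * rho ^+ M / (1 - rho).
Proof.
move=> rho01 fK M; have K0 := dominated_ge0 fK.
have H : (fun N => series f (N + M)%N - series f M) @ \oo --> Sum f - series f M.
  apply: sqB (sq_cst _).
  by have := Sum_cvg rho01 fK; rewrite -(cvg_shiftn M).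
apply: cvg_absc_le H => N; rewrite sub_series_geq ?leq_addl//.
rewrite (le_trans (absc_sum _ _ _))// (le_trans _ (sum_geometric_le M (N + M) K0 rho01))//.
by apply: ler_sum_nat => n _; exact: fK.
Qed.

Lemma SumE (f : nat -> C) (l : C) : series f @ \oo --> l -> Sum f = l.
Proof. by move=> h; exact: (cvg_lim _ h). Qed.

Lemma dv_sum (I : Type) (s : seq I) (F : I -> C -> C) (dF : I -> C) x :
  (forall i, dv (F i) x (dF i)) ->
  dv (fun y => \sum_(i <- s) F i y) x (\sum_(i <- s) dF i).
Proof.
move=> h; elim: s => [|i s ih].
  rewrite big_nil (_ : (fun y => _) = fun=> 0); first exact: dv_cst.
  by apply/funext => y; rewrite big_nil.
rewrite big_cons (_ : (fun y => _) = fun y => F i y + \sum_(i <- s) F i y).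
  exact: dvD.
by apply/funext => y; rewrite big_cons.
Qed.

(** The domination is required of the derivatives, uniformly on the disk. The mean value inequality
    transfers it to the increments [phi n y - phi n x], with a factor [absc (y - x)], so that a
    finite sum and two small tails remain. *)
Lemma dv_Sum (phi dphi : nat -> C -> C) (r K rho : R) (x : C) :
  0 <= rho < 1 ->
  (forall n y, absc y < r -> dv (phi n) y (dphi n y)) ->
  (forall n y, absc y < r -> absc (dphi n y) <= K * rho ^+ n) ->
  (forall y, absc y < r -> exists l : C, series (phi^~ y) @ \oo --> l) ->
  absc x < r ->
  dv (fun y => Sum (phi^~ y)) x (Sum (dphi^~ x)).
Proof.
move=> rho01 hd hK hc xr.
have [r0 r1] := andP rho01.
have K0 : 0 <= K.
  by have := hK 0%N x xr; rewrite expr0 mulr1; apply: le_trans; exact: absc_ge0.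
apply/dvP => e e0.
(* The finite sum costs [e / 2], the tail of the increments [2 * (e / 6)] because of the factor 2 in
   [mean_value], and the tail of the derivatives [e / 6]. *)
have e60 : 0 < e / 6 by rewrite divr_gt0.
have [N HN] := (cvg_realP _ _).1 (geometric_cvg0 (K / (1 - rho)) rho01) _ e60.
have {HN} T : K * rho ^+ N / (1 - rho) < e / 6.
  have := HN N (leqnn N); rewrite subr0 => /(le_lt_trans (ler_norm _)).
  by rewrite mulrAC.
have e20 : 0 < e / 2 by rewrite divr_gt0.
have := @dv_sum nat (index_iota 0 N) phi (dphi^~ x) x (fun i => hd i x xr).
move=> /dvP /(_ _ e20) [d d0 Hd].
exists (Num.min d (r - absc x)); first by rewrite lt_min d0 subr_gt0.
move=> y; rewrite lt_min => /andP[/Hd hfin yr].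
have yr' : absc y < r.
  have : absc y <= absc x + absc (y - x) by rewrite -{1}(subrK x y) addrC abscD.
  by lra.
pose psi n := phi n y - phi n x.
have psiK n : absc (psi n) <= (2 * K * absc (y - x)) * rho ^+ n.
  rewrite mulrAC; have -> : 2 * K * rho ^+ n = 2 * (K * rho ^+ n) by ring.
  have conv (s : R) : 0 <= s <= 1 -> absc (x + s%:C * (y - x)) < r.
    move=> /andP[s0 s1].
    have -> : x + s%:C * (y - x) = (1 - s)%:C * x + s%:C * y.
      by rewrite rmorphB rmorph1; ring.
    rewrite (le_lt_trans (abscD _ _))// !abscM !absc_real !ger0_norm//; last by lra.
    have mr : Num.max (absc x) (absc y) < r by rewrite gt_max xr.
    have mx : absc x <= Num.max (absc x) (absc y) by rewrite le_max lexx.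
    have my : absc y <= Num.max (absc x) (absc y) by rewrite le_max lexx orbT.
    by apply: le_lt_trans mr; nra.
  have conv' (s : R) : 0 < s < 1 -> absc (x + s%:C * (y - x)) < r.
    by move=> /andP[s0 s1]; apply: conv; lra.
  rewrite /psi -{1}(subrKC x y).
  apply: (@mean_value _ (phi n) (dphi n)).
  - by move=> s /conv /hd /dv_cvg.
  - by move=> s /conv' /hd.
  - by move=> s /conv' /hK.
have Spsi : Sum psi = Sum (phi^~ y) - Sum (phi^~ x).
  apply: SumE; have [ly hy] := hc y yr'; have [lx hx] := hc x xr.
  rewrite (SumE hy) (SumE hx).
  have := sqB hy hx; rewrite (_ : (fun t => _) = series psi)//.
  by apply/funext => n; rewrite /series /= -sumrB.
have t1 := Sum_tail rho01 psiK N.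
have t2 := Sum_tail rho01 (fun n => hK n x xr) N.
rewrite -Spsi.
have -> : Sum psi - (y - x) * Sum (dphi^~ x) =
   (\sum_(i <- index_iota 0 N) phi i y - \sum_(i <- index_iota 0 N) phi i x
    - (y - x) * \sum_(i <- index_iota 0 N) dphi i x)
   + (Sum psi - series psi N) - (y - x) * (Sum (dphi^~ x) - series (dphi^~ x) N).
  by rewrite -sumrB /series /= /psi; ring.
rewrite (le_trans (abscB _ _))//.
have h3 := abscD (\sum_(i <- index_iota 0 N) phi i y - \sum_(i <- index_iota 0 N) phi i x
    - (y - x) * \sum_(i <- index_iota 0 N) dphi i x) (Sum psi - series psi N).
rewrite abscM.
have p0 := absc_ge0 (y - x).
have t1' : absc (Sum psi - series psi N) <= 2 * absc (y - x) * (e / 6).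
  apply: (le_trans t1).
  have -> : 2 * K * absc (y - x) * rho ^+ N / (1 - rho) =
     2 * absc (y - x) * (K * rho ^+ N / (1 - rho)) by ring.
  by apply: ler_wpM2l; [rewrite mulr_ge0|exact: ltW].
have t2' : absc (y - x) * absc (Sum (dphi^~ x) - series (dphi^~ x) N) <= absc (y - x) * (e / 6).
  by apply: ler_wpM2l => //; exact: le_trans t2 (ltW T).
by lra.
Qed.

End Series.

(** * Lambert series *)

Section PolynomialBounds.
Context {R : realType}.
Local Notation C := (Cplx R).

(** Two indices are kept because the kernels depend on both; sequences are the case constant in the
    second, so the closure rules serve for both. The successor keeps the base at least 1, which lets
    exponents be raised. *)
Definition polybd2 (f : nat -> nat -> C) : Prop :=
  exists (K : R) (d : nat), 0 <= K /\ forall n m, absc (f n m) <= K * (n + m).+1%:R ^+ d.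

Definition polybd (f : nat -> C) : Prop := polybd2 (fun n _ => f n).

Lemma polybdP f : polybd f ->
  exists (K : R) (d : nat), 0 <= K /\ forall n, absc (f n) <= K * n.+1%:R ^+ d.
Proof.
by move=> [K [d [K0 H]]]; exists K, d; split => // n; have := H n 0; rewrite addn0.
Qed.

Lemma polybd_cst (a : C) : polybd2 (fun _ _ => a).
Proof. by exists (absc a), 0; split=> [|n m]; rewrite ?absc_ge0// expr0 mulr1. Qed.

Lemma polybd_fst : polybd2 (fun n _ => n%:R).
Proof.
exists 1, 1; split=> // n m; rewrite absc_nat mul1r expr1 ler_nat.
by rewrite (leq_trans (leq_addr m n)).
Qed.

Lemma polybd_snd : polybd2 (fun _ m => m%:R).
Proof.
exists 1, 1; split=> // n m; rewrite absc_nat mul1r expr1 ler_nat.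
by rewrite (leq_trans (leq_addl n m)).
Qed.

Lemma polybd_add : polybd2 (fun n m => (n + m)%:R).
Proof. by exists 1, 1; split=> // n m; rewrite absc_nat mul1r expr1 ler_nat. Qed.

Lemma polybdD f g : polybd2 f -> polybd2 g -> polybd2 (fun n m => f n m + g n m).
Proof.
move=> [K [d [K0 H]]] [L [e [L0 H']]]; exists (K + L), (d + e)%N.
split=> [|n m]; first exact: addr_ge0.
rewrite (le_trans (abscD _ _))// mulrDl exprD.
have g1 k : 1 <= (n + m).+1%:R ^+ k :> R by rewrite exprn_ege1// ler1n.
apply: lerD; [apply: (le_trans (H n m))|apply: (le_trans (H' n m))]; apply: ler_wpM2l => //.
  by rewrite ler_peMr ?(le_trans ler01)//.
by rewrite ler_peMl ?(le_trans ler01)//.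
Qed.

Lemma polybdM f g : polybd2 f -> polybd2 g -> polybd2 (fun n m => f n m * g n m).
Proof.
move=> [K [d [K0 H]]] [L [e [L0 H']]]; exists (K * L), (d + e)%N.
split=> [|n m]; first exact: mulr_ge0.
by rewrite abscM exprD mulrACA ler_pM ?absc_ge0.
Qed.

Lemma polybdN f : polybd2 f -> polybd2 (fun n m => - f n m).
Proof. by move=> [K [d [K0 H]]]; exists K, d; split=> // n m; rewrite abscN. Qed.

Lemma polybdX f k : polybd2 f -> polybd2 (fun n m => f n m ^+ k).
Proof.
move=> hf; elim: k => [|k ih].
  by rewrite (_ : (fun _ => _) = fun _ _ => 1) //; exact: polybd_cst.
rewrite (_ : (fun _ => _) = fun n m => f n m * f n m ^+ k); first exact: polybdM.
by apply/funext => n; apply/funext => m; rewrite exprS.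
Qed.

(** The quantity [(n + 1) s^n] is at most [1 + s + ... + s^n], hence at most the whole geometric
    series; the induction shows this after multiplication by [1 - s]. *)
Lemma mul_geometric_le (s : R) n : 0 <= s < 1 -> n.+1%:R * s ^+ n <= (1 - s)^-1.
Proof.
move=> /andP[s0 s1]; rewrite -[leRHS]mul1r ler_pdivlMr ?subr_gt0//.
apply: (@le_trans _ _ (1 - s ^+ n.+1)); last by rewrite lerBlDr lerDl exprn_ge0.
elim: n => [|n ih]; first by rewrite expr0 expr1 !mul1r.
have sn0 : 0 <= s ^+ n.+1 by exact: exprn_ge0.
have sn1 : s ^+ n.+1 <= 1 by rewrite exprn_ile1// ltW.
rewrite exprS in sn0 sn1 ih *; rewrite -[n.+2%:R]natr1 (exprS s n.+1) (exprS s n).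
set t := s ^+ n in sn0 sn1 ih *; have h : s * (n.+1%:R * t * (1 - s)) <= s * (1 - s * t).
  by rewrite ler_wpM2l.
nra.
Qed.

(** Writing [r^n] as [sqrt(r)^n * sqrt(r)^n], one factor absorbs one power of [n + 1] and the other
    is left to the induction on [d]. *)
Lemma poly_geometric d (r : R) : 0 <= r < 1 -> exists (K rho : R),
  [/\ 0 <= K, 0 <= rho < 1 & forall n, n.+1%:R ^+ d * r ^+ n <= K * rho ^+ n].
Proof.
elim: d r => [|d ih] r r01.
  by exists 1, r; split=> // n; rewrite expr0.
have [r0 r1] := andP r01.
have s01 : 0 <= Num.sqrt r < 1.
  by rewrite sqrtr_ge0 /= -[ltRHS]sqrtr1 ltr_sqrt.
have [K [rho [K0 rho01 H]]] := ih _ s01.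
exists (K / (1 - Num.sqrt r)), rho; split=> //.
  by rewrite divr_ge0// subr_ge0 ltW//; case/andP: s01.
move=> n; rewrite -[in leLHS](sqr_sqrtr r0) -exprM mul2n -addnn exprD exprS.
have [rh0 _] := andP rho01; have [s0 _] := andP s01.
rewrite [leLHS](_ : _ = (n.+1%:R ^+ d * Num.sqrt r ^+ n) * (n.+1%:R * Num.sqrt r ^+ n)); last by ring.
rewrite [leRHS](_ : _ = K * rho ^+ n * (1 - Num.sqrt r)^-1); last by ring.
apply: ler_pM => //; try by rewrite mulr_ge0// ?exprn_ge0.
exact: mul_geometric_le.
Qed.

End PolynomialBounds.

Section Lambert.
Context {R : realType}.
Local Notation C := (Cplx R).

(* [lamb q 0 = 0], since [1 / 0 = 0]. *)
Definition lamb (q : C) (n : nat) : C := q ^+ n / (1 - q ^+ n).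

Lemma lamb0 q : lamb q 0 = 0.
Proof. by rewrite /lamb expr0 subrr invr0 mulr0. Qed.

Lemma absc_expn_lt1 (q : C) n : absc q < 1 -> (0 < n)%N -> absc (q ^+ n) < 1.
Proof. by move=> q1 n0; rewrite abscX exprn_ilt1 ?absc_ge0// -lt0n. Qed.

Lemma one_subX_ge (q : C) (r : R) n : absc q <= r -> r < 1 -> (0 < n)%N ->
  1 - r <= absc (1 - q ^+ n).
Proof.
move=> qr r1 n0.
have h : absc (q ^+ n) <= r.
  have q1 : absc q <= 1 by lra.
  rewrite abscX; apply: le_trans qr; case: n n0 => // n _.
  by rewrite exprS ler_piMr ?absc_ge0// exprn_ile1// absc_ge0.
have : absc (1 : C) <= absc (1 - q ^+ n) + absc (q ^+ n).
  by rewrite -{1}(subrK (q ^+ n) 1) abscD.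
by rewrite absc1; lra.
Qed.

Lemma one_subX_neq0 (q : C) n : absc q < 1 -> (0 < n)%N -> 1 - q ^+ n != 0.
Proof.
move=> q1 n0; rewrite -absc_eq0 gt_eqF//.
by rewrite (lt_le_trans _ (one_subX_ge (lexx _) q1 n0))// subr_gt0.
Qed.

Lemma lambM (q : C) n m : absc q < 1 -> (0 < n)%N -> (0 < m)%N ->
  lamb q n * lamb q m = lamb q (n + m) * (1 + lamb q n + lamb q m).
Proof.
move=> q1 n0 m0; have hn := one_subX_neq0 q1 n0; have hm := one_subX_neq0 q1 m0.
have := one_subX_neq0 q1 (ltn_addr m n0); rewrite /lamb exprD => hnm.
by field; rewrite hn hm hnm.
Qed.

Lemma lamb_le (q : C) (r : R) n : absc q <= r -> r < 1 ->
  absc (lamb q n) <= (1 - r)^-1 * r ^+ n.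
Proof.
move=> qr r1; have r0 : 0 <= r by exact: le_trans (absc_ge0 _) qr.
case: n => [|n]; first by rewrite lamb0 absc0 expr0 mulr1 invr_ge0 subr_ge0 ltW.
rewrite /lamb abscM abscV mulrC abscX; apply: ler_pM; rewrite ?invr_ge0 ?exprn_ge0 ?absc_ge0//.
  rewrite lef_pV2 ?posrE ?subr_gt0//; first exact: one_subX_ge.
  by rewrite (lt_le_trans _ (one_subX_ge qr r1 _))// subr_gt0.
by rewrite lerXn2r ?nnegrE ?absc_ge0.
Qed.

(** [K] and [rho] are chosen before [n] and [z], so that one bound holds on a whole disk, as
    [dv_Sum] requires. *)
Lemma polybd_dominated (f : nat -> C) (r L : R) : 0 <= r < 1 -> 0 <= L -> polybd f ->
  exists K rho : R, 0 <= rho < 1 /\ forall n (z : C), absc z <= L * r ^+ n ->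
    absc (f n * z) <= K * rho ^+ n.
Proof.
move=> r01 L0 /polybdP[A [d [A0 H]]].
have [K [rho [K0 rho01 Hg]]] := poly_geometric d r01.
exists (A * L * K), rho; split=> // n z zn; have [r0 _] := andP r01.
rewrite abscM (@le_trans _ _ ((A * n.+1%:R ^+ d) * (L * r ^+ n)))//.
  by apply: ler_pM; rewrite ?absc_ge0.
rewrite [leLHS](_ : _ = (A * L) * (n.+1%:R ^+ d * r ^+ n)); last by ring.
by rewrite -[leRHS]mulrA ler_wpM2l// mulr_ge0.
Qed.

Definition Lam (f : nat -> C) (q : C) : C := Sum (fun n => f n * lamb q n).
Definition Lam2 (f : nat -> C) (q : C) : C := Sum (fun n => f n * lamb q n ^+ 2).

Lemma lamb_dominated (f : nat -> C) (q : C) : absc q < 1 -> polybd f ->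
  exists K rho : R, 0 <= rho < 1 /\ forall n, absc (f n * lamb q n) <= K * rho ^+ n.
Proof.
move=> q1 pf.
have r01 : 0 <= absc q < 1 by rewrite absc_ge0.
have L0 : 0 <= (1 - absc q)^-1 by rewrite invr_ge0 subr_ge0 ltW.
have [K [rho [rho01 H]]] := polybd_dominated r01 L0 pf.
by exists K, rho; split=> // n; apply: H; apply: lamb_le.
Qed.

Lemma lamb2_dominated (f : nat -> C) (q : C) : absc q < 1 -> polybd f ->
  exists K rho : R, 0 <= rho < 1 /\ forall n, absc (f n * lamb q n ^+ 2) <= K * rho ^+ n.
Proof.
move=> q1 pf.
have r01 : 0 <= absc q < 1 by rewrite absc_ge0.
have L0 : 0 <= (1 - absc q)^-1 by rewrite invr_ge0 subr_ge0 ltW.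
have L20 : 0 <= (1 - absc q)^-1 ^+ 2 by exact: exprn_ge0.
have [K [rho [rho01 H]]] := polybd_dominated r01 L20 pf.
exists K, rho; split=> // n; apply: H.
have h := lamb_le n (lexx _) q1.
rewrite expr2 abscM; apply: (le_trans (ler_pM (absc_ge0 _) (absc_ge0 _) h h)).
rewrite [leLHS](_ : _ = (1 - absc q)^-1 ^+ 2 * (absc q ^+ n * absc q ^+ n)); last by ring.
by rewrite ler_wpM2l// ler_piMr ?exprn_ge0 ?absc_ge0// exprn_ile1 ?absc_ge0// ltW.
Qed.

Lemma Lam_cvg f q : absc q < 1 -> polybd f ->
  series (fun n => f n * lamb q n) @ \oo --> Lam f q.
Proof. by move=> q1 /(lamb_dominated q1)[K [rho [h H]]]; exact: Sum_cvg h H. Qed.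

Lemma Lam2_cvg f q : absc q < 1 -> polybd f ->
  series (fun n => f n * lamb q n ^+ 2) @ \oo --> Lam2 f q.
Proof. by move=> q1 /(lamb2_dominated q1)[K [rho [h H]]]; exact: Sum_cvg h H. Qed.

Lemma LamD f g q : absc q < 1 -> polybd f -> polybd g ->
  Lam (fun n => f n + g n) q = Lam f q + Lam g q.
Proof.
move=> q1 pf pg; apply: SumE; have := sqD (Lam_cvg q1 pf) (Lam_cvg q1 pg).
apply: sq_near; apply: nearW => n; rewrite /series /= -big_split /=.
by apply: eq_bigr => i _; rewrite mulrDl.
Qed.

Lemma LamZ (a : C) f q : absc q < 1 -> polybd f ->
  Lam (fun n => a * f n) q = a * Lam f q.
Proof.
move=> q1 pf; apply: SumE; have := sqM (sq_cst a) (Lam_cvg q1 pf).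
apply: sq_near; apply: nearW => n; rewrite /series /= mulr_sumr.
by apply: eq_bigr => i _; rewrite mulrA.
Qed.

Lemma Lam2Z (a : C) f q : absc q < 1 -> polybd f ->
  Lam2 (fun n => a * f n) q = a * Lam2 f q.
Proof.
move=> q1 pf; apply: SumE; have := sqM (sq_cst a) (Lam2_cvg q1 pf).
apply: sq_near; apply: nearW => n; rewrite /series /= mulr_sumr.
by apply: eq_bigr => i _; rewrite mulrA.
Qed.

Lemma dv_lamb n (y : C) : absc y < 1 ->
  dv (lamb^~ n) y (n%:R * y ^+ n.-1 / (1 - y ^+ n) ^+ 2).
Proof.
move=> y1; case: n => [|n].
  rewrite (_ : lamb^~ 0%N = fun=> 0); last by apply/funext => z; rewrite lamb0.
  by rewrite !mul0r; exact: dv_cst.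
have h := one_subX_neq0 y1 (ltn0Sn n).
have dX := dvX n.+1 (dv_id y).
have := @dv_div _ (fun z => z ^+ n.+1) (fun z => 1 - z ^+ n.+1) y _ _ h dX (dvB (dv_cst 1 y) dX).
move/dv_eq; apply; rewrite /=; field; exact: h.
Qed.

(** This is the derivative itself and not [q d/dq]: its value at [q = 0] is used to compare
    functions to first order at the cusp. *)
Definition dLam (f : nat -> C) (q : C) : C :=
  Sum (fun n => f n * (n%:R * q ^+ n.-1 / (1 - q ^+ n) ^+ 2)).

Lemma dLam_dominated (f : nat -> C) (r : R) : 0 < r < 1 -> polybd f ->
  exists K rho : R, 0 <= rho < 1 /\ forall n y, absc y <= r ->
    absc (f n * (n%:R * y ^+ n.-1 / (1 - y ^+ n) ^+ 2)) <= K * rho ^+ n.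
Proof.
move=> /andP[r0 r1] pf; have r01 : 0 <= r < 1 by rewrite ltW.
have pg : polybd (fun n => f n * n%:R) by apply: polybdM => //; exact: polybd_fst.
have L0 : 0 <= (1 - r)^-1 ^+ 2 * r^-1.
  by rewrite mulr_ge0 ?exprn_ge0// invr_ge0 ?subr_ge0 ltW.
have [K [rho [rho01 H]]] := polybd_dominated r01 L0 pg.
exists K, rho; split=> // n y yr.
have -> : f n * (n%:R * y ^+ n.-1 / (1 - y ^+ n) ^+ 2) =
  f n * n%:R * (y ^+ n.-1 / (1 - y ^+ n) ^+ 2) by ring.
apply: H; case: n => [|n].
  have -> : y ^+ 0.-1 / (1 - y ^+ 0) ^+ 2 = 0.
    by rewrite expr0 subrr expr2 mulr0 invr0 mulr0.
  by rewrite absc0 mulr_ge0// exprn_ge0// ltW.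
have -> : (1 - r)^-1 ^+ 2 * r^-1 * r ^+ n.+1 = r ^+ n * (1 - r)^-1 ^+ 2.
  by rewrite (exprS r); field; rewrite !lt0r_neq0// subr_gt0.
rewrite abscM abscV !abscX -exprVn /=.
have h := one_subX_ge yr r1 (ltn0Sn n).
have h1 : 0 < 1 - r by rewrite subr_gt0.
apply: ler_pM; rewrite ?exprn_ge0 ?invr_ge0 ?absc_ge0//.
  by rewrite lerXn2r// nnegrE ?absc_ge0// ltW.
rewrite lerXn2r// ?nnegrE ?invr_ge0 ?absc_ge0 ?(ltW h1)//.
by rewrite lef_pV2 ?posrE// (lt_le_trans h1 h).
Qed.

Lemma dv_Lam f q : absc q < 1 -> polybd f -> dv (Lam f) q (dLam f q).
Proof.
move=> q1 pf.
pose r := (1 + absc q) / 2.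
have r01 : 0 < r < 1 by have := absc_ge0 q; rewrite /r; lra.
have [r0 r1] := andP r01.
have [K [rho [rho01 H]]] := dLam_dominated r01 pf.
apply: (@dv_Sum _ (fun n y => f n * lamb y n)
  (fun n y => f n * (n%:R * y ^+ n.-1 / (1 - y ^+ n) ^+ 2)) r K rho) => //.
- move=> n y yr; have y1 : absc y < 1 by exact: lt_trans yr r1.
  by have := dvM (dv_cst (f n) y) (dv_lamb n y1); move/dv_eq; apply; rewrite mul0r add0r.
- by move=> n y /ltW; exact: H.
- move=> y yr; exists (Lam f y); apply: Lam_cvg => //; exact: lt_trans yr r1.
- by rewrite /r; lra.
Qed.

(** Termwise this is [q d/dq u_n = n (u_n + u_n^2)]; the squares are the ones that Liouville's
    identity evaluates. *)
Lemma dLamE f q : absc q < 1 -> polybd f ->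
  q * dLam f q = Lam (fun n => n%:R * f n) q + Lam2 (fun n => n%:R * f n) q.
Proof.
move=> q1 pf.
have pg : polybd (fun n => n%:R * f n) by apply: polybdM => //; exact: polybd_fst.
pose r := (1 + absc q) / 2.
have r01 : 0 < r < 1 by have := absc_ge0 q; rewrite /r; lra.
have qr : absc q <= r by rewrite /r; lra.
have [K [rho [rho01 H]]] := dLam_dominated r01 pf.
have h1 := sqM (sq_cst q) (Sum_cvg rho01 (fun n => H n q qr)).
apply: cvgc_unique h1 _; have := sqD (Lam_cvg q1 pg) (Lam2_cvg q1 pg).
apply: sq_near; apply: nearW => n; rewrite /series /= -big_split mulr_sumr /=.
apply: eq_bigr => -[|i] _; first by rewrite !mul0r addr0 mulr0 mulr0.
have h := one_subX_neq0 q1 (ltn0Sn i).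
by move: h; rewrite /lamb /= (exprS q i) => h; field.
Qed.

Lemma sum_triangle (V : nmodType) (F : nat -> nat -> V) M :
  \sum_(1 <= k < M) \sum_(1 <= n < k) F n (k - n)%N =
  \sum_(1 <= n < M) \sum_(1 <= m < M - n) F n m.
Proof.
elim: M => [|M ih]; first by rewrite !big_geq.
case: M ih => [_|M ih]; first by rewrite !big_geq.
rewrite big_nat_recr//= ih [RHS]big_nat_recr//= subSnn [X in _ = _ + X]big_geq// addr0.
rewrite -big_split /=; apply: eq_big_nat => n /andP[n1 nM].
have -> : (M.+2 - n = (M.+1 - n).+1)%N by rewrite subSn// ltnW.
by rewrite [RHS]big_nat_recr ?subn_gt0.
Qed.

(** The pairs in the square but outside the triangle have [n + m >= M]. Each term is geometrically
    small in [M], and the second use of [poly_geometric], with exponent 2, pays for the at most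
    [M^2] pairs. *)
Lemma square_sub_triangle_cvg0 (q : C) (A : nat -> nat -> C) : absc q < 1 -> polybd2 A ->
  (fun M => \sum_(1 <= n < M) \sum_(1 <= m < M) lamb q n * lamb q m * A n m
     - \sum_(1 <= n < M) \sum_(1 <= m < M - n) lamb q n * lamb q m * A n m) @ \oo --> (0 : C).
Proof.
move=> q1 [L [d [L0 HA]]].
have r01 : 0 <= absc q < 1 by rewrite absc_ge0.
have [K [rho [K0 rho01 Hg]]] := poly_geometric d r01.
have [rho0 rho1] := andP rho01.
have [K' [rho' [K'0 rho'01 Hg']]] := poly_geometric 2 rho01.
have c0 : 0 <= (1 - absc q)^-1 by rewrite invr_ge0 subr_ge0 ltW.
pose B : R := (1 - absc q)^-1 ^+ 2 * L * K.
have B0 : 0 <= B by rewrite !mulr_ge0// exprn_ge0.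
have bound n m M : (M <= n + m)%N -> absc (lamb q n * lamb q m * A n m) <= B * rho ^+ M.
  move=> Mnm; rewrite abscM (abscM (lamb q n)).
  have hn := lamb_le n (lexx _) q1; have hm := lamb_le m (lexx _) q1.
  have hnm := ler_pM (absc_ge0 _) (absc_ge0 _) hn hm.
  apply: (le_trans (ler_pM _ (absc_ge0 _) hnm (HA n m))); first by rewrite mulr_ge0 ?absc_ge0.
  rewrite [leLHS](_ : _ = (1 - absc q)^-1 ^+ 2 * L *
    ((n + m).+1%:R ^+ d * absc q ^+ (n + m))); last first.
    by rewrite exprD; ring.
  rewrite /B -[leRHS]mulrA ler_wpM2l ?mulr_ge0 ?exprn_ge0//.
  apply: (le_trans (Hg _)); rewrite ler_wpM2l// -(subnKC Mnm) exprD.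
  by rewrite ler_piMr ?exprn_ge0// exprn_ile1// ?rho0 ltW.
apply: (@cvg_absc_squeeze _ _ _ (fun M => B * K' * rho' ^+ M)); last exact: geometric_cvg0.
move=> M; rewrite subr0 -sumrB.
have step n : (1 <= n < M)%N -> absc (\sum_(1 <= m < M) lamb q n * lamb q m * A n m
   - \sum_(1 <= m < M - n) lamb q n * lamb q m * A n m) <= M%:R * (B * rho ^+ M).
  move=> /andP[n1 nM]; have h1 : (1 <= M - n)%N by rewrite subn_gt0.
  rewrite (big_cat_nat (n := (M - n)%N)) ?leq_subr//= [X in absc X](_ : _ =
     \sum_(M - n <= m < M) lamb q n * lamb q m * A n m); last by ring.
  rewrite (le_trans (absc_sum _ _ _))//.
  apply: (@le_trans _ _ (\sum_(M - n <= m < M) B * rho ^+ M)).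
    apply: ler_sum_nat => m /andP[Mm mM]; apply: bound.
    by rewrite -leq_subLR.
  rewrite sumr_const_nat -[leLHS]mulr_natl ler_wpM2r ?mulr_ge0 ?exprn_ge0// ler_nat.
  by rewrite subKn ?(ltnW nM)// ltnW.
rewrite (le_trans (absc_sum _ _ _))//.
apply: (@le_trans _ _ (\sum_(1 <= n < M) M%:R * (B * rho ^+ M))).
  by apply: ler_sum_nat => n; exact: step.
rewrite sumr_const_nat -mulr_natl.
apply: (@le_trans _ _ (B * (M.+1%:R ^+ 2 * rho ^+ M))); last first.
  by rewrite -mulrA ler_wpM2l.
rewrite [leLHS](_ : _ = B * ((M - 1)%:R * M%:R * rho ^+ M)); last by ring.
rewrite ler_wpM2l// ler_wpM2r ?exprn_ge0// -natrM -natrX ler_nat expnS expn1.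
by apply: leq_mul => //; rewrite (leq_trans (leq_subr _ _)).
Qed.

(** The list [s] holds the pairs of functions into which [Phi(n, m) - Phi(n, -m)] separates; each
    pair contributes a product of two Lambert series. *)
Lemma liouville (B : nat -> nat -> C) (s : seq ((nat -> C) * (nat -> C))) (G D : nat -> C) q :
  absc q < 1 ->
  (forall n m, B n m = B m n) -> (forall n m, B n (n + m)%N = B m (n + m)%N) ->
  polybd2 (fun n m => B n (n + m)%N) ->
  (forall n m, B n (n + m)%N - B n m = \sum_(p <- s) p.1 n * p.2 m) ->
  (forall i, polybd (nth (cst 0, cst 0) s i).1 /\ polybd (nth (cst 0, cst 0) s i).2) ->
  (forall k, (0 < k)%N -> \sum_(1 <= n < k) B n k = G k) -> polybd G ->
  (forall n, B n n = D n) -> polybd D ->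
  \sum_(p <- s) Lam p.1 q * Lam p.2 q = Lam G q - Lam2 D q.
Proof.
move=> q1 BC BD pB BE ps BG pG BDi pD.
have from1 (f : nat -> C) M : f 0 = 0 -> \sum_(1 <= n < M) f n = \sum_(0 <= n < M) f n.
  by move=> f0; case: M => [|M]; [rewrite !big_geq|rewrite [RHS]big_nat_recl// f0 add0r big_add1].
have lhs : (fun M => \sum_(i < size s) (series (fun n => (nth (cst 0, cst 0) s i).1 n * lamb q n) M *
    series (fun n => (nth (cst 0, cst 0) s i).2 n * lamb q n) M)) @ \oo -->
    \sum_(i < size s) Lam (nth (cst 0, cst 0) s i).1 q * Lam (nth (cst 0, cst 0) s i).2 q.
  apply: cvgc_sum => i _; have [p1 p2] := ps i.
  exact: (sqM (Lam_cvg q1 p1) (Lam_cvg q1 p2)).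
rewrite (big_nth (cst 0, cst 0)) big_mkord.
apply: cvgc_unique lhs _.
(* At finite [M] the terms with [Phi(n, m)] run over the triangle [n + m < M] and those with
   [Phi(n, -m)] over the square. Completing the triangle changes nothing in the limit and makes the
   products factor. *)
have := sqB (sqB (Lam_cvg q1 pG) (Lam2_cvg q1 pD)) (sqN (square_sub_triangle_cvg0 q1 pB)).
rewrite oppr0 subr0; apply: sq_near; apply: nearW => M.
have := liouville_sum M (fun n m => @lambM q n m q1) BC BD.
rewrite (_ : \sum_(1 <= k < M) \sum_(1 <= n < k) _ =
   \sum_(1 <= n < M) \sum_(1 <= m < M - n) lamb q n * lamb q m * B n (n + m)%N); last first.
  rewrite -(sum_triangle (fun n m => lamb q n * lamb q m * B n (n + m)%N)).
  apply: eq_bigr => k _; apply: eq_big_nat => n /andP[_ nk].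
  by rewrite subnKC// ltnW.
have -> : series (fun n => G n * lamb q n) M = \sum_(1 <= k < M) lamb q k * \sum_(1 <= n < k) B n k.
  rewrite /series /= -from1 ?lamb0 ?mulr0//.
  by apply: eq_big_nat => k /andP[k0 _]; rewrite BG// mulrC.
have -> : series (fun n => D n * lamb q n ^+ 2) M = \sum_(1 <= n < M) lamb q n ^+ 2 * B n n.
  rewrite /series /= -from1 ?lamb0 ?expr0n ?mulr0//.
  by apply: eq_bigr => k _; rewrite BDi mulrC.
move=> <-.
rewrite (_ : \sum_(i < size s) _ = \sum_(1 <= n < M) \sum_(1 <= m < M) lamb q n * lamb q m *
   (B n (n + m)%N - B n m)); last first.
  under [RHS]eq_bigr => n _ do under eq_bigr => m _ do
    rewrite BE (big_nth (cst 0, cst 0)) big_mkord mulr_sumr.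
  under [RHS]eq_bigr => n _ do rewrite exchange_big /=.
  rewrite exchange_big /=; apply: eq_bigr => i _.
  rewrite /series /= -!from1 ?lamb0 ?mulr0// mulr_suml; apply: eq_bigr => n _.
  by rewrite mulr_sumr; apply: eq_bigr => m _; ring.
under [X in _ = X]eq_bigr => n _ do under eq_bigr => m _ do rewrite mulrBr.
under [X in _ = X]eq_bigr => n _ do rewrite sumrB.
rewrite sumrB; ring.
Qed.

End Lambert.

(** * The differential system of level 3 *)

Section LambertIdentities.
Context {R : realType}.
Local Notation C := (Cplx R).

Lemma polybd_chi (h : nat -> nat -> nat) : polybd2 (fun n m => chi (h n m) : C).
Proof.
exists 1, 0; split=> // n m; rewrite expr0 mulr1.
by case: (@residueP R (h n m)) => -[-> _]; rewrite ?abscN ?absc1 ?absc0.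
Qed.

Lemma polybd_three (h : nat -> nat -> nat) : polybd2 (fun n m => three (h n m) : C).
Proof.
exists 1, 0; split=> // n m; rewrite expr0 mulr1.
by case: (@residueP R (h n m)) => -[_ ->]; rewrite ?absc1 ?absc0.
Qed.

Ltac polybd_rec := lazymatch goal with
  | |- polybd2 (fun n m => @?f n m + @?g n m) => apply: (@polybdD _ f g); polybd_rec
  | |- polybd2 (fun n m => @?f n m * @?g n m) => apply: (@polybdM _ f g); polybd_rec
  | |- polybd2 (fun n m => - @?f n m) => apply: (@polybdN _ f); polybd_rec
  | |- polybd2 (fun n m => (@?f n m) ^+ ?k) => apply: (@polybdX _ f k); polybd_rec
  | |- polybd2 (fun n m => chi (@?h n m)) => exact: (polybd_chi h)
  | |- polybd2 (fun n m => three (@?h n m)) => exact: (polybd_three h)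
  | |- polybd2 (fun n m => n%:R) => exact: polybd_fst
  | |- polybd2 (fun n m => m%:R) => exact: polybd_snd
  | |- polybd2 (fun n m => (n + m)%:R) => exact: polybd_add
  | |- polybd2 (fun n m => ?a) => exact: (polybd_cst a)
  end.

Definition n_chi0 (n : nat) : C := n%:R * (1 - three n).
Definition n_three (n : nat) : C := n%:R * three n.
Definition n2chi (n : nat) : C := n%:R ^+ 2 * chi n.
Definition n4chi (n : nat) : C := n%:R ^+ 4 * chi n.

Ltac polybd := rewrite /polybd /n_chi0 /n_three /n2chi /n4chi; polybd_rec.

(* [aF] is the cubic theta function [a] of the Borweins, [betaF] is [b^3], [gammaF] is [3 E_5],
   and [XF = (1 - E_2(tau)) / 24], [XF - YF = (1 - E_2(3 tau)) / 8]. *)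
Definition aF (q : C) : C := 1 + 6 * Lam chi q.
Definition betaF (q : C) : C := 1 - 9 * Lam n2chi q.
Definition gammaF (q : C) : C := 1 + 3 * Lam n4chi q.
Definition XF (q : C) : C := Lam (fun n => n%:R) q.
Definition YF (q : C) : C := Lam n_chi0 q.

Lemma Lam_n_three q : absc q < 1 -> Lam n_three q = XF q - YF q.
Proof.
move=> q1; apply/eqP; rewrite -subr_eq opprK eq_sym; apply/eqP.
rewrite /XF /YF -LamD//; try by polybd.
by congr Lam; apply/funext => n; rewrite /n_three /n_chi0; ring.
Qed.

Lemma Lam2_0 q : Lam2 (fun=> 0 : C) q = 0.
Proof.
apply: SumE; apply: sq_near (sq_cst 0); apply: nearW => n.
by rewrite /series /= big1// => i _; rewrite mul0r.
Qed.

(** For [S = Lam chi q], [ker1] gives [S^2 = (YF q - S) / 3]; completing the square gives the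
    constants 6 and 12. In classical terms, [a^2] is [(3 E_2(3 tau) - E_2(tau)) / 2]. *)
Lemma aF_sqr q : absc q < 1 -> aF q ^+ 2 = 1 + 12 * YF q.
Proof.
move=> q1.
have := @liouville R (at_residues ker1) [:: (chi, chi)]
  (fun n => 3^-1 * n_chi0 n + - 3^-1 * chi n) (fun=> 0) q q1 (@ker1_sym R) (@ker1_symD R).
rewrite big_seq1 /= Lam2_0 LamD//; try by polybd.
rewrite !LamZ//; try by polybd.
rewrite /aF /YF => H.
have E : Lam chi q * Lam chi q = 3^-1 * Lam n_chi0 q + - 3^-1 * Lam chi q - 0.
  apply: H.
  - by rewrite /at_residues /ker1; polybd.
  - by move=> n m; rewrite ker1_sub big_seq1.
  - by case=> [|i]; rewrite /= ?nth_nil; split; rewrite /cst /=; polybd.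
  - by move=> k k0; rewrite sum_ker1// /n_chi0; field.
  - by polybd.
  - exact: ker1_diag.
  - by polybd.
rewrite (_ : _ ^+ 2 = 1 + 12 * Lam chi q + 36 * (Lam chi q * Lam chi q)); last by ring.
by rewrite E; field.
Qed.

Lemma dLam_chi q : absc q < 1 ->
  6 * (q * dLam chi q) = (aF q - betaF q) / 3 - aF q * (2 * XF q - 3 * YF q).
Proof.
move=> q1; rewrite dLamE//; last by polybd.
(* [nc n] is [n * (3 * three n - 1)], in a form that [XF] and [YF] evaluate. It is introduced as an
   opaque function so that the linearity rewrites leave [Lam nc] whole. *)
have [nc ncE] : exists nc : nat -> C, nc = (fun n => 2 * n_three n + - 1 * n_chi0 n) by eexists.
have LN : Lam nc q = 2 * (XF q - YF q) - YF q.
  rewrite ncE LamD//; try by polybd.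
  by rewrite !LamZ ?Lam_n_three//; try (by polybd); rewrite mulN1r.
have E : Lam chi q * Lam nc q + Lam nc q * Lam chi q =
    (Lam n2chi q + - 2 * Lam (fun n => n%:R * chi n) q + - 3^-1 * Lam nc q + 2 / 3 * Lam chi q)
    - 2 * Lam2 (fun n => n%:R * chi n) q.
  have := @liouville R (at_residues ker2) [:: (chi, nc); (nc, chi)]
    (fun n => n2chi n + - 2 * (n%:R * chi n) + - 3^-1 * nc n + 2 / 3 * chi n)
    (fun n => 2 * (n%:R * chi n)) q q1 (@ker2_sym R) (@ker2_symD R).
  rewrite 2!big_cons big_nil addr0 /= !LamD//; try by rewrite ?ncE; polybd.
  rewrite !LamZ ?Lam2Z//; try by rewrite ?ncE; polybd.
  apply.
  - by rewrite /at_residues /ker2 /chi_sub; polybd.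
  - move=> n m; rewrite ker2_sub !big_cons big_nil /= ncE /n_three /n_chi0; ring.
  - by case=> [|[|i]]; rewrite /= ?nth_nil; split; rewrite /cst ?ncE /=; polybd.
  - by move=> k k0; rewrite sum_ker2// ncE /n2chi /n_three /n_chi0; field.
  - by rewrite ncE; polybd.
  - by move=> n; rewrite ker2_diag; ring.
  - by polybd.
have -> : Lam (fun n => n%:R * chi n) q + Lam2 (fun n => n%:R * chi n) q =
  (Lam n2chi q - 3^-1 * Lam nc q + 2 / 3 * Lam chi q - 2 * (Lam chi q * Lam nc q)) / 2.
  have : 2 * Lam2 (fun n => n%:R * chi n) q =
    (Lam n2chi q + - 2 * Lam (fun n => n%:R * chi n) q + - 3^-1 * Lam nc q + 2 / 3 * Lam chi q)
     - (Lam chi q * Lam nc q + Lam nc q * Lam chi q) by rewrite E; ring.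
  move=> E2; have -> : Lam2 (fun n => n%:R * chi n) q =
    2^-1 * (2 * Lam2 (fun n => n%:R * chi n) q) by field.
  by rewrite E2; field.
by rewrite LN /aF /betaF; field.
Qed.

(** For [S = Lam n2chi q], the only quadratic term of [(1 + 12 Y) (1 - 9 S)] is [-108 Y S], which
    [ker5] turns into [3 Lam n4chi - 12 Y + 9 S]; the terms of lower weight cancel. *)
Lemma gammaE q : absc q < 1 -> aF q ^+ 2 * betaF q = gammaF q.
Proof.
move=> q1; rewrite aF_sqr//.
have E : - YF q * Lam n2chi q + - Lam n2chi q * YF q =
    18^-1 * Lam n4chi q + - (2 / 9) * YF q + 6^-1 * Lam n2chi q.
  have := @liouville R (at_residues ker5)
    [:: (fun n => -1 * n_chi0 n, n2chi); (fun n => -1 * n2chi n, n_chi0)]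
    (fun n => 18^-1 * n4chi n + - (2 / 9) * n_chi0 n + 6^-1 * n2chi n)
    (fun n => 0) q q1 (@ker5_sym R) (@ker5_symD R).
  rewrite 2!big_cons big_nil addr0 /= Lam2_0 subr0 !LamD//; try by polybd.
  rewrite !LamZ//; try by polybd.
  rewrite -/(YF q) !mulN1r; apply.
  - by rewrite /at_residues /ker5 /chi_sub; polybd.
  - move=> n m; rewrite ker5_sub !big_cons big_nil /= /n2chi /n_chi0; ring.
  - by case=> [|[|i]]; rewrite /= ?nth_nil; split; rewrite /cst /=; polybd.
  - by move=> k k0; rewrite sum_ker5// /n4chi /n2chi /n_chi0; field.
  - by polybd.
  - by move=> n; rewrite ker5_diag.
  - by polybd.
rewrite /gammaF /betaF.
have -> : Lam n4chi q = 18 * (- YF q * Lam n2chi q + - Lam n2chi q * YF q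
    + 2 / 9 * YF q - 6^-1 * Lam n2chi q).
  by rewrite E; field.
by field.
Qed.

(** [ker3] is built so that [beta] factors out: the logarithmic derivative [-(6 X + 3 Y)] found here
    is three times that of [b], which later identifies [beta] with [b^3]. *)
Lemma dLam_n2chi q : absc q < 1 ->
  - 9 * (q * dLam n2chi q) = - (6 * XF q + 3 * YF q) * betaF q.
Proof.
move=> q1; rewrite dLamE//; last by polybd.
have L3 := Lam_n_three q1.
have E : -18 * (Lam n2chi q * YF q) - 12 * (Lam n2chi q * (XF q - YF q)) =
    2 * Lam (fun n => n%:R * n2chi n) q + - (4 / 3) * (XF q - YF q) + - 2 * YF q
    + 2 * Lam2 (fun n => n%:R * n2chi n) q.
  have := @liouville R (at_residues ker3)
    [:: (fun n => -9 * n2chi n, n_chi0); (fun n => -9 * n_chi0 n, n2chi);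
     (fun n => -6 * n2chi n, n_three); (fun n => -6 * n_three n, n2chi)]
    (fun n => 2 * (n%:R * n2chi n) + - (4 / 3) * n_three n + - 2 * n_chi0 n)
    (fun n => - 2 * (n%:R * n2chi n)) q q1 (@ker3_sym R) (@ker3_symD R).
  rewrite 4!big_cons big_nil addr0 /= !LamD//; try by polybd.
  rewrite !LamZ ?Lam2Z//; try by polybd.
  rewrite -/(YF q) L3 => H.
  rewrite (_ : _ - _ = -9 * Lam n2chi q * YF q + (-9 * YF q * Lam n2chi q +
     (-6 * Lam n2chi q * (XF q - YF q) + -6 * (XF q - YF q) * Lam n2chi q))); last by ring.
  rewrite H; first by ring.
  - by rewrite /at_residues /ker3 /chi_sub /three_sub; polybd.
  - move=> n m; rewrite ker3_sub !big_cons big_nil /= /n2chi /n_chi0 /n_three; ring.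
  - by case=> [|[|[|[|i]]]]; rewrite /= ?nth_nil; split; rewrite /cst /=; polybd.
  - by move=> k k0; rewrite sum_ker3// /n2chi /n_chi0 /n_three; field.
  - by polybd.
  - by move=> n; rewrite ker3_diag /n2chi; ring.
  - by polybd.
have -> : Lam2 (fun n => n%:R * n2chi n) q =
    2^-1 * (-18 * (Lam n2chi q * YF q) - 12 * (Lam n2chi q * (XF q - YF q))
   - (2 * Lam (fun n => n%:R * n2chi n) q + - (4 / 3) * (XF q - YF q) + - 2 * YF q)).
  by rewrite E; field.
by rewrite /betaF; field.
Qed.

(** This is Ramanujan's equation [12 D E_2 = E_2^2 - E_4] for [E_2 = 1 - 24 X], with [E_4] in its
    level 3 form [9 a^4 - 8 a beta]. *)
Lemma dLam_n q : absc q < 1 ->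
  - 288 * (q * dLam (fun n => n%:R) q) =
  1 - 48 * XF q + 576 * XF q ^+ 2 - 9 * aF q ^+ 4 + 8 * aF q * betaF q.
Proof.
move=> q1; rewrite dLamE//; last by polybd.
have E : 4 * (XF q * XF q) - 9 * (YF q * YF q) - 3 * (Lam chi q * Lam n2chi q) =
    3^-1 * XF q + 3 / 2 * YF q + - 3^-1 * Lam chi q + 2^-1 * Lam n2chi q +
    - 2 * Lam (fun n => n%:R * n%:R) q - 2 * Lam2 (fun n => n%:R * n%:R) q.
  have := @liouville R (at_residues ker4)
    [:: (fun n => 4 * n%:R, fun n => n%:R); (fun n => -9 * n_chi0 n, n_chi0);
     (fun n => - (3 / 2) * chi n, n2chi); (fun n => - (3 / 2) * n2chi n, chi)]
    (fun n => 3^-1 * n%:R + 3 / 2 * n_chi0 n + - 3^-1 * chi n + 2^-1 * n2chi n + - 2 * (n%:R * n%:R))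
    (fun n => 2 * (n%:R * n%:R)) q q1 (@ker4_sym R) (@ker4_symD R).
  rewrite 4!big_cons big_nil addr0 /= !LamD//; try by polybd.
  rewrite !LamZ ?Lam2Z//; try by polybd.
  rewrite -/(YF q) -/(XF q) => H.
  rewrite -H.
  - by field.
  - by rewrite /at_residues /ker4 /chi_sub /three_sub; polybd.
  - move=> n m; rewrite ker4_sub !big_cons big_nil /= /n2chi /n_chi0; by field.
  - by case=> [|[|[|[|i]]]]; rewrite /= ?nth_nil; split; rewrite /cst /=; polybd.
  - by move=> k k0; rewrite sum_ker4// /n2chi /n_chi0; field.
  - by polybd.
  - by move=> n; rewrite ker4_diag; ring.
  - by polybd.
rewrite (_ : aF q ^+ 4 = (aF q ^+ 2) ^+ 2); last by rewrite -exprM.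
rewrite aF_sqr//.
have -> : Lam2 (fun n => n%:R * n%:R) q =
    2^-1 * (3^-1 * XF q + 3 / 2 * YF q + - 3^-1 * Lam chi q + 2^-1 * Lam n2chi q +
    - 2 * Lam (fun n => n%:R * n%:R) q
    - (4 * (XF q * XF q) - 9 * (YF q * YF q) - 3 * (Lam chi q * Lam n2chi q))).
  by rewrite E; field.
by rewrite /aF /betaF; field.
Qed.

End LambertIdentities.

(** * Eta quotients *)

Section ThetaDerivative.
Context {R : realType}.
Local Notation C := (Cplx R).

(* The derivation [q d/dq]. *)
Definition th (f : C -> C) (q d : C) : Prop := exists2 d', dv f q d' & q * d' = d.

Lemma th_eq f q a b : th f q a -> a = b -> th f q b.
Proof. by move=> h <-. Qed.

Lemma th_cvg f q d : th f q d -> f @ near_c q --> f q.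
Proof. by case=> d' /dv_cvg. Qed.

Lemma th_cst a q : th (fun=> a) q 0.
Proof. by exists 0; [exact: dv_cst|rewrite mulr0]. Qed.

Lemma th_id q : th (fun y => y) q q.
Proof. by exists 1; [exact: dv_id|rewrite mulr1]. Qed.

Lemma thD f g q a b : th f q a -> th g q b -> th (fun y => f y + g y) q (a + b).
Proof.
by move=> [a' fa <-] [b' gb <-]; exists (a' + b'); [exact: dvD|rewrite mulrDr].
Qed.

Lemma thB f g q a b : th f q a -> th g q b -> th (fun y => f y - g y) q (a - b).
Proof.
by move=> [a' fa <-] [b' gb <-]; exists (a' - b'); [exact: dvB|rewrite mulrBr].
Qed.

Lemma thM f g q a b : th f q a -> th g q b ->
  th (fun y => f y * g y) q (a * g q + f q * b).
Proof.
move=> [a' fa <-] [b' gb <-]; exists (a' * g q + f q * b'); first exact: dvM.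
by ring.
Qed.

Lemma thX f q a n : th f q a -> th (fun y => f y ^+ n) q (n%:R * a * f q ^+ n.-1).
Proof.
by move=> [a' fa <-]; exists (n%:R * a' * f q ^+ n.-1); [exact: dvX|ring].
Qed.

Lemma th_div f g q a b : g q != 0 -> th f q a -> th g q b ->
  th (fun y => f y / g y) q ((a * g q - f q * b) / g q ^+ 2).
Proof.
move=> g0 [a' fa <-] [b' gb <-]; exists ((a' * g q - f q * b') / g q ^+ 2).
  exact: dv_div.
by field.
Qed.

Lemma th_near f g q a : (\forall y \near near_c q, f y = g y) -> th f q a -> th g q a.
Proof. by move=> fg [a' fa <-]; exists a' => //; exact: dv_near fg fa. Qed.

Lemma th0_dv f q : q != 0 -> th f q 0 -> dv f q 0.
Proof.
move=> q0 [d fd /eqP]; rewrite mulf_eq0 (negbTE q0) /= => /eqP d0.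
by rewrite d0 in fd.
Qed.

(** Off the origin [q f' = 0] gives [f' = 0], so the mean value inequality applies with bound 0;
    continuity at [s = 0] reaches the cusp. *)
Lemma th0_ray (f : C -> C) (q : C) :
  (forall s : R, 0 <= s <= 1 -> f @ near_c (s%:C * q) --> f (s%:C * q)) ->
  (forall s : R, 0 < s < 1 -> th f (s%:C * q) 0) -> f q = f 0.
Proof.
move=> fc fth; have [->//|q0] := eqVneq q 0.
have H : absc (f (0 + q) - f 0) <= 2 * 0 * absc q.
  apply: (@mean_value _ f (fun=> 0)) => [s|s|s _]; rewrite ?add0r.
  - exact: fc.
  - move=> s01; apply: th0_dv; last exact: fth.
    rewrite mulf_neq0//; have [s0 _] := andP s01.
    by rewrite -absc_eq0 absc_real normr_eq0 gt_eqF.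
  - by rewrite absc0.
have : absc (f q - f 0) == 0.
  by rewrite eq_le absc_ge0 andbT; move: H; rewrite mulr0 mul0r add0r.
by rewrite absc_eq0 subr_eq0 => /eqP.
Qed.

Lemma absc_ray (s : R) (q : C) : 0 <= s <= 1 -> absc (s%:C * q) <= absc q.
Proof.
by move=> /andP[s0 s1]; rewrite abscM absc_real ger0_norm// ler_piMl ?absc_ge0.
Qed.

Lemma th_Lam (f : nat -> C) q : absc q < 1 -> polybd f ->
  th (Lam f) q (q * dLam f q).
Proof. by move=> q1 pf; exists (dLam f q) => //; exact: dv_Lam. Qed.

End ThetaDerivative.

(** * Convergence and logarithmic derivative of the Euler product *)

Section EulerProduct.
Context {R : realType}.
Local Notation C := (Cplx R).

Definition eulerN (n : nat) (q : C) : C := \prod_(1 <= k < n) (1 - q ^+ k).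

Definition euler (q : C) : C := limn (eulerN^~ q : nat -> C).

(** The inequality [1 + x <= exp x] turns the product into the exponential of a geometric sum,
    uniformly in [n]. *)
Lemma prod_bound (x : nat -> C) (c r : R) n : 0 <= c -> 0 <= r < 1 ->
  (forall k, (0 < k)%N -> absc (x k) <= 1 + c * r ^+ k) ->
  absc (\prod_(1 <= k < n) x k) <= expR (c / (1 - r)).
Proof.
move=> c0 r01 xk; have [r0 r1] := andP r01.
apply: (@le_trans _ _ (expR (\sum_(1 <= k < n) c * r ^+ k))); last first.
  rewrite ler_expR (le_trans (sum_geometric_le 1 n c0 r01))// expr1.
  by rewrite ler_wpM2r ?invr_ge0 ?subr_ge0 ?ler_piMr// ltW.
elim: n => [|n ih]; first by rewrite !big_geq// absc1 expR0.
case: n ih => [_|n ih]; first by rewrite !big_geq// absc1 expR0.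
have -> : \prod_(1 <= k < n.+2) x k = \prod_(1 <= k < n.+1) x k * x n.+1.
  by rewrite big_nat_recr.
rewrite abscM [X in expR X]big_nat_recr//= expRD ler_pM ?absc_ge0//.
by rewrite (le_trans (xk _ _))// expR_ge1Dx.
Qed.

Lemma eulerN_bound (r : R) n (y : C) : 0 <= r < 1 -> absc y <= r ->
  absc (eulerN n y) <= expR (1 / (1 - r)).
Proof.
move=> r01 yr; have [r0 _] := andP r01; apply: prod_bound => // k _.
rewrite (le_trans (abscB _ _))// absc1 lerD2l mul1r abscX.
by rewrite lerXn2r ?nnegrE ?absc_ge0.
Qed.

Lemma eulerN_neq0 n (y : C) : absc y < 1 -> eulerN n y != 0.
Proof.
move=> y1; rewrite /eulerN prodf_seq_neq0; apply/allP => k.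
by rewrite mem_index_iota => /andP[k0 _]; apply/implyP => _; exact: one_subX_neq0.
Qed.

(** The inverse of a factor is [1 + u_k] with [u_k] geometrically small, so [prod_bound] applies to
    the inverse product. As the bound is uniform in [n], the infinite product is nonzero. *)
Lemma eulerN_lower_bound (r : R) n (y : C) : 0 <= r < 1 -> absc y <= r ->
  (expR ((1 - r)^-1 / (1 - r)))^-1 <= absc (eulerN n y).
Proof.
move=> r01 yr; have [r0 r1] := andP r01.
have y1 : absc y < 1 by exact: le_lt_trans yr r1.
have p0 : 0 < absc (eulerN n y).
  by rewrite lt_neqAle absc_ge0 andbT eq_sym absc_eq0 eulerN_neq0.
rewrite -[leRHS]invrK lef_pV2 ?posrE ?invr_gt0 ?expR_gt0// -abscV.
rewrite /eulerN -prodfV; apply: prod_bound => //; first by rewrite invr_ge0 subr_ge0 ltW.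
move=> k k0; have h := one_subX_neq0 y1 k0.
have -> : (1 - y ^+ k)^-1 = 1 + lamb y k by rewrite /lamb; field.
by rewrite (le_trans (abscD _ _))// absc1 lerD2l lamb_le.
Qed.

(** Minus the logarithmic derivative of the partial product; [deulerN] restores the sign. *)
Definition log_eulerN (n : nat) (y : C) : C :=
  \sum_(1 <= k < n) k%:R * y ^+ k.-1 / (1 - y ^+ k).

Definition deulerN (n : nat) (y : C) : C := - eulerN n y * log_eulerN n y.

Lemma eulerNS n (y : C) : (0 < n)%N -> eulerN n.+1 y = eulerN n y * (1 - y ^+ n).
Proof. by move=> n0; rewrite /eulerN big_nat_recr. Qed.

Lemma deulerNS n (y : C) : absc y < 1 -> (0 < n)%N ->
  deulerN n.+1 y = deulerN n y * (1 - y ^+ n) - eulerN n y * (n%:R * y ^+ n.-1).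
Proof.
move=> y1 n0; rewrite /deulerN eulerNS// /log_eulerN big_nat_recr//=.
by have h := one_subX_neq0 y1 n0; field.
Qed.

Lemma dv_eulerN n (y : C) : absc y < 1 -> dv (eulerN n) y (deulerN n y).
Proof.
move=> y1; elim: n => [|n ih]; last case: n ih => [_|n ih].
- rewrite (_ : eulerN 0 = fun=> 1); last by apply/funext => z; rewrite /eulerN big_geq.
  by rewrite /deulerN /log_eulerN big_geq// mulr0; exact: dv_cst.
- rewrite (_ : eulerN 1 = fun=> 1); last by apply/funext => z; rewrite /eulerN big_geq.
  by rewrite /deulerN /log_eulerN big_geq// mulr0; exact: dv_cst.
- rewrite (_ : eulerN n.+2 = fun z => eulerN n.+1 z * (1 - z ^+ n.+1)); last first.
    by apply/funext => z; rewrite eulerNS.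
  have := dvM ih (dvB (dv_cst 1 y) (dvX n.+1 (dv_id y))); move/dv_eq; apply.
  by rewrite (deulerNS y1 (ltn0Sn n)) /=; ring.
Qed.

Lemma sum_n_geometric_bounded (r : R) : 0 <= r < 1 ->
  exists2 B : R, 0 <= B & forall n, \sum_(1 <= k < n) k%:R * r ^+ k.-1 <= B.
Proof.
move=> r01; have [r0 r1] := andP r01.
have [K [rho [K0 rho01 H]]] := poly_geometric 1 r01.
have [rho0 rho1] := andP rho01.
exists (K / (1 - rho)); first by rewrite divr_ge0// subr_ge0 ltW.
case=> [|n]; first by rewrite big_geq// divr_ge0// subr_ge0 ltW.
rewrite big_add1 /=; apply: (@le_trans _ _ (\sum_(0 <= k < n) K * rho ^+ k)).
  by apply: ler_sum_nat => k _; have := H k; rewrite expr1.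
by have := sum_geometric_le 0 n K0 rho01; rewrite expr0 mulr1.
Qed.

(** The product is written as the telescoping series of the differences [eulerN n.+1 - eulerN n],
    which [dv_Sum] can differentiate. *)
Lemma euler_facts (q : C) : absc q < 1 ->
  [/\ eulerN^~ q @ \oo --> euler q, euler q != 0 & th euler q (- euler q * XF q)].
Proof.
move=> q1; pose r := (1 + absc q) / 2.
have r01' : 0 < r < 1 by have := absc_ge0 q; rewrite /r; lra.
have [r0 r1] := andP r01'; have r01 : 0 <= r < 1 by rewrite ltW.
have qr : absc q < r by rewrite /r; lra.
pose A := expR (1 / (1 - r)); have A0 : 0 < A by exact: expR_gt0.
have [B B0 HB] := sum_n_geometric_bounded r01.
pose phi n (y : C) := eulerN n.+1 y - eulerN n y.
pose dphi n (y : C) := deulerN n.+1 y - deulerN n y.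
(* The telescoping starts at the empty product [eulerN 0 y = 1]. *)
have sphi y n : series (phi^~ y) n = eulerN n y - 1.
  by rewrite /series /= telescope_sumr// /eulerN [X in _ - X]big_geq.
have sdphi y n : series (dphi^~ y) n = deulerN n y.
  rewrite /series /= telescope_sumr//.
  by rewrite /deulerN /log_eulerN [X in _ - _ * X]big_geq// mulr0 subr0.
have phiE n y : (0 < n)%N -> phi n y = - y ^+ n * eulerN n y.
  by move=> n0; rewrite /phi eulerNS//; ring.
have logB n y : absc y <= r -> absc (log_eulerN n y) <= B / (1 - r).
  move=> yr; rewrite (le_trans (absc_sum _ _ _))//.
  apply: (@le_trans _ _ (\sum_(1 <= k < n) k%:R * r ^+ k.-1 * (1 - r)^-1)).
    apply: ler_sum_nat => k /andP[k0 _]; rewrite !abscM abscV abscX absc_nat.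
    have h := one_subX_ge yr r1 k0.
    apply: ler_pM; rewrite ?mulr_ge0 ?exprn_ge0 ?invr_ge0 ?absc_ge0//.
      by rewrite ler_wpM2l// lerXn2r ?nnegrE ?absc_ge0// ltW.
    by rewrite lef_pV2 ?posrE ?subr_gt0// (lt_le_trans _ h)// subr_gt0.
  by rewrite -mulr_suml ler_wpM2r ?invr_ge0 ?subr_ge0 ?(ltW r1).
have dB n y : absc y <= r -> absc (deulerN n y) <= A * (B / (1 - r)).
  move=> yr; rewrite /deulerN abscM abscN ler_pM ?absc_ge0//; last exact: logB.
  exact: eulerN_bound.
(* For [|y| <= r], [A] bounds the partial products and [A * (B / (1 - r))] their derivatives. The
   [n]-th difference has derivative [-(y^n deulerN n + n y^(n-1) eulerN n)], and [A / r] makes up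
   for the exponent [n - 1]. *)
pose c := A / r + A * (B / (1 - r)).
have h1r : 0 < 1 - r by rewrite subr_gt0.
have c1 : 0 <= A / r by rewrite divr_ge0// ltW.
have c2 : 0 <= A * (B / (1 - r)) by rewrite mulr_ge0 ?divr_ge0// ltW.
have [K [rho [K0 rho01 HK]]] := poly_geometric 1 r01.
have dphiK n y : absc y < r -> absc (dphi n y) <= c * K * rho ^+ n.
  move=> /ltW yr; have y1 : absc y < 1 by exact: le_lt_trans yr r1.
  rewrite -mulrA; apply: (@le_trans _ _ (c * (n.+1%:R ^+ 1 * r ^+ n))); last first.
    by rewrite ler_wpM2l// addr_ge0.
  case: n => [|n].
    rewrite /dphi /deulerN /log_eulerN !big_geq// !mulr0 subrr absc0.
    by rewrite !mulr_ge0// addr_ge0.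
  have -> : dphi n.+1 y = - (y ^+ n.+1 * deulerN n.+1 y + n.+1%:R * y ^+ n * eulerN n.+1 y).
    by rewrite /dphi deulerNS//=; ring.
  rewrite abscN (le_trans (abscD _ _))// (abscM (y ^+ n.+1)) (abscM (_ * _)) (abscM n.+1%:R).
  rewrite !abscX absc_nat.
  have ry m : absc y ^+ m <= r ^+ m by rewrite lerXn2r ?nnegrE ?absc_ge0// ltW.
  have e1 : absc y ^+ n.+1 * absc (deulerN n.+1 y) <= r ^+ n.+1 * (A * (B / (1 - r))).
    by rewrite ler_pM ?exprn_ge0 ?absc_ge0// dB.
  have e2 : n.+1%:R * absc y ^+ n * absc (eulerN n.+1 y) <= n.+1%:R * r ^+ n * A.
    rewrite ler_pM ?mulr_ge0 ?exprn_ge0 ?absc_ge0 ?ler_wpM2l//.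
    exact: eulerN_bound.
  have e3 : n.+1%:R * r ^+ n * A = n.+1%:R * r ^+ n.+1 * (A / r).
    by rewrite exprS; field; rewrite gt_eqF.
  have rn0 : 0 <= r ^+ n.+1 by rewrite exprn_ge0// ltW.
  have n2 : (n.+2%:R : R) = n.+1%:R + 1 by rewrite -natr1.
  have n10 : (1 : R) <= n.+1%:R by rewrite ler1n.
  rewrite (le_trans (lerD e1 e2))// e3 expr1 n2 /c.
  set u := A / r in c1 *; set v := A * (B / (1 - r)) in c2 *.
  set w := r ^+ n.+1 in rn0 *.
  have p1 : 0 <= n.+1%:R * (w * v) by apply: mulr_ge0 => //; exact: mulr_ge0.
  have p2 : 0 <= w * u by exact: mulr_ge0.
  rewrite -subr_ge0 [X in 0 <= X](_ : _ = n.+1%:R * (w * v) + w * u); last by ring.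
  exact: addr_ge0.
have dphi_dv n y : absc y < r -> dv (phi n) y (dphi n y).
  by move=> yr; apply: dvB; apply: dv_eulerN; exact: lt_trans yr r1.
have phi_cvg y : absc y < r -> exists l : C, series (phi^~ y) @ \oo --> l.
  move=> /ltW yr; exists (Sum (phi^~ y)).
  apply: (@Sum_cvg _ _ A r) => // n.
  case: n => [|n].
    by rewrite /phi /eulerN !big_geq// subrr absc0 expr0 mulr1 ltW.
  rewrite phiE// abscM abscN abscX mulrC; apply: ler_pM; rewrite ?absc_ge0 ?exprn_ge0 ?absc_ge0//.
    exact: eulerN_bound.
  by rewrite lerXn2r ?nnegrE ?absc_ge0// ltW.
have ecvg y : absc y < r -> eulerN^~ y @ \oo --> euler y.
  move=> /phi_cvg[l hl]; have h := sqD hl (sq_cst 1).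
  have h' : eulerN^~ y @ \oo --> l + 1.
    by apply: sq_near h; apply: nearW => n; rewrite sphi subrK.
  by rewrite /euler (cvg_lim _ h').
have eE y : absc y < r -> euler y = Sum (phi^~ y) + 1.
  move=> yr; have [l hl] := phi_cvg y yr; rewrite (SumE hl).
  apply: cvgc_unique (ecvg y yr) _; have h := sqD hl (sq_cst 1).
  by apply: sq_near h; apply: nearW => n; rewrite sphi subrK.
have e0 : euler q != 0.
  rewrite -absc_eq0 gt_eqF//.
  apply: (@lt_le_trans _ _ (expR ((1 - r)^-1 / (1 - r)))^-1); first by rewrite invr_gt0 expR_gt0.
  apply: (cvg_absc_ge _ (ecvg q qr)) => n; apply: eulerN_lower_bound => //; exact: ltW.
split=> //; first exact: ecvg.
exists (Sum (dphi^~ q)).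
  have := dvD (dv_Sum rho01 dphi_dv dphiK phi_cvg qr) (dv_cst 1 q).
  rewrite addr0; apply: dv_near.
  exists (r - absc q); first by rewrite subr_gt0.
  move=> y yq; rewrite eE//.
  have : absc y <= absc q + absc (y - q) by rewrite -{1}(subrK q y) addrC abscD.
  by lra.
have h1 := sqM (sq_cst q) (Sum_cvg rho01 (fun n => dphiK n q qr)).
apply: cvgc_unique h1 _.
have pn : polybd (fun n => n%:R : C) by exact: polybd_fst.
(* [q * log_eulerN n q] is a partial sum of [XF q], because [k q^k / (1 - q^k) = k u_k]. *)
have := sqM (sqN (ecvg q qr)) (Lam_cvg q1 pn).
apply: sq_near; apply: nearW => n; rewrite sdphi /deulerN mulrCA; congr (_ * _).
rewrite /series /log_eulerN /= mulr_sumr; case: n => [|n]; first by rewrite !big_geq.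
rewrite big_nat_recl// mul0r add0r big_add1 /=; apply: eq_bigr => i _.
by rewrite /lamb exprS; ring.
Qed.

End EulerProduct.

(** * Logarithmic derivatives of [t] and [b], and the cubic relation *)

Section EtaQuotients.
Context {R : realType}.
Local Notation C := (Cplx R).

Lemma Lam_at0 (f : nat -> C) : Lam f 0 = 0.
Proof.
apply: SumE; apply: sq_near (sq_cst 0); apply: nearW => n.
rewrite /series /= big1// => -[|i] _; first by rewrite lamb0 mulr0.
by rewrite /lamb expr0n /= mul0r mulr0.
Qed.

Lemma dLam_at0 (f : nat -> C) : dLam f 0 = f 1.
Proof.
apply: SumE; apply: sq_near (sq_cst (f 1)); exists 2 => // -[|[|n]]//= _.
rewrite /series /= big_nat_recl// big_nat_recl// big1 => [|i _].
  by rewrite /= !mul0r mulr0 expr0 expr1 subr0 expr1n divr1 !mulr1 add0r addr0.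
by rewrite /= expr0n /= mulr0 mul0r mulr0.
Qed.

Lemma euler_at0 : euler (0 : C) = 1.
Proof.
apply: cvg_lim => //; apply: sq_near (sq_cst 1); apply: nearW => n.
rewrite /eulerN big_nat_cond big1// => i /andP[/andP[i0 _] _].
by case: i i0 => // i _; rewrite expr0n subr0.
Qed.

(** Since [lamb (q^3) k = lamb q (3 k)], the left side collects the indices divisible by 3: its
    partial sum to [n] is the one to [3 n] on the right. *)
Lemma XF_cube (q : C) : absc q < 1 -> 3 * XF (q ^+ 3) = XF q - YF q.
Proof.
move=> q1; rewrite -Lam_n_three//.
have q31 : absc (q ^+ 3) < 1 by exact: absc_expn_lt1.
have pn : polybd (fun n => n%:R : C) by exact: polybd_fst.
have p3 : polybd (n_three : nat -> C).
  by apply: polybdM; [exact: polybd_fst|exact: (polybd_three (fun n _ => n))].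
have h1 := sqM (sq_cst 3) (Lam_cvg q31 pn).
apply: cvgc_unique h1 _.
have /cvg_absP h2 := Lam_cvg q1 p3.
apply/cvg_absP => e e0; have [M HM] := h2 _ e0; exists M => n Mn.
have -> : 3 * series (fun k => k%:R * lamb (q ^+ 3) k) n =
    series (fun k => n_three k * lamb q k) (3 * n)%N.
  rewrite /series /=; elim: n {Mn} => [|n ih]; first by rewrite muln0 !big_nil mulr0.
  have rec3 (F : nat -> C) m : \sum_(0 <= i < m.+3) F i =
      \sum_(0 <= i < m) F i + (F m + F m.+1 + F m.+2).
    by rewrite 3?big_nat_recr//= !addrA.
  rewrite mulnS addnC addn3 rec3 big_nat_recr//= mulrDr ih; congr (_ + _).
  rewrite /n_three /three (_ : (3 %| 3 * n)%N = true) ?dvdn_mulr//.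
  rewrite (_ : (3 %| (3 * n).+1)%N = false) 1?(_ : (3 %| (3 * n).+2)%N = false).
  - by rewrite /lamb -exprM natrM /=; ring.
  - by rewrite -[X in (_ %| X)%N]addn2 dvdn_addr ?dvdn_mulr.
  - by rewrite -[X in (_ %| X)%N]addn1 dvdn_addr ?dvdn_mulr.
by apply: HM; rewrite (leq_trans Mn)// leq_pmull.
Qed.

Definition eulerq3 (q : C) : C := euler (q ^+ 3).

Lemma eulerq3_neq0 q : absc q < 1 -> eulerq3 q != 0.
Proof. by move=> q1; have [] := euler_facts (absc_expn_lt1 q1 (isT : (0 < 3)%N)). Qed.

Lemma euler_neq0 (q : C) : absc q < 1 -> euler q != 0.
Proof. by case/euler_facts. Qed.

Lemma th_euler (q : C) : absc q < 1 -> th euler q (- euler q * XF q).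
Proof. by case/euler_facts. Qed.

Lemma th_eulerq3 q : absc q < 1 -> th eulerq3 q (- eulerq3 q * (XF q - YF q)).
Proof.
move=> q1; have [_ _ [d hd dE]] := euler_facts (absc_expn_lt1 q1 (isT : (0 < 3)%N)).
exists (d * (3 * 1 * q ^+ 2)); first exact: dv_comp (dvX 3 (dv_id q)) hd.
rewrite -XF_cube// /eulerq3.
have -> : q * (d * (3 * 1 * q ^+ 2)) = 3 * (q ^+ 3 * d) by ring.
by rewrite dE; ring.
Qed.

(* [tF = eta(3 tau)^12 / eta(tau)^12] and [bF = eta(tau)^3 / eta(3 tau)] as functions of [q]. *)
Definition tF (q : C) : C := q * (eulerq3 q / euler q) ^+ 12.
Definition bF (q : C) : C := euler q ^+ 3 / eulerq3 q.

(** The factor [q] contributes 1 and the Euler products [12 (X - (X - Y))], so that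
    [D t / t = 1 + 12 Y = a^2]. *)
Lemma th_tF q : absc q < 1 -> th tF q (tF q * aF q ^+ 2).
Proof.
move=> q1; have e0 := euler_neq0 q1; have e30 := eulerq3_neq0 q1.
have := thM (th_id q) (thX 12 (th_div e0 (th_eulerq3 q1) (th_euler q1))).
move/th_eq; apply; rewrite aF_sqr// /tF /=; field; exact: e0.
Qed.

Lemma th_bF q : absc q < 1 -> th bF q (bF q * (- 2 * XF q - YF q)).
Proof.
move=> q1; have e0 := euler_neq0 q1; have e30 := eulerq3_neq0 q1.
have := th_div e30 (thX 3 (th_euler q1)) (th_eulerq3 q1).
move/th_eq; apply; rewrite /bF /=; field; exact: e30.
Qed.

Lemma bF_neq0 q : absc q < 1 -> bF q != 0.
Proof.
by move=> q1; rewrite mulf_neq0 ?invr_neq0 ?eulerq3_neq0// expf_neq0// euler_neq0.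
Qed.

Lemma tF_neq0 q : absc q < 1 -> q != 0 -> tF q != 0.
Proof.
move=> q1 q0; apply: mulf_neq0; first exact: q0.
apply: expf_neq0; apply: mulf_neq0; first exact: eulerq3_neq0.
by rewrite invr_eq0; exact: euler_neq0.
Qed.

Lemma polybd_chi1 : polybd (chi : nat -> C).
Proof. exact: (polybd_chi (fun n _ => n)). Qed.

Lemma polybd_n2chi : polybd (n2chi : nat -> C).
Proof.
by apply: polybdM; [apply: polybdX; exact: polybd_fst|exact: (polybd_chi (fun n _ => n))].
Qed.

Lemma th_aF (q : C) : absc q < 1 ->
  th aF q ((aF q - betaF q) / 3 - aF q * (2 * XF q - 3 * YF q)).
Proof.
move=> q1; rewrite -dLam_chi//.
have := thD (th_cst 1 q) (thM (th_cst 6 q) (th_Lam q1 polybd_chi1)).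
by move/th_eq; apply; ring.
Qed.

Lemma th_betaF (q : C) : absc q < 1 -> th betaF q (- (6 * XF q + 3 * YF q) * betaF q).
Proof.
move=> q1; rewrite -dLam_n2chi//.
have := thB (th_cst 1 q) (thM (th_cst 9 q) (th_Lam q1 polybd_n2chi)).
by move/th_eq; apply; ring.
Qed.

Lemma betaFE (q : C) : absc q < 1 -> betaF q = bF q ^+ 3.
Proof.
move=> q1.
have tht y : absc y < 1 -> th (fun y => betaF y / bF y ^+ 3) y 0.
  move=> y1; have b0 := bF_neq0 y1; have b30 : bF y ^+ 3 != 0 by rewrite expf_neq0.
  have := @th_div _ betaF (fun z => bF z ^+ 3) y _ _ b30 (th_betaF y1) (thX 3 (th_bF y1)).
  by move/th_eq; apply; rewrite /=; field.
have ray (s : R) : 0 <= s <= 1 -> absc (s%:C * q) < 1.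
  by move=> s01; exact: le_lt_trans (absc_ray q s01) q1.
have : betaF q / bF q ^+ 3 = betaF 0 / bF 0 ^+ 3.
  apply: (@th0_ray _ (fun y => betaF y / bF y ^+ 3)) => s s01.
    exact: th_cvg (tht _ (ray s s01)).
  by apply: tht; apply: ray; case/andP: s01 => s0 s1; rewrite !ltW.
have b30 : bF q ^+ 3 != 0 by rewrite expf_neq0// bF_neq0.
rewrite [betaF 0]/betaF /bF /eulerq3 Lam_at0 expr0n /= !euler_at0 mulr0 subr0 expr1n divr1 expr1n divr1.
by move/(canRL (divfK b30)); rewrite mul1r.
Qed.

Lemma betaF_neq0 (q : C) : absc q < 1 -> betaF q != 0.
Proof. by move=> q1; rewrite betaFE// expf_neq0// bF_neq0. Qed.

Lemma aF_at0 : aF (0 : C) = 1. Proof. by rewrite /aF Lam_at0 mulr0 addr0. Qed.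
Lemma betaF_at0 : betaF (0 : C) = 1. Proof. by rewrite /betaF Lam_at0 mulr0 subr0. Qed.

(* Both sides of [a^3 / beta - 1 = 27 t] have logarithmic derivative [a^2]; they agree to
   first order at the cusp. *)
Lemma aF_cube (q : C) : absc q < 1 -> aF q ^+ 3 = (1 + 27 * tF q) * betaF q.
Proof.
move=> q1; have [->|q0] := eqVneq q 0.
  by rewrite aF_at0 betaF_at0 /tF mul0r mulr0 addr0 expr1n mulr1.
pose y (z : C) := aF z ^+ 3 / betaF z - 1.
have zero1 : absc (0 : C) < 1 by rewrite absc0.
(* Here [3 D a / a - D beta / beta = a^2 - beta / a]; multiplied by [a^3 / beta] this is
   [a^2 (a^3 / beta - 1)], which explains the subtracted 1 in [y]. *)
have thy z : absc z < 1 -> th y z (y z * aF z ^+ 2).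
  move=> z1; have b0 := betaF_neq0 z1.
  have := thB (th_div b0 (thX 3 (th_aF z1)) (th_betaF z1)) (th_cst 1 z).
  move/th_eq; apply; rewrite /y /=.
  have -> : aF z ^+ 2 = 1 + 12 * YF z by rewrite aF_sqr.
  have -> : aF z ^+ 3 = aF z * (1 + 12 * YF z) by rewrite -aF_sqr// exprS.
  by field.
(* From [a = 1 + 6 q + ...] and [beta = 1 - 9 q + ...] the slope is [3 * 6 + 9 = 27]. *)
have dy0 : dv y (0 : C) 27.
  have da : dv aF (0 : C) 6.
    apply: (dv_eq (dvD (dv_cst 1 0) (dvM (dv_cst 6 0) (dv_Lam zero1 polybd_chi1)))).
    rewrite dLam_at0 (_ : chi 1 = 1); first by ring.
    by rewrite /chi chi3E.
  have db : dv betaF (0 : C) (- 9).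
    apply: (dv_eq (dvB (dv_cst 1 0) (dvM (dv_cst 9 0) (dv_Lam zero1 polybd_n2chi)))).
    rewrite dLam_at0 /n2chi (_ : chi 1 = 1); first by ring.
    by rewrite /chi chi3E.
  apply: (dv_eq (dvB (dv_div (betaF_neq0 zero1) (dvX 3 da) db) (dv_cst 1 0))).
  rewrite aF_at0 betaF_at0 /= !expr1n; by field.
have [g [g0 gc gE]] := dy0.
pose k (z : C) := (eulerq3 z / euler z) ^+ 12.
have y0 : y 0 = 0 by rewrite /y aF_at0 betaF_at0 expr1n divr1 subrr.
have k0 : k 0 = 1 by rewrite /k /eulerq3 expr0n /= !euler_at0 divr1 expr1n.
have kc : k @ near_c 0 --> k 0.
  exact: (th_cvg (thX 12 (th_div (euler_neq0 zero1) (th_eulerq3 zero1) (th_euler zero1)))).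
(* The quotient [y / tF] is [0 / 0] at the cusp. Its limit there is 27, because [tF z = z * k z]
   with [k 0 = 1]. *)
pose phi (z : C) := if z == 0 then 27 else y z / tF z.
have phic0 : phi @ near_c 0 --> phi 0.
  have -> : phi 0 = 27 / k 0 by rewrite /phi eqxx k0 divr1.
  have k00 : k 0 != 0 by rewrite k0 oner_eq0.
  have := atM gc (atV k00 kc); apply: at_near; exists 1 => // z.
  rewrite subr0 /phi => z1; case: eqP => [->|/eqP z0]; first by rewrite g0 k0 divr1.
  have := gE z; rewrite y0 !subr0 => ->; rewrite /tF -/(k z).
  have kz : k z != 0.
    rewrite /k; apply: expf_neq0; apply: mulf_neq0; first exact: eulerq3_neq0.
    by rewrite invr_eq0; exact: euler_neq0.
  by move: (k z) kz => kz' kz0; field; rewrite z0 kz0.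
have thphi z : z != 0 -> absc z < 1 -> th phi z 0.
  move=> z0 z1; have t0 := tF_neq0 z1 z0.
  have := th_div t0 (thy z z1) (th_tF z1).
  rewrite [X in th _ _ X](_ : _ = 0); last by field.
  apply: th_near; exists (absc z).
    by rewrite lt_neqAle absc_ge0 andbT eq_sym absc_eq0.
  move=> w; rewrite /phi; case: eqP => [->|//].
  by rewrite sub0r abscN ltxx.
have ray (s : R) : 0 <= s <= 1 -> absc (s%:C * q) < 1.
  by move=> s01; exact: le_lt_trans (absc_ray q s01) q1.
have sq0 (s : R) : s != 0 -> s%:C * q != 0.
  by move=> s0; rewrite mulf_neq0// -absc_eq0 absc_real normr_eq0.
have : phi q = phi 0.
  apply: th0_ray => s s01.
    have [->|s0] := eqVneq s 0; first by rewrite mul0r.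
    by apply: th_cvg (thphi _ (sq0 s s0) (ray s s01)).
  have [s0 s1] := andP s01.
  by apply: thphi; [apply: sq0; rewrite gt_eqF|apply: ray; rewrite !ltW].
rewrite /phi eqxx (negbTE q0) => /(canRL (divfK (tF_neq0 q1 q0))).
rewrite /y => /(canRL (subrK _)) h.
have b0 := betaF_neq0 q1.
have -> : aF q ^+ 3 = aF q ^+ 3 / betaF q * betaF q by rewrite divfK.
by rewrite h addrC.
Qed.

End EtaQuotients.

(** * The hypergeometric series *)

Section PowerSeries.
Context {R : realType}.
Local Notation C := (Cplx R).

Definition Pow (b : nat -> C) (w : C) : C := Sum (fun n => b n * w ^+ n).

Lemma Pow_dominated (b : nat -> C) (w : C) : absc w < 1 -> polybd b ->
  exists K rho : R, 0 <= rho < 1 /\ forall n, absc (b n * w ^+ n) <= K * rho ^+ n.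
Proof.
move=> w1 pb; have r01 : 0 <= absc w < 1 by rewrite absc_ge0.
have [K [rho [rho01 H]]] := polybd_dominated r01 ler01 pb.
by exists K, rho; split=> // n; apply: H; rewrite mul1r abscX.
Qed.

Lemma Pow_cvg (b : nat -> C) (w : C) : absc w < 1 -> polybd b ->
  series (fun n => b n * w ^+ n) @ \oo --> Pow b w.
Proof. by move=> w1 /(Pow_dominated w1)[K [rho [h H]]]; exact: Sum_cvg h H. Qed.

Lemma Pow_at0 (b : nat -> C) : Pow b 0 = b 0%N.
Proof.
apply: SumE; apply: sq_near (sq_cst (b 0%N)); exists 1%N => // -[|n]//= _.
rewrite /series /= big_nat_recl// big1 => [|i _]; first by rewrite expr0 mulr1 addr0.
by rewrite expr0n /= mulr0.
Qed.

Lemma th_Pow (b : nat -> C) (w : C) : absc w < 1 -> polybd b ->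
  th (Pow b) w (Pow (fun n => n%:R * b n) w).
Proof.
move=> w1 pb.
have pg : polybd (fun n => b n * n%:R) by apply: polybdM => //; exact: polybd_fst.
have pg' : polybd (fun n => n%:R * b n) by apply: polybdM => //; exact: polybd_fst.
pose r := (1 + absc w) / 2.
have r01' : 0 < r < 1 by have := absc_ge0 w; rewrite /r; lra.
have [r0 r1] := andP r01'; have r01 : 0 <= r < 1 by rewrite ltW.
have wr : absc w < r by rewrite /r; lra.
have L0 : 0 <= r^-1 by rewrite invr_ge0 ltW.
have [K [rho [rho01 H]]] := polybd_dominated r01 L0 pg.
have dK n (y : C) : absc y < r -> absc (b n * (n%:R * y ^+ n.-1)) <= K * rho ^+ n.
  move=> /ltW yr; case: n => [|n].
    have := H 0%N 0; rewrite absc0 !mulr0 mul0r mulr0 absc0; apply.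
    by rewrite mulr_ge0// exprn_ge0// ltW.
  rewrite mulrA; apply: H; rewrite abscX exprS mulrA mulVf ?gt_eqF// mul1r.
  by rewrite lerXn2r ?nnegrE ?absc_ge0// ltW.
exists (Sum (fun n => b n * (n%:R * w ^+ n.-1))).
  apply: (@dv_Sum _ (fun n y => b n * y ^+ n) (fun n y => b n * (n%:R * y ^+ n.-1)) r K rho) => //.
  - move=> n y _; have := dvM (dv_cst (b n) y) (dvX n (dv_id y)).
    by move/dv_eq; apply; ring.
  - by move=> y yr; exists (Pow b y); apply: Pow_cvg => //; exact: lt_trans yr r1.
have h1 := sqM (sq_cst w) (Sum_cvg rho01 (fun n => dK n w wr)).
apply: cvgc_unique h1 _; apply: sq_near (Pow_cvg w1 pg'); apply: nearW => n.
rewrite /series /= mulr_sumr; apply: eq_bigr => -[|i] _; first by rewrite !mul0r !mulr0.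
by rewrite exprS /=; ring.
Qed.

(** Chain rule in logarithmic form: [q d/dq] of the composite is [w d/dw] of [G], taken at
    [w = f q], times the logarithmic derivative [a] of [f]. *)
Lemma th_comp_log (f G : C -> C) q a d : th f q (f q * a) -> th G (f q) d ->
  th (fun y => G (f y)) q (d * a).
Proof.
move=> [f' hf fE] [G' hG <-]; exists (G' * f'); first exact: dv_comp hf hG.
by rewrite mulrCA fE; ring.
Qed.

Definition conv (b c : nat -> C) (n : nat) : C := \sum_(j < n.+1) b j * c (n - j)%N.

Lemma polybd_conv b c : polybd b -> polybd c -> polybd (conv b c).
Proof.
move=> /polybdP[K [d [K0 H]]] /polybdP[L [e [L0 H']]].
exists (K * L), (d + e).+1; split=> [|n m]; first exact: mulr_ge0.
rewrite (le_trans (absc_sum _ _ _))//.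
apply: (@le_trans _ _ (\sum_(j < n.+1) K * L * (n + m).+1%:R ^+ (d + e))).
  apply: ler_sum => -[j /= jn] _; rewrite abscM exprD mulrACA.
  have le1 k x : (x <= n)%N -> x.+1%:R ^+ k <= (n + m).+1%:R ^+ k :> R.
    move=> xn; rewrite lerXn2r ?nnegrE// ler_nat ltnS.
    by rewrite (leq_trans xn)// leq_addr.
  apply: ler_pM; rewrite ?absc_ge0//.
    by rewrite (le_trans (H _))// ler_wpM2l// le1// -ltnS.
  by rewrite (le_trans (H' _))// ler_wpM2l// le1// leq_subr.
rewrite sumr_const card_ord -[leLHS]mulr_natl exprS [leRHS]mulrCA.
by rewrite ler_wpM2r ?mulr_ge0 ?exprn_ge0// ler_nat ltnS leq_addr.
Qed.

Lemma sum_triangle0 (F : nat -> nat -> C) M :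
  \sum_(0 <= k < M) \sum_(j < k.+1) F j (k - j)%N =
  \sum_(0 <= n < M) \sum_(0 <= m < M - n) F n m.
Proof.
elim: M => [|M ih]; first by rewrite !big_nil.
rewrite big_nat_recr//= ih [RHS]big_nat_recr//= subSnn big_nat1 big_ord_recr/= subnn addrA.
congr (_ + _); rewrite -(big_mkord xpredT (fun j => F j (M - j)%N)) -big_split /=.
by apply: eq_big_nat => n /andP[_ nM]; rewrite subSn ?(ltnW nM)// big_nat_recr.
Qed.

(** For each [n < M] the products missing from the triangle form a geometric tail in [m >= M - n];
    times the [n]-th term this is of order [mu^M], and [poly_geometric] absorbs the [M] values of
    [n]. *)
Lemma PowM b c w : absc w < 1 -> polybd b -> polybd c ->
  Pow b w * Pow c w = Pow (conv b c) w.
Proof.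
move=> w1 pb pc.
have [K [rho [/andP[r0 r1] HK]]] := Pow_dominated w1 pb.
have [L [sig [/andP[s0 s1] HL]]] := Pow_dominated w1 pc.
pose mu := Num.max rho sig.
have mu01 : 0 <= mu < 1 by rewrite le_max r0 gt_max r1 s1.
have [mu0 mu1] := andP mu01.
have K0 := dominated_ge0 HK.
have L0 := dominated_ge0 HL.
have HK' n : absc (b n * w ^+ n) <= K * mu ^+ n.
  rewrite (le_trans (HK n))// ler_wpM2l// lerXn2r ?nnegrE// ?le_max ?lexx//.
have HL' n : absc (c n * w ^+ n) <= L * mu ^+ n.
  rewrite (le_trans (HL n))// ler_wpM2l// lerXn2r ?nnegrE// ?le_max ?lexx ?orbT//.
have h1 := sqM (Pow_cvg w1 pb) (Pow_cvg w1 pc).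
apply: cvgc_unique h1 _.
have pbc := polybd_conv pb pc.
suff D : (fun M => series (fun n => b n * w ^+ n) M * series (fun n => c n * w ^+ n) M
    - series (fun n => conv b c n * w ^+ n) M) @ \oo --> (0 : C).
  have := sqD D (Pow_cvg w1 pbc); rewrite add0r; apply: sq_near.
  by apply: nearW => n; rewrite subrK.
have [A [tau [A0 tau01 HA]]] := poly_geometric 1 mu01.
have e0 : 0 <= K * (L / (1 - mu)) by rewrite mulr_ge0// divr_ge0// subr_ge0 ltW.
apply: (@cvg_absc_squeeze _ _ _ (fun M => K * (L / (1 - mu)) * A * tau ^+ M));
  last exact: geometric_cvg0.
move=> M; rewrite subr0.
have -> : series (fun n => conv b c n * w ^+ n) M =
    \sum_(0 <= n < M) \sum_(0 <= m < M - n) (b n * w ^+ n) * (c m * w ^+ m).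
  rewrite -sum_triangle0; apply: eq_bigr => k _; rewrite /conv mulr_suml.
  apply: eq_bigr => -[j /= jk] _.
  have -> : w ^+ k = w ^+ j * w ^+ (k - j) by rewrite -exprD subnKC.
  by ring.
rewrite /series /= mulr_suml -sumrB (le_trans (absc_sum _ _ _))//.
apply: (@le_trans _ _ (\sum_(0 <= n < M) K * (L / (1 - mu)) * mu ^+ M)).
  apply: ler_sum_nat => n /andP[_ nM].
  rewrite -mulr_sumr -mulrBr abscM.
  have MnM : (M - n <= M)%N by exact: leq_subr.
  rewrite (big_cat_nat (leq0n _) MnM) /= [X in absc (X - _)]addrC addrK.
  have t1 : absc (\sum_(M - n <= m < M) c m * w ^+ m) <= L * mu ^+ (M - n) / (1 - mu).
    rewrite (le_trans (absc_sum _ _ _))// (le_trans _ (sum_geometric_le (M - n) M L0 mu01))//.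
    by apply: ler_sum_nat.
  rewrite (le_trans (ler_pM (absc_ge0 _) (absc_ge0 _) (HK' n) t1))//.
  rewrite -[in leRHS](subnKC (ltnW nM)) exprD.
  by rewrite le_eqVlt; apply/orP; left; apply/eqP; ring.
rewrite sumr_const_nat subn0 -[leLHS]mulr_natl -[leRHS]mulrA mulrCA ler_wpM2l//.
apply: le_trans (HA M); rewrite expr1 ler_wpM2r ?exprn_ge0// ler_nat//.
Qed.

End PowerSeries.

(** * The hypergeometric equation and its pullback along [27 t] *)

Section Hypergeometric.
Context {R : realType}.
Local Notation C := (Cplx R).

Definition hyp13 (n : nat) : rat := hyp2F1_coef (1 / 3) (1 / 3) 1 n.

Lemma pochhammerS a n : pochhammer a n.+1 = pochhammer a n * (a + n%:R).
Proof. by rewrite /pochhammer big_ord_recr. Qed.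

Lemma hyp13_0 : hyp13 0 = 1.
Proof. by rewrite /hyp13 /hyp2F1_coef /pochhammer !big_ord0 fact0; field. Qed.

Lemma hyp13S n : n.+1%:R ^+ 2 * hyp13 n.+1 = (n%:R + 1 / 3) ^+ 2 * hyp13 n.
Proof.
have p0 : pochhammer 1 n != 0.
  rewrite /pochhammer prodf_seq_neq0; apply/allP => i _; apply/implyP => _.
  by rewrite addrC natr1 pnatr_eq0.
have f0 : (n`!%:R : rat) != 0 by rewrite pnatr_eq0 -lt0n fact_gt0.
have n0 : (1 + n%:R : rat) != 0 by rewrite addrC natr1 pnatr_eq0.
rewrite /hyp13 /hyp2F1_coef !pochhammerS factS natrM -natr1 [n%:R + 1]addrC.
by field; rewrite p0 f0 n0.
Qed.

(** The sign of [B_n] is moved into the hypergeometric series, so that [sum B_n x^n] becomes the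
    cube of [Pow hC (27 * x)]. *)
Definition hC (n : nat) : C := (-1) ^+ n * ratr (hyp13 n).

Lemma hC_0 : hC 0 = 1. Proof. by rewrite /hC hyp13_0 expr0 mul1r rmorph1. Qed.

Lemma hCS n : n.+1%:R ^+ 2 * hC n.+1 = - (n%:R + 1 / 3) ^+ 2 * hC n.
Proof.
have E : n.+1%:R ^+ 2 * ratr (hyp13 n.+1) = (n%:R + 1 / 3) ^+ 2 * ratr (hyp13 n) :> C.
  have := congr1 (ratr : rat -> C) (hyp13S n).
  have rM x y : ratr (x * y) = ratr x * ratr y :> C by exact: rmorphM.
  have rD x y : ratr (x + y) = ratr x + ratr y :> C by exact: rmorphD.
  have r3 : ratr (1 / 3) = 1 / 3 :> C by rewrite fmorph_div /= ratr_nat rmorph1.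
  by rewrite !expr2 !rM !rD r3 !ratr_nat.
have -> : n.+1%:R ^+ 2 * hC n.+1 = - (-1) ^+ n * (n.+1%:R ^+ 2 * ratr (hyp13 n.+1)).
  by rewrite /hC (exprS (-1)); ring.
by rewrite E /hC; ring.
Qed.

Lemma hC_le1 n : absc (hC n) <= 1.
Proof.
elim: n => [|n ih]; first by rewrite hC_0 absc1.
have n0 : (n.+1%:R : C) ^+ 2 != 0 by rewrite expf_neq0// pnatr_eq0.
have -> : hC n.+1 = - ((n * 3 + 1)%:R / (n.+1 * 3)%:R) ^+ 2 * hC n.
  apply: (mulfI n0); rewrite hCS natrD !natrM.
  by field; rewrite ?natr1 ?nat1r pnatr_eq0.
rewrite abscM abscN abscX abscM abscV !absc_nat.
have u0 : 0 <= (n * 3 + 1)%:R / (n.+1 * 3)%:R :> R by rewrite divr_ge0.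
have u1 : (n * 3 + 1)%:R / (n.+1 * 3)%:R <= 1 :> R.
  by rewrite ler_pdivrMr ?ltr0n// mul1r ler_nat mulSn addnC leq_add2r.
by rewrite -[leRHS]mul1r ler_pM ?exprn_ge0 ?absc_ge0 ?exprn_ile1.
Qed.

Lemma polybd_hC : polybd hC.
Proof. by exists 1, 0%N; split=> // n m; rewrite expr0 mulr1 hC_le1. Qed.

(** With [F = Pow hC], [h1C] and [h2C] are the coefficients of [w d/dw F] and [(w d/dw)^2 F]. *)
Definition h1C (n : nat) : C := n%:R * hC n.
Definition h2C (n : nat) : C := n%:R * h1C n.

Lemma polybd_h1C : polybd h1C.
Proof. by apply: polybdM; [exact: polybd_fst|exact: polybd_hC]. Qed.

Lemma polybd_h2C : polybd h2C.
Proof. by apply: polybdM; [exact: polybd_fst|exact: polybd_h1C]. Qed.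

(* Hypergeometric equation for [2F1(1/3, 1/3; 1; - w)]. *)
Lemma hyp_ode w : absc w < 1 ->
  (1 + w) * Pow h2C w = - w * (2 / 3 * Pow h1C w + Pow hC w / 9).
Proof.
move=> w1.
suff E : Pow h2C w = - w * (Pow h2C w + 2 / 3 * Pow h1C w + 9^-1 * Pow hC w).
  by rewrite mulrDl mul1r {1}E; ring.
have h1 := Pow_cvg w1 polybd_h2C.
have h2 := sqM (sq_cst (- w)) (sqD (sqD h1 (sqM (sq_cst (2 / 3)) (Pow_cvg w1 polybd_h1C)))
  (sqM (sq_cst 9^-1) (Pow_cvg w1 polybd_hC))).
(* The recurrence [(n + 1)^2 h_(n+1) = -(n + 1/3)^2 h_n] shifts the index by one; [h2C 0 = 0], so
   the partial sum of length [n + 1] on the left matches length [n] on the right. *)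
have h1' : (fun n => series (fun n => h2C n * w ^+ n) (n + 1)%N) @ \oo --> Pow h2C w.
  by have := h1; rewrite -(cvg_shiftn 1).
apply: cvgc_unique h1' _; apply: sq_near h2; apply: nearW => n.
rewrite addn1 /series /= [RHS]big_nat_recl// /h2C !mul0r add0r.
rewrite !mulr_sumr -!big_split /= mulr_sumr; apply: eq_bigr => i _.
rewrite /h1C; have := hCS i; rewrite exprS => E.
rewrite [RHS](_ : _ = w * w ^+ i * (i.+1%:R ^+ 2 * hC i.+1)); last by rewrite exprS; ring.
by rewrite hCS; field.
Qed.

Lemma A_conv n : A_ n = 27 ^+ n *
  \sum_(j < n.+1) hyp13 j * \sum_(i < (n - j).+1) hyp13 i * hyp13 (n - j - i)%N.
Proof.
rewrite /A_ exprS expr2 coefM; congr (_ * _).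
have cE k : (k <= n)%N -> (\poly_(k < n.+1) hyp2F1_coef (1 / 3) (1 / 3) 1 k)`_k = hyp13 k.
  by move=> kn; rewrite coef_poly ltnS kn.
apply: eq_bigr => -[j /= jn] _; rewrite (cE j jn) coefM; congr (_ * _).
apply: eq_bigr => -[i /= ij] _; rewrite !cE//.
  by rewrite (leq_trans (leq_subr _ _))// leq_subr.
exact: (leq_trans (ij : i <= n - j)%N (leq_subr j n)).
Qed.

Lemma B_conv n : (ratr (B_ n) : C) = 27 ^+ n * conv hC (conv hC hC) n.
Proof.
rewrite /B_ A_conv !rmorphM !rmorphXn /= rmorphN rmorph1 ratr_nat mulrCA; congr (_ * _).
rewrite rmorph_sum mulr_sumr; apply: eq_bigr => -[j /= jn] _.
rewrite rmorphM rmorph_sum /hC /conv !mulr_sumr; apply: eq_bigr => -[i /= ij] _.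
rewrite rmorphM; have -> : (-1) ^+ n = (-1) ^+ j * ((-1) ^+ i * (-1) ^+ (n - j - i)) :> C.
  by rewrite -!exprD (subnKC (ij : i <= n - j)%N) (subnKC (jn : j <= n)%N).
by ring.
Qed.

Lemma B_series_cvg x : absc (27 * x) < 1 -> B_series x @ \oo --> Pow hC (27 * x) ^+ 3.
Proof.
move=> x1; have pc := polybd_conv polybd_hC polybd_hC.
rewrite exprS expr2 !PowM//; try exact: polybd_hC.
rewrite (_ : B_series x = series (fun n => conv hC (conv hC hC) n * (27 * x) ^+ n)).
  by apply: Pow_cvg => //; apply: polybd_conv => //; exact: polybd_hC.
rewrite /B_series; congr series; apply/funext => n.
by rewrite B_conv exprMn; ring.
Qed.

(* The solutions of the equation of [F], pulled back along [27 t], are spanned by [b] and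
   [b log q]; so [D (D (F (27 t) / b)) = 0], and regularity at the cusp excludes the logarithm. *)
Lemma hyp_tF q : absc q < 1 ->
  (forall s : R, 0 <= s <= 1 -> absc (27 * tF (s%:C * q)) < 1) ->
  Pow hC (27 * tF q) = bF q.
Proof.
move=> q1 tq.
pose w (z : C) := 27 * tF z.
pose h (z : C) := Pow hC (w z) / bF z.
(* [v] is [D b / b], and [Dh] is [D h] with [D (F o w) = (w d/dw F)(w) * a^2] inserted. *)
pose v (z : C) := - 2 * XF z - YF z.
pose Dh (z : C) := (aF z ^+ 2 * Pow h1C (w z) - v z * Pow hC (w z)) / bF z.
have ray (s : R) : 0 <= s <= 1 -> absc (s%:C * q) < 1.
  by move=> s01; exact: le_lt_trans (absc_ray q s01) q1.
have thw z : absc z < 1 -> th w z (w z * aF z ^+ 2).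
  move=> z1; have := thM (th_cst 27 z) (th_tF z1).
  by move/th_eq; apply; rewrite /w; ring.
have thG0 z : absc z < 1 -> absc (w z) < 1 ->
    th (fun y => Pow hC (w y)) z (Pow h1C (w z) * aF z ^+ 2).
  by move=> z1 w1; apply: (th_comp_log (thw z z1)); exact: th_Pow w1 polybd_hC.
have thG1 z : absc z < 1 -> absc (w z) < 1 ->
    th (fun y => Pow h1C (w y)) z (Pow h2C (w z) * aF z ^+ 2).
  by move=> z1 w1; apply: (th_comp_log (thw z z1)); exact: th_Pow w1 polybd_h1C.
have thh z : absc z < 1 -> absc (w z) < 1 -> th h z (Dh z).
  move=> z1 w1; have b0 := bF_neq0 z1.
  have := th_div b0 (thG0 z z1 w1) (th_bF z1).
  by move/th_eq; apply; rewrite /Dh /v; field.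
(* [Y] is differentiated through [Y = (a^2 - 1) / 12], which reduces [D Y] to [D a]. *)
have thv z : absc z < 1 -> th v z (- 2 * (z * dLam (fun n => n%:R) z)
   - aF z * ((aF z - betaF z) / 3 - aF z * (2 * XF z - 3 * YF z)) / 6).
  move=> z1; have pn : polybd (fun n => n%:R : C) by exact: polybd_fst.
  have h1 := thM (th_cst (- 2) z) (th_Lam z1 pn).
  have h2 := thM (th_cst (12^-1) z) (thB (thX 2 (th_aF z1)) (th_cst 1 z)).
  have h3 : th YF z (aF z * ((aF z - betaF z) / 3 - aF z * (2 * XF z - 3 * YF z)) / 6).
    apply: (th_near (f := fun y => 12^-1 * (aF y ^+ 2 - 1))).
      exists (1 - absc z); first by rewrite subr_gt0.
      move=> y yz; rewrite aF_sqr; first by field.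
      have : absc y <= absc z + absc (y - z) by rewrite -{1}(subrK z y) addrC abscD.
      by lra.
    by apply: th_eq h2 _; rewrite /=; field.
  by apply: th_eq (thB h1 h3) _; ring.
(* The equation of [F] removes the second derivative, [aF_cube] removes [beta], [dLam_n] and
   [aF_sqr] remove [D X] and [Y]. What remains is a rational identity in [a], [X], [w], [b], [F] and
   [w d/dw F], with [1 + w] invertible since [|w| < 1]. *)
have thDh z : absc z < 1 -> absc (w z) < 1 -> th Dh z 0.
  move=> z1 w1; have b0 := bF_neq0 z1; have be0 := betaF_neq0 z1.
  have w10 : 1 + w z != 0.
    rewrite -absc_eq0 gt_eqF//.
    have : absc (1 : C) <= absc (1 + w z) + absc (w z) by rewrite -{1}(addrK (w z) 1) abscB.
    by rewrite absc1; lra.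
  have a3 := aF_cube z1; rewrite -/(w z) in a3.
  have ode : Pow h2C (w z) = - w z * (2 / 3 * Pow h1C (w z) + Pow hC (w z) / 9) / (1 + w z).
    by rewrite -hyp_ode// mulrAC mulfV// mul1r.
  have hX := dLam_n z1; have hY := aF_sqr z1.
  have dX : z * dLam (fun n => n%:R) z = - (1 - 48 * XF z + 576 * XF z ^+ 2 - 9 * aF z ^+ 4
     + 8 * aF z * betaF z) / 288 by rewrite -hX; field.
  have YE : YF z = (aF z ^+ 2 - 1) / 12 by rewrite hY; field.
  have bE : betaF z = aF z ^+ 3 / (1 + w z) by rewrite a3; field.
  have := th_div b0 (thB (thM (thX 2 (th_aF z1)) (thG1 z z1 w1))
    (thM (thv z z1) (thG0 z z1 w1))) (th_bF z1).
  move/th_eq; apply; rewrite /v dX ode bE YE /=.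
  by field; rewrite b0 w10.
(* [Dh] is constant on each shorter segment from 0 to [s q], and vanishes at 0 because [X], [Y] and
   the constant term of [w d/dw F] do. *)
have Dh0 (s : R) : 0 <= s <= 1 -> Dh (s%:C * q) = 0.
  move=> s01; have -> : Dh (s%:C * q) = Dh 0.
    have ray2 (s' : R) : 0 <= s' <= 1 -> s'%:C * (s%:C * q) = (s' * s)%:C * q /\ 0 <= s' * s <= 1.
      move=> /andP[s0 s1]; split; first by rewrite mulrA -rmorphM.
      by have [s0' s1'] := andP s01; rewrite mulr_ge0 //= mulr_ile1.
    apply: th0_ray => s' s01'; last first.
      have [|-> hs] := ray2 s'; first by case/andP: s01' => ? ?; rewrite !ltW.
      by apply: thDh; [exact: ray|exact: tq].
    have [//|-> hs] := ray2 s'.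
    by apply: th_cvg (thDh _ (ray _ hs) (tq _ hs)).
  rewrite /Dh /v /XF /YF /w /tF !Lam_at0 mul0r mulr0 !Pow_at0 /h1C.
  by rewrite mul0r !mulr0 subr0 mul0r subrr mul0r.
have : h q = h 0.
  apply: th0_ray => s s01; first exact: th_cvg (thh _ (ray _ s01) (tq _ s01)).
  have s01' : 0 <= s <= 1 by case/andP: s01 => ? ?; rewrite !ltW.
  by rewrite -(Dh0 s s01'); exact: thh (ray _ s01') (tq _ s01').
rewrite /h /w [tF 0]/tF mul0r mulr0 Pow_at0 hC_0.
rewrite [bF 0]/bF /eulerq3 expr0n /= euler_at0 expr1n !divr1.
by move/(canRL (divfK (bF_neq0 q1))); rewrite mul1r.
Qed.

End Hypergeometric.

(** * q-expansions and the nome *)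

Section LambertPower.
Context {R : realType}.
Local Notation C := (Cplx R).

Lemma lamb_multiples (q : C) d M : absc q < 1 -> (0 < d)%N -> (0 < M)%N ->
  absc (lamb q d - \sum_(1 <= n < M | (d %| n)%N) q ^+ n) <= (1 - absc q)^-1 * absc q ^+ M.
Proof.
move=> q1 d0 M0.
have h := one_subX_neq0 q1 d0.
(* [c] is the least multiple of [d] that is at least [M]; the remainder of the geometric series is
   [q^c / (1 - q^d)]. *)
have [c [Mc dc cM E]] : exists c, [/\ (M <= c)%N, (d %| c)%N, (c < M + d)%N &
    (lamb q d - \sum_(1 <= n < M | (d %| n)%N) q ^+ n) * (1 - q ^+ d) = q ^+ c].
  elim: M M0 => // -[|M] ih _.
    exists d; split=> //.
    by rewrite big_geq// subr0 /lamb divfK.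
  have [c [Mc dc cM E]] := ih isT.
  have sE : \sum_(1 <= n < M.+2 | (d %| n)%N) q ^+ n =
      \sum_(1 <= n < M.+1 | (d %| n)%N) q ^+ n + (if (d %| M.+1)%N then q ^+ M.+1 else 0).
    by rewrite big_mkcond big_nat_recr//= -big_mkcond.
  have [dM|dM] := boolP (d %| M.+1)%N; rewrite sE; last first.
    exists c; split=> //; last by rewrite (negbTE dM) addr0.
    - by rewrite ltn_neqAle Mc andbT; apply: contraNneq dM => ->.
    - by rewrite (ltn_trans cM)// ltn_add2r.
  have cE : c = M.+1.
    apply/eqP; rewrite eqn_leq Mc andbT leqNgt; apply/negP => p.
    have p1 : (0 < c - M.+1)%N by rewrite subn_gt0.
    have p2 : (c - M.+1 < d)%N by rewrite ltn_subLR.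
    by have := gtnNdvd p1 p2; rewrite dvdn_sub.
  exists (c + d)%N; rewrite dM; split.
  - by rewrite cE -addn1 leq_add2l.
  - by rewrite dvdn_add.
  - by rewrite cE ltn_add2r.
  - by rewrite opprD addrA mulrDl E cE exprD; ring.
have -> : lamb q d - \sum_(1 <= n < M | (d %| n)%N) q ^+ n = q ^+ c / (1 - q ^+ d).
  by rewrite -E mulfK.
have h1 := one_subX_ge (lexx _) q1 d0.
have q1' : 0 < 1 - absc q by rewrite subr_gt0.
rewrite abscM abscV abscX mulrC ler_pM ?invr_ge0 ?absc_ge0 ?exprn_ge0 ?absc_ge0//.
  by rewrite lef_pV2 ?posrE// (lt_le_trans q1').
by rewrite -(subnKC Mc) exprD ler_piMr ?exprn_ge0 ?absc_ge0// exprn_ile1 ?absc_ge0// ltW.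
Qed.

Lemma sum_divisors (V : nmodType) (F : nat -> V) n M : (0 < n)%N -> (n < M)%N ->
  \sum_(d <- divisors n) F d = \sum_(1 <= d < M | (d %| n)%N) F d.
Proof.
move=> n0 nM; rewrite -[RHS]big_filter; apply: perm_big; apply: uniq_perm.
- exact: divisors_uniq.
- by rewrite filter_uniq// iota_uniq.
move=> d; rewrite mem_filter mem_index_iota -dvdn_divisors//.
case dn: (d %| n)%N => //=; rewrite (dvdn_gt0 n0 dn) /=.
by rewrite (leq_ltn_trans _ nM)// dvdn_leq.
Qed.

(** After interchanging the finite sums, each [k < N] leaves the tail of the expansion of [u_k] over
    the multiples of [k], of order [|q|^N]; the growth of [g] and the number of terms are absorbed
    by [poly_geometric]. *)
Lemma lambert_power (g : nat -> C) (q : C) : absc q < 1 -> polybd g ->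
  (fun N => \sum_(1 <= n < N) (\sum_(d <- divisors n) g d) * q ^+ n) @ \oo --> Lam g q.
Proof.
move=> q1 pg.
suff D : (fun N => series (fun n => g n * lamb q n) N -
    \sum_(1 <= n < N) (\sum_(d <- divisors n) g d) * q ^+ n) @ \oo --> (0 : C).
  have := sqB (Lam_cvg q1 pg) D; rewrite subr0; apply: sq_near.
  by apply: nearW => n; rewrite subKr.
have [A [d [A0 HA]]] := polybdP pg.
have r01 : 0 <= absc q < 1 by rewrite absc_ge0.
have [K [rho [K0 rho01 H]]] := poly_geometric d.+1 r01.
have c0 : 0 <= (1 - absc q)^-1 by rewrite invr_ge0 subr_ge0 ltW.
apply: (@cvg_absc_squeeze _ _ _ (fun M => A * (1 - absc q)^-1 * K * rho ^+ M));
  last exact: geometric_cvg0.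
case=> [|M].
  rewrite subr0 /series /= !big_nil subrr absc0 expr0 mulr1.
  by rewrite !mulr_ge0.
have -> : \sum_(1 <= n < M.+1) (\sum_(d <- divisors n) g d) * q ^+ n =
    \sum_(1 <= k < M.+1) g k * \sum_(1 <= n < M.+1 | (k %| n)%N) q ^+ n.
  rewrite (eq_big_nat _ _ (F2 := fun n => \sum_(1 <= k < M.+1)
    if (k %| n)%N then g k * q ^+ n else 0)); last first.
    move=> n /andP[n0 nM]; rewrite (sum_divisors _ n0 nM) mulr_suml -big_mkcond.
    by [].
  rewrite exchange_big /=; apply: eq_bigr => k _.
  by rewrite mulr_sumr -big_mkcond.
have -> : series (fun n => g n * lamb q n) M.+1 = \sum_(1 <= k < M.+1) g k * lamb q k.
  by rewrite /series /= big_nat_recl// lamb0 mulr0 add0r big_add1.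
rewrite subr0 -sumrB (le_trans (absc_sum _ _ _))//.
apply: (@le_trans _ _ (\sum_(1 <= k < M.+1) A * M.+2%:R ^+ d * ((1 - absc q)^-1 * absc q ^+ M.+1))).
  apply: ler_sum_nat => k /andP[k0 kM]; rewrite -mulrBr abscM.
  apply: ler_pM; rewrite ?absc_ge0//; last exact: lamb_multiples.
  rewrite (le_trans (HA k))// ler_wpM2l// lerXn2r ?nnegrE// ler_nat ltnS.
  exact: ltnW.
rewrite sumr_const_nat subn1 -[leLHS]mulr_natl /=.
apply: (@le_trans _ _ (A * (1 - absc q)^-1 * (M.+2%:R ^+ d.+1 * absc q ^+ M.+1))); last first.
  by rewrite -[leRHS]mulrA ler_wpM2l ?mulr_ge0.
rewrite (exprS M.+2%:R); set u := M.+2%:R ^+ d; set z := absc q ^+ M.+1; set c := (1 - absc q)^-1.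
rewrite [leLHS](_ : _ = M%:R * (A * c * (u * z))); last by ring.
rewrite [leRHS](_ : _ = M.+2%:R * (A * c * (u * z))); last by ring.
apply: ler_wpM2r; last by rewrite ler_nat (leq_trans (leqnSn _)).
by rewrite !mulr_ge0// ?exprn_ge0// absc_ge0.
Qed.

Lemma sigma4_chi3E n : ((sigma4_chi3 n)%:~R : C) = \sum_(d <- divisors n) n4chi d.
Proof.
rewrite /sigma4_chi3 rmorph_sum /=; apply: eq_bigr => d _.
by rewrite intrM /n4chi /chi rmorphXn /= mulrC.
Qed.

Lemma polybd_n4chi : polybd (n4chi : nat -> C).
Proof.
by apply: polybdM; [apply: polybdX; exact: polybd_fst|exact: (polybd_chi (fun n _ => n))].
Qed.

Lemma sigma4_cvg q : absc q < 1 ->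
  (fun N => \sum_(1 <= n < N) (sigma4_chi3 n)%:~R * q ^+ n : C) @ \oo --> Lam n4chi q.
Proof.
move=> q1; have := lambert_power q1 polybd_n4chi; apply: sq_near.
by apply: nearW => N; apply: eq_bigr => n _; rewrite sigma4_chi3E.
Qed.

Lemma cvgc_bounded (z : nat -> C) (l : C) : z @ \oo --> l -> exists B : R, forall n, absc (z n) <= B.
Proof.
move=> /cvg_absP /(_ _ ltr01)[M HM].
exists (\sum_(k < M) absc (z k) + (absc l + 1)) => n.
have s0 : 0 <= \sum_(k < M) absc (z k) by apply: sumr_ge0 => k _; exact: absc_ge0.
have [Mn|nM] := leqP M n.
  have : absc (z n) <= absc (z n - l) + absc l by rewrite -{1}(subrK l (z n)) abscD.
  by have := HM n Mn; lra.
rewrite (bigD1 (Ordinal nM)) //=.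
have t0 : 0 <= \sum_(i < M | i != Ordinal nM) absc (z i) by apply: sumr_ge0 => k _; exact: absc_ge0.
by have := absc_ge0 l; lra.
Qed.

(** Convergence at the single radius [r = e / 2] bounds [|d_n| r^n]. At the smaller points [x r] the
    lowest coefficient is then compared with a geometric tail as [x] tends to 0. *)
Lemma power_series_unique (d : nat -> C) (e : R) : 0 < e ->
  (forall q : C, q != 0 -> absc q < e ->
     (fun N => \sum_(1 <= n < N) d n * q ^+ n) @ \oo --> (0 : C)) ->
  forall n, (0 < n)%N -> d n = 0.
Proof.
move=> e0 H; elim/ltn_ind => m ih m0.
pose r := e / 2; have r0 : 0 < r by rewrite divr_gt0.
have rC (x : R) : 0 < x -> (x%:C : C) != 0.
  by move=> x0; rewrite -absc_eq0 absc_real normr_eq0 gt_eqF.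
have ar (x : R) : 0 < x -> absc (x%:C : C) = x by move=> x0; rewrite absc_real gtr0_norm.
have [B HB] : exists B : R, forall n, (0 < n)%N -> absc (d n) * r ^+ n <= B.
  have re : absc (r%:C : C) < e by rewrite ar// /r; lra.
  have [B HB] := cvgc_bounded (H _ (rC r r0) re).
  exists (B + B) => n n0; rewrite -(ar r r0) -abscX -abscM.
  have -> : d n * r%:C ^+ n = \sum_(1 <= k < n.+1) d k * r%:C ^+ k - \sum_(1 <= k < n) d k * r%:C ^+ k.
    by rewrite big_nat_recr//=; ring.
  by rewrite (le_trans (abscB _ _))// lerD.
have B0 : 0 <= B by apply: le_trans (HB m m0); rewrite mulr_ge0 ?absc_ge0 ?exprn_ge0// ltW.
(* As the earlier coefficients vanish, [d_m (x r)^m] is minus the sum of the later terms, at most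
   [B x^(m+1) / (1 - x)]; dividing by [x^m] and using [1 / (1 - x) <= 2] gives the bound. *)
have key (x : R) : 0 < x <= 1 / 2 -> absc (d m) * r ^+ m <= 2 * B * x.
  move=> /andP[x0 x1]; have xr0 : 0 < x * r by rewrite mulr_gt0.
  have xre : absc ((x * r)%:C : C) < e by rewrite ar// /r; nra.
  have hx := H _ (rC _ xr0) xre.
  have h2 : (fun N => \sum_(1 <= n < N + m.+1) d n * (x * r)%:C ^+ n) @ \oo --> (0 : C).
    by move: hx; rewrite -(cvg_shiftn m.+1).
  have h3 := sqB (sq_cst (d m * (x * r)%:C ^+ m)) h2.
  rewrite subr0 in h3.
  have rho01 : 0 <= x < 1 by rewrite ltW//=; lra.
  have : absc (d m * (x * r)%:C ^+ m) <= B * x ^+ m.+1 / (1 - x).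
    apply: (cvg_absc_le _ h3) => N.
    have -> : \sum_(1 <= n < N + m.+1) d n * (x * r)%:C ^+ n =
        d m * (x * r)%:C ^+ m + \sum_(m.+1 <= n < N + m.+1) d n * (x * r)%:C ^+ n.
      rewrite (big_cat_nat (n := m.+1)) ?leq_addl//=; congr (_ + _).
      rewrite big_nat_recr//= big_nat_cond big1 ?add0r// => k.
      by rewrite andbT => /andP[k0 km]; rewrite ih// mul0r.
    rewrite opprD addrA subrr add0r abscN (le_trans (absc_sum _ _ _))//.
    rewrite (le_trans _ (sum_geometric_le m.+1 (N + m.+1) B0 rho01))//.
    apply: ler_sum_nat => n /andP[mn _]; rewrite abscM abscX ar// exprMn mulrCA mulrC.
    by rewrite ler_wpM2r ?exprn_ge0 ?(ltW x0)// HB// (leq_trans _ mn).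
  rewrite abscM abscX ar// exprMn => h.
  have xm0 : 0 < x ^+ m by exact: exprn_gt0.
  rewrite -(ler_pM2r xm0).
  have -> : absc (d m) * r ^+ m * x ^+ m = absc (d m) * (x ^+ m * r ^+ m) by ring.
  apply: (le_trans h).
  rewrite exprS [leLHS](_ : _ = B * x * x ^+ m * (1 - x)^-1); last by ring.
  rewrite [leRHS](_ : _ = B * x * x ^+ m * 2); last by ring.
  rewrite ler_wpM2l ?mulr_ge0 ?(ltW x0) ?(ltW xm0)//.
  rewrite -[leRHS]invrK lef_pV2 ?posrE ?invr_gt0//; lra.
apply/eqP; rewrite -absc_eq0; apply/negPn/negP => dm0.
have p : 0 < absc (d m) * r ^+ m.
  by rewrite mulr_gt0 ?exprn_gt0// lt_neqAle absc_ge0 andbT eq_sym.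
set P := absc (d m) * r ^+ m in p key.
(* This [x] gives [2 B x <= P / 2], so that [key] contradicts [P > 0]; the [B + 1] covers the case
   [B = 0]. *)
have x0 : 0 < Num.min (1 / 2) (P / (4 * (B + 1))) by rewrite lt_min !divr_gt0//; lra.
have := key (Num.min (1 / 2) (P / (4 * (B + 1)))).
rewrite x0 ge_min lexx /= => /(_ isT) h.
have h2 : Num.min (1 / 2) (P / (4 * (B + 1))) <= P / (4 * (B + 1)) by rewrite ge_min lexx orbT.
have h3 : 2 * B * Num.min (1 / 2) (P / (4 * (B + 1))) <= 2 * B * (P / (4 * (B + 1))).
  by rewrite ler_wpM2l// mulr_ge0.
have h4 : 2 * B * (P / (4 * (B + 1))) <= P / 2.
  rewrite mulrA ler_pdivrMr; last by lra.
  nra.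
by lra.
Qed.

End LambertPower.

(** * From the upper half-plane to the punctured disk *)

Section Nome.
Context {R : realType}.
Local Notation C := (Cplx R).

Lemma absc_cexp (z : C) : absc (cexp z) = expR (complex.Re z).
Proof.
rewrite /cexp abscM absc_real gtr0_norm ?expR_gt0//.
by rewrite /absc/= cos2Dsin2 sqrtr1 mulr1.
Qed.

Lemma cexp_neq0 (z : C) : cexp z != 0.
Proof. by rewrite -absc_eq0 absc_cexp gt_eqF// expR_gt0. Qed.

Lemma cexpD (z w : C) : cexp (z + w) = cexp z * cexp w.
Proof.
rewrite /cexp raddfD /= expRD rmorphM.
have -> : complex.Im (z + w) = complex.Im z + complex.Im w by case: z; case: w.
rewrite cosD sinD [RHS]mulrACA; congr (_ * _).
by apply/eqP; rewrite eq_complex /=; apply/andP; split; apply/eqP; ring.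
Qed.

Lemma cexp0 : cexp (0 : C) = 1.
Proof.
rewrite /cexp /= expR0 cos0 sin0 mul1r.
by [].
Qed.

Lemma cexpX (z : C) n : cexp z ^+ n = cexp (n%:R * z).
Proof.
elim: n => [|n ih]; first by rewrite mul0r cexp0.
by rewrite exprS ih -cexpD -natr1 mulrDl mul1r addrC.
Qed.

Lemma absc_nome (tau : C) : absc (nome tau) = expR (- (2 * pi * complex.Im tau)).
Proof. by rewrite absc_cexp; case: tau => a b /=; rewrite mul0r sub0r. Qed.

Lemma absc_nome_lt1 (tau : C) : 0 < complex.Im tau -> absc (nome tau) < 1.
Proof.
move=> t0; rewrite absc_nome -expR0 ltr_expR oppr_lt0 mulr_gt0//.
by rewrite mulr_gt0// pi_gt0.
Qed.

Lemma nome3 (tau : C) : nome (3 * tau) = nome tau ^+ 3.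
Proof. by rewrite /nome cexpX; congr cexp; ring. Qed.

Lemma etaE (tau : C) : eta tau = cexp (two_pi_i * tau / 24) * euler (nome tau).
Proof. by []. Qed.

Lemma eta3E (tau : C) :
  eta (3 * tau) = cexp (two_pi_i * tau / 24) ^+ 3 * eulerq3 (nome tau).
Proof. by rewrite etaE nome3 cexpX; congr (cexp _ * _); ring. Qed.

(** With [c = q^(1/24)], the prefactors of the eta functions combine to [c^36 / c^12 = c^24 = q]. *)
Lemma t_E (tau : C) : 0 < complex.Im tau -> t_ tau = tF (nome tau).
Proof.
move=> t0; have e0 := euler_neq0 (absc_nome_lt1 t0).
have c24 : cexp (two_pi_i * tau / 24) ^+ 24 = nome tau by rewrite cexpX; congr cexp; field.
rewrite /t_ eta3E etaE /tF -[X in X * _ ^+ 12]c24.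
move: (cexp _) (cexp_neq0 (two_pi_i * tau / 24)) (euler _) (eulerq3 _) e0 => c c0 u v u0.
rewrite (exprMn 12 (c ^+ 3) v) (exprMn 12 c u) (exprMn 12 v u^-1) exprVn -exprM (exprD c 24 12).
have := expf_neq0 12 c0; have := expf_neq0 12 u0.
move: (c ^+ 12) (u ^+ 12) => x y y0 x0; field; by rewrite x0 y0.
Qed.

(** Here the prefactors cancel: [c^9 / (c^3)^3 = 1]. *)
Lemma eta_quotientE (tau : C) : 0 < complex.Im tau ->
  eta tau ^+ 9 / eta (3 * tau) ^+ 3 = bF (nome tau) ^+ 3.
Proof.
move=> t0; have e30 := eulerq3_neq0 (absc_nome_lt1 t0).
rewrite eta3E etaE /bF; set c := cexp (two_pi_i * tau / 24).
have c0 : c != 0 := cexp_neq0 _.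
move: (euler (nome tau)) (eulerq3 (nome tau)) c e30 c0 => u v c v0 c0.
by field; rewrite v0 c0.
Qed.

Lemma nome_surj (q : C) : q != 0 -> absc q < 1 ->
  exists tau : C, 0 < complex.Im tau /\ nome tau = q.
Proof.
move=> q0 q1.
have a0 : 0 < absc q by rewrite lt_neqAle absc_ge0 andbT eq_sym absc_eq0.
have p0 : (0 : R) < 2 * pi by rewrite mulr_gt0// pi_gt0.
pose x := complex.Re q / absc q; pose y := complex.Im q / absc q.
have xy : x ^+ 2 + y ^+ 2 = 1.
  have aE : absc q ^+ 2 = complex.Re q ^+ 2 + complex.Im q ^+ 2.
    by rewrite /absc; case: (q) => a b /=; rewrite sqr_sqrtr// addr_ge0// sqr_ge0.
  have an := lt0r_neq0 a0.
  have -> : x ^+ 2 + y ^+ 2 = (complex.Re q ^+ 2 + complex.Im q ^+ 2) / absc q ^+ 2.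
    by rewrite /x /y; field.
  by rewrite -aE mulfV// expf_neq0.
have x1 : -1 <= x <= 1 by have := sqr_ge0 y; nra.
(* [acos] gives an argument in [[0, pi]]; it is negated when the imaginary part is negative. *)
have [th [cth sth]] : exists th : R, cos th = x /\ sin th = y.
  have sy : Num.sqrt (1 - x ^+ 2) = `|y|.
    by rewrite (_ : 1 - x ^+ 2 = y ^+ 2) ?sqrtr_sqr// -xy; ring.
  have [y0|y0] := leP 0 y.
    by exists (acos x); rewrite acosK ?sin_acos// sy ger0_norm.
  by exists (- acos x); rewrite cosN sinN acosK ?sin_acos// sy ltr0_norm// opprK.
exists ((th / (2 * pi)) +i* (- ln (absc q) / (2 * pi))); split.
  by rewrite /= divr_gt0// oppr_gt0 ln_lt0// a0.
rewrite /nome /cexp /two_pi_i /= !mul0r !add0r.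
have key (X : R) : 2 * pi * (X / (2 * pi)) = X by rewrite mulrC divfK// lt0r_neq0.
rewrite !key opprK.
rewrite lnK ?posrE// cth sth /x /y.
move: a0; case: (q) => a b a0.
apply/eqP; rewrite eq_complex /=; apply/andP; split; apply/eqP; field; exact: lt0r_neq0.
Qed.

End Nome.

(** * The cusp domain, the function [C_] and its expansion *)

Section Main.
Context {R : realType}.
Local Notation C := (Cplx R).

(** [xget] selects some [tau] above [q]; by [t_E] the value depends on its nome only. *)
Lemma in_qE (q : C) : q != 0 -> absc q < 1 -> in_q t_ q = tF q.
Proof.
move=> q0 q1; rewrite /in_q; have [tau [t0 tq]] := nome_surj q0 q1.
have : [set tau : C | 0 < complex.Im tau /\ nome tau = q]
    (xget 0 [set tau : C | 0 < complex.Im tau /\ nome tau = q]).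
  by apply: xgetPex; exists tau.
by move: (xget _ _) => x [h0 hq]; rewrite (t_E h0) hq.
Qed.

(** The counterpart of [cusp_domain] in the disk: adding [i y] to [tau] multiplies [q] by
    [exp (- 2 pi y)], so the vertical half-line becomes the segment from [q] to 0, and [s = 0] adds
    the cusp. *)
Definition ray_domain (q : C) : Prop :=
  absc q < 1 /\ forall s : R, 0 <= s <= 1 -> absc (27 * tF (s%:C * q)) < 1.

Lemma ray_domainE (q : C) : ray_domain q -> absc (27 * tF q) < 1.
Proof. by case=> _ /(_ 1); rewrite mul1r; apply; rewrite ler01 lexx. Qed.

Lemma B_series_bF (q : C) : ray_domain q -> B_series (tF q) @ \oo --> bF q ^+ 3.
Proof.
move=> qd; rewrite -(hyp_tF (proj1 qd) (proj2 qd)).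
by apply: B_series_cvg; exact: ray_domainE.
Qed.

Lemma C_E (q : C) : q != 0 -> ray_domain q -> C_ q = gammaF q.
Proof.
move=> q0 qd; have q1 := proj1 qd.
have [d hd dE] := th_tF q1.
have hd' : dv (in_q t_) q d.
  (* [in_q t_] is known to agree with [tF] for [0 < |y| < 1]; this radius keeps [y] away from 0 and
     inside the unit disk. *)
  apply: dv_near hd; exists (Num.min (absc q) (1 - absc q)).
    by rewrite lt_min lt_neqAle absc_ge0 andbT eq_sym absc_eq0 q0 subr_gt0.
  move=> y; rewrite lt_min => /andP[y1 y2]; rewrite in_qE//.
    by apply: contraTneq y1 => ->; rewrite sub0r abscN ltxx.
  have : absc y <= absc q + absc (y - q) by rewrite -{1}(subrK q y) addrC abscD.
  by lra.
rewrite /C_ (dv_derive1 hd') in_qE// (cvg_lim _ (B_series_bF qd))//.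
have t0 := tF_neq0 q1 q0.
rewrite -gammaE// betaFE//.
have -> : aF q ^+ 2 = q * d / tF q by rewrite dE; field.
by ring.
Qed.

Lemma cusp_ray_domain (tau : C) : cusp_domain tau -> ray_domain (nome tau).
Proof.
move=> [t0 ht]; split; first exact: absc_nome_lt1.
move=> s /andP[s0 s1].
have [->|sn0] := eqVneq s 0.
  by rewrite mul0r /tF mul0r mulr0 absc0.
have sp : 0 < s by rewrite lt_neqAle eq_sym sn0.
have p0 : (0 : R) < 2 * pi by rewrite mulr_gt0// pi_gt0.
(* The solution of [exp (- 2 pi y) = s], nonnegative because [s <= 1]. *)
pose y := - ln s / (2 * pi).
have y0 : 0 <= y.
  by rewrite divr_ge0 ?(ltW p0)// oppr_ge0 ln_le0.
have nE : nome (tau + (0 +i* y)) = s%:C * nome tau.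
  rewrite /nome mulrDr cexpD mulrC; congr (_ * _).
  have zE : (two_pi_i * (0 +i* y) : C) = (ln s)%:C.
    apply/eqP; rewrite eq_complex /=; apply/andP; split; apply/eqP; last by ring.
    by rewrite mul0r sub0r /y mulrC divfK ?opprK// lt0r_neq0.
  by rewrite zE /cexp /= cos0 sin0 lnK ?posrE// -[RHS]mulr1.
have i0 : 0 < complex.Im (tau + (0 +i* y)).
  by move: t0; case: (tau) => a b /= b0; rewrite ltr_wpDr.
have := ht y y0; rewrite t_E// nE.
have -> : (1 / 27 : R[i]) = (1 / 27 : R)%:C by rewrite fmorph_div rmorph1 rmorph_nat.
rewrite absc_lt1 => h; rewrite abscM (absc_nat 27).
by lra.
Qed.

Lemma E5E (tau : C) : 0 < complex.Im tau -> 3 * E5 tau = gammaF (nome tau).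
Proof.
move=> t0; rewrite /E5 (cvg_lim _ (sigma4_cvg (absc_nome_lt1 t0)))//.
by rewrite /gammaF; field.
Qed.

(** [tF] is continuous with [tF 0 = 0], and a disk around 0 contains the segments from 0 to its
    points. *)
Lemma near0_ray_domain : exists2 e : R, 0 < e & forall q : C, absc q < e -> ray_domain q.
Proof.
have zero1 : absc (0 : C) < 1 by rewrite absc0.
have /cvgc_atP := th_cvg (th_tF zero1).
have e0 : 0 < 1 / 27 :> R by rewrite divr_gt0.
move=> /(_ _ e0)[d d0 H]; exists (Num.min d 1); first by rewrite lt_min d0 ltr01.
move=> q; rewrite lt_min => /andP[qd q1]; split=> // s s01.
have : absc (s%:C * q - 0) < d by rewrite subr0 (le_lt_trans (absc_ray q s01)).
move=> /H; rewrite [tF 0]/tF mul0r subr0 abscM (absc_nat 27) => h.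
by lra.
Qed.

Lemma q_expansion_gammaF (q : C) : absc q < 1 ->
  (fun N : nat => 1 + \sum_(1 <= n < N) (3 * (sigma4_chi3 n)%:~R) * q ^+ n : C) @ \oo --> gammaF q.
Proof.
move=> q1; have := sqD (sq_cst 1) (sqM (sq_cst 3) (sigma4_cvg q1)).
apply: sq_near; apply: nearW => N; rewrite mulr_sumr; congr (_ + _).
by apply: eq_bigr => n _; rewrite mulrA.
Qed.

(** Near the cusp [C_] equals [gammaF], whose expansion is known. The direct implication is the
    uniqueness of power series coefficients, applied to the difference of the two expansions. *)
Lemma has_q_expansion_C_ (c : nat -> C) :
  has_q_expansion C_ c <->
  (forall n : nat, (0 < n)%N -> c n = 3 * (sigma4_chi3 n)%:~R).
Proof.
have [e e0 He] := near0_ray_domain.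
have CE q : q != 0 -> absc q < e -> C_ q = gammaF q by move=> q0 /He; exact: C_E.
split=> [|cE].
  move=> /near_absP[d d0 Hd].
  suff H n : (0 < n)%N -> c n - 3 * (sigma4_chi3 n)%:~R = 0.
    by move=> n n0; apply/eqP; rewrite -subr_eq0 H.
  apply: (@power_series_unique _ (fun n => c n - 3 * (sigma4_chi3 n)%:~R) (Num.min d e)).
    by rewrite lt_min d0 e0.
  move=> q q0; rewrite lt_min => /andP[qd qe].
  have qd0 : absc (q - 0) < d by rewrite subr0.
  have h1 := Hd q qd0 q0.
  have h2 := q_expansion_gammaF (proj1 (He q qe)).
  rewrite (CE q q0 qe) in h1.
  have := sqB h1 h2; rewrite subrr; apply: sq_near; apply: nearW => N.
  under [RHS]eq_bigr do rewrite mulrBl.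
  by rewrite sumrB; ring.
apply/near_absP; exists e => // q; rewrite subr0 => qe q0.
rewrite CE//; apply: sq_near (q_expansion_gammaF (proj1 (He q qe))).
apply: nearW => N; congr (_ + _); apply: eq_big_nat => n /andP[n0 _].
by rewrite cE.
Qed.

End Main.

Theorem theorem3p1 (R : realType) :
  [/\ forall tau : Cplx R, cusp_domain tau ->
        B_series (t_ tau) @ \oo --> (eta tau ^+ 9 / eta (3 * tau) ^+ 3 : Cplx R),
      forall tau : Cplx R, cusp_domain tau -> C_ (nome tau) = 3 * E5 tau
    & forall c : nat -> Cplx R,
        has_q_expansion C_ c <->
        (forall n : nat, (0 < n)%N -> c n = 3 * (sigma4_chi3 n)%:~R) ].
Proof.
split=> [tau td|tau td|c].
- have t0 := proj1 td; rewrite t_E// eta_quotientE//.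
  by apply: B_series_bF; exact: cusp_ray_domain.
- rewrite E5E ?(proj1 td)//; apply: C_E; last exact: cusp_ray_domain.
  exact: cexp_neq0.
- exact: has_q_expansion_C_.
Qed.
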